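(* Let $0<\alpha<\pi/4$ and let $G_\alpha$ be the closed set of $s=\sigma+it$ with $|t|\tan 2\alpha\le 1-\sigma$. Then, as $|s|\to\infty$ with $s\in G_\alpha$, $$\mathcal{R}(s)=\frac{e^{-\pi i/8}}{\sqrt2}\,\chi(s)\,\eta^{s-1}e^{\pi i(\eta-\eta^2)}\bigl(1+O(|\eta|^{-1})\bigr).$$
   Context: $\mathcal{R}(s)=\int_{0\swarrow 1}\frac{x^{-s}e^{\pi i x^2}}{e^{\pi i x}-e^{-\pi i x}}\,dx$ (Riemann's auxiliary function), where $0\swarrow1$ is a straight line of direction $e^{-3\pi i/4}$ crossing the real axis in $(0,1)$ and $x^{-s}$ is the principal branch. $\chi(s)=\pi^{s-1/2}\Gamma(\frac{1-s}{2})/\Gamma(\frac s2)$. $\eta:=\sqrt{(s-1)/(2\pi i)}$ with $-\pi/4<\arg\eta<3\pi/4$; $\eta^{s-1}$ is the principal power. *)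

(* Defs.v *)
From Stdlib Require Import Reals.
From Coquelicot Require Import Coquelicot.
From Stdlib Require Import Factorial.

Open Scope R_scope.

Definition cexp (z : C) : C :=
  (exp (Re z) * cos (Im z), exp (Re z) * sin (Im z)).

(** Principal argument, with values in (-PI, PI] (0 at the origin). *)
Definition carg (z : C) : R :=
  let x := Re z in let y := Im z in
  if Rlt_dec 0 x then atan (y / x)
  else if Rlt_dec x 0 then
    (if Rle_dec 0 y then atan (y / x) + PI else atan (y / x) - PI)
  else if Rlt_dec 0 y then PI / 2
  else if Rlt_dec y 0 then - (PI / 2)
  else 0.

Definition clog (z : C) : C := (ln (Cmod z), carg z).

Definition cpow (z w : C) : C :=
  if Ceq_dec z 0 then 0%C else cexp (Cmult w (clog z)).

Definition csqrt (z : C) : C := cpow z (RtoC (/ 2)).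

(** Limit of a complex sequence (meaningful when it converges). *)
Definition clim (u : nat -> C) : C := @lim C_CompleteNormedModule (filtermap u eventually).

Fixpoint prodz (z : C) (n : nat) : C :=
  match n with
  | O => z
  | S m => Cmult (prodz z m) (Cplus z (RtoC (INR n)))
  end.

(** Reciprocal Gamma function (entire), via Euler--Gauss:
    1/Gamma(z) = lim_n z(z+1)...(z+n) / (n! n^z). *)
Definition rgamma (z : C) : C :=
  clim (fun n : nat =>
    Cdiv (prodz z n)
         (Cmult (RtoC (INR (fact n))) (cexp (Cmult z (RtoC (ln (INR n))))))).

(** Gamma function (off its poles): Gamma(z) = 1 / (1/Gamma(z)). *)
Definition cgamma (z : C) : C := Cinv (rgamma z).

Definition chi (s : C) : C :=
  Cmult (Cmult (cpow (RtoC PI) (Cminus s (RtoC (/ 2))))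
               (cgamma (Cdiv (Cminus 1%C s) (RtoC 2))))
        (rgamma (Cdiv s (RtoC 2))).

(** Direction e^{-3 pi i/4} of the line 0 \swarrow 1. *)
Definition omega : C := cexp (0, - (3 * PI / 4)).

Definition Rintegrand (s x : C) : C :=
  Cdiv (Cmult (cpow x (Copp s)) (cexp (Cmult (Cmult (RtoC PI) Ci) (Cmult x x))))
       (Cminus (cexp (Cmult (Cmult (RtoC PI) Ci) x))
               (cexp (Copp (Cmult (Cmult (RtoC PI) Ci) x)))).

(** Riemann's auxiliary function R(s), integrating along the straight line
    x = c + u * omega (u from -oo to +oo), which crosses the real axis at c. *)
Definition RiemannR (c : R) (s : C) : C :=
  @RInt_gen C_R_CompleteNormedModule
    (fun u : R => Cmult (Rintegrand s (Cplus (RtoC c) (Cmult (RtoC u) omega))) omega)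
    (Rbar_locally m_infty) (Rbar_locally p_infty).

(** eta = sqrt((s-1)/(2 pi i)) with -pi/4 < arg eta < 3pi/4. *)
Definition eta (s : C) : C :=
  let w := csqrt (Cdiv (Cminus s 1%C) (Cmult (RtoC (2 * PI)) Ci)) in
  if Rlt_dec (- (PI / 4)) (carg w) then w else Copp w.

Definition mainterm (s : C) : C :=
  Cmult (Cmult (Cmult (Cdiv (cexp (0, - (PI / 8))) (RtoC (sqrt 2))) (chi s))
               (cpow (eta s) (Cminus s 1%C)))
        (cexp (Cmult (Cmult (RtoC PI) Ci) (Cminus (eta s) (Cmult (eta s) (eta s))))).

Definition G_alpha (alpha : R) (s : C) : Prop :=
  Rabs (Im s) * tan (2 * alpha) <= 1 - Re s.

(* Main.v *)
Require Import Defs.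
From Stdlib Require Import Reals Lra Lia Psatz Factorial.
From Coquelicot Require Import Coquelicot.
Open Scope R_scope.

(** Write [s = 1 - Lam] with [Lam = -2 pi i eta^2], so that [Re Lam >= k |Lam|]
in [G_alpha], and let [f] be the integrand.  For [Re s] very negative [f]
vanishes at [0], and [F z = int_0^1 z f(tz) dt] is a primitive of [f] on a
star-shaped domain containing the line through [c] and the ray through [eta].
Moving both ends of the line to the rays spanned by [eta] and [-eta], and using
[f(-x) = - e^(pi i s) f(x)], gives [R(s) = (e^(pi i s) - 1) L] with
[L = lim F(r eta)] as [r -> +oo].

On [x = r eta] one has [x^(1-s) e^(pi i x^2) = const * exp(Lam phi(r))] with the
real phase [phi(r) = log r - r^2/2 + 1/2 <= -(r-1)^2/2], so Laplace's method
compares [F(r eta)] with a Gaussian integral up to [O(|eta|^-2)].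

On the other side, the Euler-Gauss limit gives Stirling's formula in the right
half-plane by telescoping, and the reflection formula, obtained from the
product for [sin (pi z)] by integrating [cos^(2m) t cos(2zt)], turns
[1/Gamma(s/2)] into [sin(pi s/2) Gamma(1-s/2)/pi].  Hence [chi(s)] is
[1 - e^(pi i s)] times an explicit exponential times [1 + O(|s|^-1)]; this factor
is also the one found in [R(s)], so the quotient stays controlled near the zeros. *)

(** * Complex-valued calculus along a real parameter *)


(** No Cauchy theorem is used: contours move only through differences of the primitive [F]
    ([ray_prim]), bounded by the length of a segment times the supremum of the integrand on it. The
    centre of the star is the branch point 0, so limits of the integrand and of [x] times its
    derivative are needed there; [Re s <= -4] supplies them through a cubic bound. The comparison
    with the Gaussian is made between derivatives in the real parameter [r]: they differ by at most
    a constant times [1 / (N (1 + N^2 (r-1)^2))] with [N = |eta|]. A primitive of this bound is an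
    arctangent, so the total error is [O(N^-2)], while the Gaussian integral has size [1/N]; hence
    the relative error [1/N]. The factor [e^(-pi i/8)] is left over when the square is completed by
    the shift [1/4]. In Stirling's formula only the square of the constant matters, because [chi]
    reduces to a product of two Gamma values; the reflection formula on [Re w = 1/2] yields that
    square. *)

Lemma C_eq (a b : C) : Re a = Re b -> Im a = Im b -> a = b.
Proof. destruct a, b; simpl; intros; subst; reflexivity. Qed.

Lemma RtoC_neq (x y : R) : x <> y -> RtoC x <> RtoC y.
Proof. intros H E. apply H. apply RtoC_inj. exact E. Qed.

Lemma Cmod_le_sum (z : C) : Cmod z <= Rabs (Re z) + Rabs (Im z).
Proof.
  unfold Cmod, Re, Im. destruct z as [a b]; simpl fst; simpl snd.
  pose proof (Rabs_pos a). pose proof (Rabs_pos b).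
  rewrite <- (sqrt_pow2 (Rabs a + Rabs b)) by lra.
  apply sqrt_le_1_alt. rewrite <- (pow2_abs a), <- (pow2_abs b). nra.
Qed.

Lemma Im_le_Cmod (z : C) : Rabs (Im z) <= Cmod z.
Proof.
  unfold Cmod, Im. destruct z as [a b]; simpl fst; simpl snd.
  rewrite <- (sqrt_pow2 (Rabs b)) by apply Rabs_pos.
  apply sqrt_le_1_alt. rewrite pow2_abs. nra.
Qed.

Lemma Cmod_minus_sym (a b : C) : Cmod (a - b) = Cmod (b - a).
Proof. rewrite <- Cmod_opp. f_equal. ring. Qed.

Lemma Cmod_triangle_minus (a b : C) : Cmod (a - b) <= Cmod a + Cmod b.
Proof. rewrite <- (Cmod_opp b). apply Cmod_triangle. Qed.

Lemma Cmod_sub_ge (a b : C) : Cmod a - Cmod b <= Cmod (a - b).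
Proof.
  pose proof (Cmod_triangle (a - b) b). replace (a - b + b)%C with a in H by ring. lra.
Qed.

(** Holomorphy is only ever used along differentiable real curves, so two real derivatives are
    enough and the real derivative lemmas carry over. *)
Definition Cder (g : R -> C) (x : R) (l : C) : Prop :=
  is_derive (fun t => Re (g t)) x (Re l) /\ is_derive (fun t => Im (g t)) x (Im l).

Lemma Cder_eq g x l l' : Cder g x l -> l = l' -> Cder g x l'.
Proof. intros H <-; exact H. Qed.

Lemma Cder_ext_loc f g x l : locally x (fun t => f t = g t) -> Cder f x l -> Cder g x l.
Proof.
  intros E [H1 H2]; split; [eapply is_derive_ext_loc; [|exact H1] | eapply is_derive_ext_loc; [|exact H2]];
  revert E; apply filter_imp; intros t ->; reflexivity.
Qed.

Lemma Cder_ext f g x l : (forall t, f t = g t) -> Cder f x l -> Cder g x l.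
Proof. intros E; apply Cder_ext_loc; apply filter_forall; exact E. Qed.

Lemma Cder_const c x : Cder (fun _ => c) x 0.
Proof. split; apply @is_derive_const. Qed.

Lemma Cder_id x : Cder (fun t => RtoC t) x 1.
Proof. split; simpl; [apply @is_derive_id | apply @is_derive_const]. Qed.

Lemma is_derive_mult_R (f g : R -> R) x a b :
  is_derive f x a -> is_derive g x b -> is_derive (fun t => f t * g t) x (a * g x + f x * b).
Proof. intros Hf Hg. apply (is_derive_mult f g x a b Hf Hg). intros; apply Rmult_comm. Qed.

Lemma Cder_RtoC (f : R -> R) x a : is_derive f x a -> Cder (fun t => RtoC (f t)) x (RtoC a).
Proof. intros H; split; simpl; [exact H | apply @is_derive_const]. Qed.

Lemma Cder_plus f g x a b : Cder f x a -> Cder g x b -> Cder (fun t => f t + g t)%C x (a + b)%C.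
Proof. intros [H1 H2] [H3 H4]; split; simpl; [apply @is_derive_plus | apply @is_derive_plus]; assumption. Qed.

Lemma Cder_opp f x a : Cder f x a -> Cder (fun t => - f t)%C x (- a)%C.
Proof. intros [H1 H2]; split; simpl; apply @is_derive_opp; assumption. Qed.

Lemma Cder_minus f g x a b : Cder f x a -> Cder g x b -> Cder (fun t => f t - g t)%C x (a - b)%C.
Proof. intros; apply Cder_plus; [assumption | apply Cder_opp; assumption]. Qed.

Lemma Cder_mult f g x a b : Cder f x a -> Cder g x b ->
  Cder (fun t => f t * g t)%C x (a * g x + f x * b)%C.
Proof.
  intros [H1 H2] [H3 H4]; split; simpl.
  - eapply is_derive_ext; [intros t; reflexivity|].
    evar_last; [apply @is_derive_minus; apply is_derive_mult_R; eassumption|].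
    unfold minus, plus, opp, Re, Im; simpl; ring.
  - evar_last; [apply @is_derive_plus; apply is_derive_mult_R; eassumption|].
    unfold minus, plus, opp, Re, Im; simpl; ring.
Qed.

Lemma Cder_scal c f x a : Cder f x a -> Cder (fun t => c * f t)%C x (c * a)%C.
Proof.
  intros H. eapply Cder_eq; [apply Cder_mult; [apply Cder_const | exact H]|]. cbv beta; ring.
Qed.

Lemma Cder_line p v x : Cder (fun t => p + RtoC t * v)%C x v.
Proof.
  eapply Cder_eq; [apply Cder_plus; [apply Cder_const | apply Cder_mult; [apply Cder_id | apply Cder_const]]|].
  cbv beta; ring.
Qed.

Lemma is_derive_exp_R (f : R -> R) x a : is_derive f x a ->
  is_derive (fun t => exp (f t)) x (a * exp (f x)).
Proof. intros H. apply (is_derive_comp exp f x); [apply is_derive_exp | exact H]. Qed.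
Lemma is_derive_cos_R (f : R -> R) x a : is_derive f x a ->
  is_derive (fun t => cos (f t)) x (a * - sin (f x)).
Proof. intros H. apply (is_derive_comp cos f x); [apply is_derive_cos | exact H]. Qed.
Lemma is_derive_sin_R (f : R -> R) x a : is_derive f x a ->
  is_derive (fun t => sin (f t)) x (a * cos (f x)).
Proof. intros H. apply (is_derive_comp sin f x); [apply is_derive_sin | exact H]. Qed.

Lemma Cder_cexp f x a : Cder f x a -> Cder (fun t => cexp (f t)) x (a * cexp (f x))%C.
Proof.
  intros [H1 H2]; split; simpl.
  - evar_last; [apply is_derive_mult_R; [apply is_derive_exp_R | apply is_derive_cos_R]; eassumption|].
    unfold Re, Im; simpl; ring.
  - evar_last; [apply is_derive_mult_R; [apply is_derive_exp_R | apply is_derive_sin_R]; eassumption|].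
    unfold Re, Im; simpl; ring.
Qed.

Lemma Cnz_sq (z : C) : z <> 0%C -> Re z ^ 2 + Im z ^ 2 <> 0.
Proof.
  intros H E. apply H. apply C_eq; simpl; nra.
Qed.

Lemma is_derive_inv_R (f : R -> R) x a : is_derive f x a -> f x <> 0 ->
  is_derive (fun t => / f t) x (- a / (f x) ^ 2).
Proof. intros H1 H2. apply is_derive_inv; assumption. Qed.

Lemma Cder_inv f x a : Cder f x a -> f x <> 0%C -> Cder (fun t => / f t)%C x (- a * (/ f x * / f x))%C.
Proof.
  intros [H1 H2] N. pose proof (Cnz_sq _ N) as N2.
  assert (H : is_derive (fun t => / (Re (f t) ^ 2 + Im (f t) ^ 2)) x
     (- (2 * Re (f x) * Re a + 2 * Im (f x) * Im a) / (Re (f x) ^ 2 + Im (f x) ^ 2) ^ 2)).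
  { apply (is_derive_inv_R (fun t => Re (f t) ^ 2 + Im (f t) ^ 2)); [|exact N2].
    apply (is_derive_ext (fun t => Re (f t) * Re (f t) + Im (f t) * Im (f t))); [intros; simpl; ring|].
    evar_last; [apply @is_derive_plus; apply is_derive_mult_R; eassumption|].
    unfold plus; simpl; ring. }
  split; simpl; unfold Rdiv.
  - evar_last; [apply is_derive_mult_R; [exact H1 | exact H]|].
    unfold Re, Im in *; simpl in *. field. intros E; apply N2; lra.
  - evar_last; [apply is_derive_mult_R; [apply @is_derive_opp; exact H2 | exact H]|].
    unfold opp, Re, Im in *; simpl in *. field. intros E; apply N2; lra.
Qed.

(** * Limits of complex functions along filters *)

Definition CL {T : Type} (F : (T -> Prop) -> Prop) (u : T -> C) (l : C) : Prop :=
  filterlim (fun t => Re (u t)) F (locally (Re l)) /\ filterlim (fun t => Im (u t)) F (locally (Im l)).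

Section CLrules.
Context {T : Type} {F : (T -> Prop) -> Prop} {FF : Filter F}.

Lemma CL_ext_loc u v l : F (fun t => u t = v t) -> CL F u l -> CL F v l.
Proof.
  intros E [H1 H2]; split; [eapply filterlim_ext_loc; [|exact H1] | eapply filterlim_ext_loc; [|exact H2]];
  revert E; apply filter_imp; intros t ->; reflexivity.
Qed.
Lemma CL_ext u v l : (forall t, u t = v t) -> CL F u l -> CL F v l.
Proof. intros E; apply CL_ext_loc; apply filter_forall; exact E. Qed.
Lemma CL_eq u l l' : CL F u l -> l = l' -> CL F u l'.
Proof. intros H <-; exact H. Qed.
Lemma CL_const c : CL F (fun _ => c) c.
Proof. split; apply filterlim_const. Qed.
Lemma filterlim_plus_R (f g : T -> R) a b : filterlim f F (locally a) -> filterlim g F (locally b) ->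
  filterlim (fun t => f t + g t) F (locally (a + b)).
Proof. intros H1 H2. eapply filterlim_comp_2; [exact H1 | exact H2 | apply (@filterlim_plus R_AbsRing R_NormedModule)]. Qed.
Lemma filterlim_mult_R (f g : T -> R) a b : filterlim f F (locally a) -> filterlim g F (locally b) ->
  filterlim (fun t => f t * g t) F (locally (a * b)).
Proof. intros H1 H2. eapply filterlim_comp_2; [exact H1 | exact H2 | apply (@filterlim_mult R_AbsRing)]. Qed.
Lemma filterlim_opp_R (f : T -> R) a : filterlim f F (locally a) ->
  filterlim (fun t => - f t) F (locally (- a)).
Proof. intros H1. eapply filterlim_comp; [exact H1 | apply (@filterlim_opp R_AbsRing R_NormedModule)]. Qed.
Lemma filterlim_cont_R (h : R -> R) (f : T -> R) a : filterlim f F (locally a) -> ex_derive h a ->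
  filterlim (fun t => h (f t)) F (locally (h a)).
Proof.
  intros H1 H2. eapply filterlim_comp; [exact H1|].
  apply (@ex_derive_continuous R_AbsRing R_NormedModule h a H2).
Qed.
Lemma CL_plus u v a b : CL F u a -> CL F v b -> CL F (fun t => u t + v t)%C (a + b)%C.
Proof. intros [] []; split; simpl; apply filterlim_plus_R; assumption. Qed.
Lemma CL_opp u a : CL F u a -> CL F (fun t => - u t)%C (- a)%C.
Proof. intros []; split; simpl; apply filterlim_opp_R; assumption. Qed.
Lemma CL_minus u v a b : CL F u a -> CL F v b -> CL F (fun t => u t - v t)%C (a - b)%C.
Proof. intros; apply CL_plus; [assumption | apply CL_opp; assumption]. Qed.
Lemma CL_mult u v a b : CL F u a -> CL F v b -> CL F (fun t => u t * v t)%C (a * b)%C.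
Proof.
  intros [] []; split; simpl.
  - apply filterlim_plus_R; [|apply filterlim_opp_R]; apply filterlim_mult_R; assumption.
  - apply filterlim_plus_R; apply filterlim_mult_R; assumption.
Qed.
Lemma CL_inv u a : CL F u a -> a <> 0%C -> CL F (fun t => / u t)%C (/ a)%C.
Proof.
  intros [H1 H2] N.
  assert (H : filterlim (fun t => / (Re (u t) ^ 2 + Im (u t) ^ 2)) F (locally (/ (Re a ^ 2 + Im a ^ 2)))).
  { apply (filterlim_cont_R Rinv (fun t => Re (u t) ^ 2 + Im (u t) ^ 2)).
    - apply (filterlim_ext (fun t => Re (u t) * Re (u t) + Im (u t) * Im (u t))); [intros; simpl; ring|].
      replace (Re a ^ 2 + Im a ^ 2) with (Re a * Re a + Im a * Im a) by ring.
      apply filterlim_plus_R; apply filterlim_mult_R; assumption.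
    - apply ex_derive_inv; [apply ex_derive_id | apply Cnz_sq; exact N]. }
  split; simpl; apply filterlim_mult_R; try assumption.
  apply filterlim_opp_R; assumption.
Qed.
Lemma CL_div u v a b : CL F u a -> CL F v b -> b <> 0%C -> CL F (fun t => u t / v t)%C (a / b)%C.
Proof. intros; apply CL_mult; [assumption | apply CL_inv; assumption]. Qed.
Lemma CL_cexp u a : CL F u a -> CL F (fun t => cexp (u t)) (cexp a).
Proof.
  intros [H1 H2]; split; simpl; apply filterlim_mult_R; apply filterlim_cont_R; try assumption;
  auto_derive; trivial.
Qed.
Lemma CL_RtoC (u : T -> R) a : filterlim u F (locally a) -> CL F (fun t => RtoC (u t)) (RtoC a).
Proof. intros H; split; simpl; [exact H | apply filterlim_const]. Qed.

Lemma filterlim_R_eps (f : T -> R) a :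
  filterlim f F (locally a) <-> (forall eps, 0 < eps -> F (fun t => Rabs (f t - a) < eps)).
Proof.
  split.
  - intros H eps He. apply (H (fun y => Rabs (y - a) < eps)). exists (mkposreal _ He). intros y Hy. exact Hy.
  - intros H P [eps HP]. unfold filtermap. generalize (H eps (cond_pos eps)). apply filter_imp.
    intros t Ht. apply HP. exact Ht.
Qed.

Lemma CL_eps u l : CL F u l <-> (forall eps, 0 < eps -> F (fun t => Cmod (u t - l) < eps)).
Proof.
  split.
  - intros [H1 H2] eps He.
    assert (He2 : 0 < eps / 2) by lra.
    generalize (filter_and _ _ (proj1 (filterlim_R_eps _ _) H1 _ He2) (proj1 (filterlim_R_eps _ _) H2 _ He2)).
    apply filter_imp. intros t [A B].
    eapply Rle_lt_trans; [apply Cmod_le_sum|].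
    unfold Re, Im in *; simpl in *. unfold Rminus in *. lra.
  - intros H; split; apply filterlim_R_eps; intros eps He; generalize (H eps He); apply filter_imp; intros t Ht;
    eapply Rle_lt_trans; [|exact Ht | |exact Ht].
    + exact (re_le_Cmod (u t - l)).
    + exact (Im_le_Cmod (u t - l)).
Qed.

Lemma CL_squeeze u l (v : T -> R) : F (fun t => Cmod (u t - l) <= v t) ->
  filterlim v F (locally 0) -> CL F u l.
Proof.
  intros H1 H2. apply CL_eps. intros eps He.
  generalize (filter_and _ _ H1 (proj1 (filterlim_R_eps _ _) H2 _ He)). apply filter_imp.
  intros t [A B]. eapply Rle_lt_trans; [exact A|]. rewrite Rminus_0_r in B.
  eapply Rle_lt_trans; [apply Rle_abs|exact B].
Qed.
End CLrules.

Lemma CL_bound {T} {F : (T -> Prop) -> Prop} {FF : ProperFilter F} (u : T -> C) l B :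
  CL F u l -> F (fun t => Cmod (u t) <= B) -> Cmod l <= B.
Proof.
  intros H1 H2. apply le_epsilon. intros eps He.
  destruct (filter_ex _ (filter_and _ _ (proj1 (CL_eps _ _) H1 eps He) H2)) as [t [A C]].
  pose proof (Cmod_triangle_minus (u t) (u t - l)). replace (u t - (u t - l))%C with l in H by ring. lra.
Qed.

Lemma CL_unique {T} {F : (T -> Prop) -> Prop} {FF : ProperFilter F} (u : T -> C) l l' :
  CL F u l -> CL F u l' -> l = l'.
Proof.
  intros H1 H2. assert (H := CL_minus _ _ _ _ H1 H2).
  assert (Cmod (l - l') <= 0).
  { eapply CL_bound; [exact H|]. apply filter_forall. intros t.
    replace (u t - u t)%C with (RtoC 0) by ring. rewrite Cmod_0. lra. }
  apply Ceq_minus. apply Cmod_eq_0. pose proof (Cmod_ge_0 (l - l')). lra.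
Qed.

Lemma CL_comp {T U} {F : (T -> Prop) -> Prop} {G : (U -> Prop) -> Prop} (f : T -> U) (u : U -> C) l :
  filterlim f F G -> CL G u l -> CL F (fun t => u (f t)) l.
Proof. intros H [H1 H2]; split;
  [exact (filterlim_comp _ _ _ f (fun x => Re (u x)) _ _ _ H H1) | exact (filterlim_comp _ _ _ f (fun x => Im (u x)) _ _ _ H H2)]. Qed.

Lemma Cder_CL g x l : Cder g x l -> CL (locally x) g (g x).
Proof.
  intros [H1 H2]; split.
  - apply (@ex_derive_continuous R_AbsRing R_NormedModule). eexists; exact H1.
  - apply (@ex_derive_continuous R_AbsRing R_NormedModule). eexists; exact H2.
Qed.

(** [lim] is specified on Cauchy filters only; convergence makes the image filter Cauchy, and
    uniqueness of limits then identifies the value. *)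
Lemma clim_CL (u : nat -> C) l : CL eventually u l -> clim u = l.
Proof.
  intros [H1 H2]. unfold clim.
  assert (HF : filterlim u eventually (locally (l : C_CompleteNormedModule))).
  { intros P [eps HP]. unfold filtermap.
    generalize (filter_and _ _ (proj1 (filterlim_R_eps _ _) H1 _ (cond_pos eps)) (proj1 (filterlim_R_eps _ _) H2 _ (cond_pos eps))).
    apply filter_imp. intros n [A B]. apply HP. split; [exact A | exact B]. }
  assert (PF : ProperFilter (filtermap u eventually)) by (apply filtermap_proper_filter; apply eventually_filter).
  assert (Hc : cauchy (filtermap u eventually)).
  { intros eps. exists l. apply HF. exists eps. intros y Hy. exact Hy. }
  assert (HL := fun eps => complete_cauchy (T := C_CompleteNormedModule) _ PF Hc eps).
  set (m := @lim C_CompleteNormedModule (filtermap u eventually)) in *.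
  apply (CL_unique (F := eventually) u); split; try assumption; apply filterlim_R_eps; intros eps He;
    generalize (HL (mkposreal _ He)); unfold filtermap; apply filter_imp; intros n [A B]; [exact A | exact B].
Qed.

Lemma CL_cauchy {T} {F : (T -> Prop) -> Prop} {FF : ProperFilter F} (u : T -> C) :
  (forall eps, 0 < eps -> exists P : T -> Prop, F P /\ forall s t, P s -> P t -> Cmod (u t - u s) < eps) ->
  exists L, CL F u L.
Proof.
  intros H.
  destruct (proj1 (filterlim_locally_cauchy (U := R_CompleteSpace) (fun t => Re (u t)))) as [x Hx].
  { intros eps. destruct (H eps (cond_pos eps)) as [P [HP HQ]]. exists P. split; [exact HP|].
    intros s t Hs Ht. eapply Rle_lt_trans; [exact (re_le_Cmod (u t - u s)) | apply HQ; assumption]. }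
  destruct (proj1 (filterlim_locally_cauchy (U := R_CompleteSpace) (fun t => Im (u t)))) as [y Hy].
  { intros eps. destruct (H eps (cond_pos eps)) as [P [HP HQ]]. exists P. split; [exact HP|].
    intros s t Hs Ht. eapply Rle_lt_trans; [exact (Im_le_Cmod (u t - u s)) | apply HQ; assumption]. }
  exists (x, y). split; assumption.
Qed.

(** * Mean value inequalities *)

Lemma mean_value_R (f df : R -> R) a b : a <= b ->
  (forall x, a <= x <= b -> is_derive f x (df x)) -> (forall x, a <= x <= b -> 0 <= df x) -> f a <= f b.
Proof.
  intros Hab H1 H2.
  destruct (MVT_gen f a b df) as [c [Hc E]].
  - intros x Hx. rewrite Rmin_left, Rmax_right in Hx by lra. apply H1; lra.
  - intros x Hx. rewrite Rmin_left, Rmax_right in Hx by lra.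
    apply continuity_pt_filterlim. apply (@ex_derive_continuous R_AbsRing R_NormedModule). eexists; apply H1; lra.
  - rewrite Rmin_left, Rmax_right in Hc by lra. specialize (H2 c Hc).
    assert (0 <= df c * (b - a)) by (apply Rmult_le_pos; lra). lra.
Qed.

(* Project on the direction of h b - h a and compare real derivatives. *)
Lemma mean_value_C (h dh : R -> C) (g dg : R -> R) a b : a <= b ->
  (forall x, a <= x <= b -> Cder h x (dh x)) -> (forall x, a <= x <= b -> is_derive g x (dg x)) ->
  (forall x, a <= x <= b -> Cmod (dh x) <= dg x) -> Cmod (h b - h a) <= g b - g a.
Proof.
  intros Hab Hh Hg Hle.
  destruct (Req_dec (Cmod (h b - h a)) 0) as [E | N].
  - rewrite E. assert (g a <= g b); [|lra].
    apply (mean_value_R g dg a b Hab Hg). intros x Hx. eapply Rle_trans; [apply Cmod_ge_0 | apply Hle; exact Hx].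
  - set (w := Cconj (h b - h a)). set (m := Cmod (h b - h a)) in *.
    assert (Hm : 0 < m) by (pose proof (Cmod_ge_0 (h b - h a)); unfold m in *; lra).
    assert (Hw : Cmod w = m) by (unfold w; apply Cmod_conj).
    assert (HQ : m * g a - Re (w * h a) <= m * g b - Re (w * h b)).
    { apply (mean_value_R (fun x => m * g x - Re (w * h x)) (fun x => m * dg x - Re (w * dh x))); trivial.
      - intros x Hx. apply (is_derive_minus (K := R_AbsRing) (V := R_NormedModule)).
        + apply is_derive_scal. apply Hg; exact Hx.
        + apply (proj1 (Cder_scal w h x _ (Hh x Hx))).
      - intros x Hx. specialize (Hle x Hx).
        pose proof (re_le_Cmod (w * dh x)). rewrite Cmod_mult, Hw in H.
        pose proof (Rle_abs (Re (w * dh x))). nra. }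
    assert (E : Re (w * h b) - Re (w * h a) = m ^ 2).
    { unfold m. rewrite Cmod2_alt. unfold w. destruct (h a), (h b); unfold Re, Im; simpl. ring. }
    nra.
Qed.

Lemma mean_value_C_const (h dh : R -> C) B a b : a <= b ->
  (forall x, a <= x <= b -> Cder h x (dh x)) ->
  (forall x, a <= x <= b -> Cmod (dh x) <= B) -> Cmod (h b - h a) <= B * (b - a).
Proof.
  intros Hab Hh Hle.
  replace (B * (b - a)) with (B * b - B * a) by ring.
  apply (mean_value_C h dh (fun x => B * x) (fun _ => B)); trivial.
  intros x _. auto_derive; trivial. ring.
Qed.

(** * The complex exponential *)

Lemma cexp_plus a b : cexp (a + b) = (cexp a * cexp b)%C.
Proof.
  destruct a as [a1 a2], b as [b1 b2]. unfold cexp; apply C_eq; simpl; rewrite exp_plus, ?cos_plus, ?sin_plus; ring.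
Qed.
Lemma cexp_0 : cexp 0 = 1%C.
Proof. unfold cexp; apply C_eq; simpl; rewrite exp_0, ?cos_0, ?sin_0; ring. Qed.
Lemma cexp_RtoC (x : R) : cexp (RtoC x) = RtoC (exp x).
Proof. unfold cexp; apply C_eq; simpl; rewrite ?cos_0, ?sin_0; ring. Qed.
Lemma Cmod_cexp z : Cmod (cexp z) = exp (Re z).
Proof.
  unfold cexp, Cmod; simpl fst; simpl snd.
  replace ((exp (Re z) * cos (Im z)) ^ 2 + (exp (Re z) * sin (Im z)) ^ 2) with (exp (Re z) ^ 2).
  - apply sqrt_pow2. left; apply exp_pos.
  - pose proof (sin2_cos2 (Im z)). unfold Rsqr in H.
    transitivity (exp (Re z) ^ 2 * (sin (Im z) * sin (Im z) + cos (Im z) * cos (Im z))); [rewrite H; ring | ring].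
Qed.
Lemma cexp_neq_0 z : cexp z <> 0%C.
Proof. apply Cmod_gt_0. rewrite Cmod_cexp. apply exp_pos. Qed.
Lemma cexp_opp z : cexp (- z) = (/ cexp z)%C.
Proof.
  assert (H : (cexp (- z) * cexp z = 1)%C) by (rewrite <- cexp_plus, <- cexp_0; f_equal; ring).
  rewrite <- (Cmult_1_l (/ cexp z)), <- H. field. apply cexp_neq_0.
Qed.
Lemma cexp_minus a b : cexp (a - b) = (cexp a / cexp b)%C.
Proof. unfold Cminus. rewrite cexp_plus, cexp_opp. reflexivity. Qed.

Lemma exp_le (a b : R) : a <= b -> exp a <= exp b.
Proof. intros [H | ->]; [left; apply exp_increasing; exact H | right; reflexivity]. Qed.

(** The second factor is the maximum of [|cexp|] on the segment from 0 to [z]. It stays equal to 1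
    when [Re z <= 0], which [Jfun_near] exploits. *)
Lemma Cmod_cexp_m1 (z : C) : Cmod (cexp z - 1) <= Cmod z * Rmax 1 (exp (Re z)).
Proof.
  rewrite <- cexp_0.
  assert (H := mean_value_C_const (fun t => cexp (0 + RtoC t * z)) (fun t => z * cexp (0 + RtoC t * z))%C
    (Cmod z * Rmax 1 (exp (Re z))) 0 1).
  cbv beta in H. replace (0 + 1 * z)%C with z in H by ring. replace (0 + 0 * z)%C with (RtoC 0) in H by ring.
  rewrite Rminus_0_r, Rmult_1_r in H. apply H; [lra | |].
  - intros x _. apply Cder_cexp. apply Cder_line.
  - intros x Hx. rewrite Cmod_mult, Cmod_cexp. apply Rmult_le_compat_l; [apply Cmod_ge_0|].
    replace (Re (0 + x * z)) with (x * Re z) by (unfold Re; simpl; ring).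
    destruct (Rle_dec 0 (Re z)).
    + eapply Rle_trans; [apply exp_le | apply Rmax_r]. nra.
    + eapply Rle_trans; [|apply Rmax_l]. rewrite <- exp_0. apply exp_le. nra.
Qed.

Lemma Cmod_cexp_m1' (z : C) : Cmod (cexp z - 1) <= Cmod z * exp (Cmod z).
Proof.
  eapply Rle_trans; [apply Cmod_cexp_m1|]. apply Rmult_le_compat_l; [apply Cmod_ge_0|].
  apply Rmax_lub.
  - rewrite <- exp_0. apply exp_le. apply Cmod_ge_0.
  - apply exp_le. eapply Rle_trans; [apply Rle_abs | apply re_le_Cmod].
Qed.

Lemma Cmod_cexp_m1z (z : C) : Cmod (cexp z - 1 - z) <= Cmod z ^ 2 * exp (Cmod z).
Proof.
  assert (H := mean_value_C_const (fun t => cexp (0 + RtoC t * z) - (0 + RtoC t * z))%C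
    (fun t => z * cexp (0 + RtoC t * z) - z)%C
    (Cmod z ^ 2 * exp (Cmod z)) 0 1).
  cbv beta in H. replace (0 + 1 * z)%C with z in H by ring. replace (0 + 0 * z)%C with (RtoC 0) in H by ring.
  rewrite Rminus_0_r, Rmult_1_r, cexp_0 in H. replace (cexp z - z - (1 - 0))%C with (cexp z - 1 - z)%C in H by ring.
  apply H; [lra | |].
  - intros x _. apply Cder_minus; [apply Cder_cexp|]; apply Cder_line.
  - intros x Hx. replace (0 + x * z)%C with (x * z)%C by ring.
    replace (z * cexp (x * z) - z)%C with (z * (cexp (x * z) - 1))%C by ring.
    rewrite Cmod_mult. replace (Cmod z ^ 2 * exp (Cmod z)) with (Cmod z * (Cmod z * exp (Cmod z))) by ring.
    apply Rmult_le_compat_l; [apply Cmod_ge_0|].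
    eapply Rle_trans; [apply Cmod_cexp_m1'|].
    assert (Cmod (x * z) <= Cmod z).
    { rewrite Cmod_mult, Cmod_R, Rabs_pos_eq by lra. pose proof (Cmod_ge_0 z). nra. }
    apply Rmult_le_compat; [apply Cmod_ge_0 | left; apply exp_pos | exact H0 | apply exp_le; exact H0].
Qed.

(** * Principal argument and logarithm *)


(** The plane without the closed negative real axis, where the principal logarithm is
    differentiable. *)
Definition slit (z : C) : Prop := 0 < Re z \/ Im z <> 0.

Lemma slit_neq_0 z : slit z -> z <> 0%C.
Proof. intros H ->. destruct H; simpl in *; lra. Qed.

Lemma carg_Re_pos z : 0 < Re z -> carg z = atan (Im z / Re z).
Proof. intros H. unfold carg. destruct (Rlt_dec 0 (Re z)); [reflexivity | lra]. Qed.

Lemma atan_inv_sym u v : 0 < u -> 0 < v -> atan (v / u) = PI / 2 - atan (u / v).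
Proof.
  intros Hu Hv. replace (v / u) with (/ (u / v)) by (field; lra).
  apply atan_inv. apply Rdiv_lt_0_compat; assumption.
Qed.

(** One formula for the whole upper half-plane, hence valid across the imaginary axis, where the
    definition of [carg] changes branch. *)
Lemma carg_Im_pos z : 0 < Im z -> carg z = PI / 2 - atan (Re z / Im z).
Proof.
  intros H. unfold carg. destruct (Rlt_dec 0 (Re z)).
  - apply atan_inv_sym; assumption.
  - destruct (Rlt_dec (Re z) 0).
    + destruct (Rle_dec 0 (Im z)); [|lra].
      replace (Im z / Re z) with (- (Im z / (- Re z))) by (field; lra).
      rewrite atan_opp, (atan_inv_sym (- Re z)) by lra.
      replace (- Re z / Im z) with (- (Re z / Im z)) by (field; lra). rewrite atan_opp. lra.
    + replace (Re z) with 0 by lra. unfold Rdiv. rewrite Rmult_0_l, atan_0.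
      destruct (Rlt_dec 0 (Im z)); lra.
Qed.

Lemma carg_Im_neg z : Im z < 0 -> carg z = - PI / 2 - atan (Re z / Im z).
Proof.
  intros H. unfold carg. destruct (Rlt_dec 0 (Re z)).
  - replace (Im z / Re z) with (- ((- Im z) / Re z)) by (field; lra).
    rewrite atan_opp, (atan_inv_sym (Re z)) by lra.
    replace (Re z / - Im z) with (- (Re z / Im z)) by (field; lra). rewrite atan_opp. lra.
  - destruct (Rlt_dec (Re z) 0).
    + destruct (Rle_dec 0 (Im z)); [lra|].
      replace (Im z / Re z) with ((- Im z) / (- Re z)) by (field; lra).
      rewrite (atan_inv_sym (- Re z)) by lra.
      replace (- Re z / - Im z) with (Re z / Im z) by (field; lra). lra.
    + replace (Re z) with 0 by lra. unfold Rdiv. rewrite Rmult_0_l, atan_0.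
      destruct (Rlt_dec 0 (Im z)); [lra|]. destruct (Rlt_dec (Im z) 0); lra.
Qed.

Lemma carg_Re_neg z : Im z = 0 -> Re z < 0 -> carg z = PI.
Proof.
  intros H1 H2. unfold carg. rewrite H1. destruct (Rlt_dec 0 (Re z)); [lra|].
  destruct (Rlt_dec (Re z) 0); [|lra]. destruct (Rle_dec 0 0); [|lra].
  unfold Rdiv. rewrite Rmult_0_l, atan_0. lra.
Qed.

Lemma carg_0 : carg 0 = 0.
Proof.
  unfold carg; simpl. destruct (Rlt_dec 0 0); [lra|]. destruct (Rlt_dec 0 0); [lra|]. reflexivity.
Qed.

Lemma C_cases (z : C) : z = 0%C \/ 0 < Re z \/ 0 < Im z \/ Im z < 0 \/ (Im z = 0 /\ Re z < 0).
Proof.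
  destruct (Rtotal_order (Im z) 0) as [H | [H | H]]; try tauto.
  destruct (Rtotal_order (Re z) 0) as [H1 | [H1 | H1]]; try tauto.
  left; apply C_eq; assumption.
Qed.

Lemma carg_bound z : - PI < carg z <= PI.
Proof.
  pose proof PI_RGT_0.
  destruct (C_cases z) as [-> | [H1 | [H1 | [H1 | [H1 H2]]]]].
  - rewrite carg_0. lra.
  - rewrite carg_Re_pos by assumption. pose proof (atan_bound (Im z / Re z)). lra.
  - rewrite carg_Im_pos by assumption. pose proof (atan_bound (Re z / Im z)). lra.
  - rewrite carg_Im_neg by assumption. pose proof (atan_bound (Re z / Im z)). lra.
  - rewrite carg_Re_neg by assumption. lra.
Qed.

Lemma carg_Re_pos_bound z : 0 < Re z -> - (PI / 2) < carg z < PI / 2.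
Proof. intros H. rewrite carg_Re_pos by assumption. pose proof (atan_bound (Im z / Re z)). lra. Qed.

Lemma carg_Im_pos_bound z : 0 < Im z -> 0 < carg z < PI.
Proof. intros H. rewrite carg_Im_pos by assumption. pose proof (atan_bound (Re z / Im z)). lra. Qed.

(** Shaped to meet [cos_atan] and [sin_atan], whose values carry the root of [1 + x^2]. *)
Lemma Cmod_div_sqrt z a b : 0 < a -> a ^ 2 + b ^ 2 = Re z ^ 2 + Im z ^ 2 -> Cmod z = a * sqrt (1 + Rsqr (b / a)).
Proof.
  intros Ha E. rewrite <- (sqrt_pow2 a) at 1 by lra. rewrite <- sqrt_mult_alt by nra. unfold Cmod.
  change (fst z) with (Re z). change (snd z) with (Im z). f_equal. rewrite <- E. unfold Rsqr. field. lra.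
Qed.

Lemma sqrt_1_sqr_neq_0 u : sqrt (1 + Rsqr u) <> 0.
Proof. apply Rgt_not_eq. apply sqrt_lt_R0. pose proof (Rle_0_sqr u). lra. Qed.

Lemma carg_polar z : Cmod z * cos (carg z) = Re z /\ Cmod z * sin (carg z) = Im z.
Proof.
  destruct (C_cases z) as [-> | [H1 | [H1 | [H1 | [H1 H2]]]]].
  - rewrite Cmod_0. split; simpl; ring.
  - rewrite carg_Re_pos by assumption. rewrite (Cmod_div_sqrt z (Re z) (Im z)) by (try assumption; ring).
    rewrite cos_atan, sin_atan. pose proof (sqrt_1_sqr_neq_0 (Im z / Re z)). split; field; lra.
  - rewrite carg_Im_pos by assumption. rewrite (Cmod_div_sqrt z (Im z) (Re z)) by (try assumption; ring).
    rewrite cos_shift, sin_shift, cos_atan, sin_atan. pose proof (sqrt_1_sqr_neq_0 (Re z / Im z)). split; field; lra.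
  - rewrite carg_Im_neg by assumption. rewrite (Cmod_div_sqrt z (- Im z) (- Re z)) by (try lra; ring).
    replace (- Re z / - Im z) with (Re z / Im z) by (field; lra).
    replace (- PI / 2 - atan (Re z / Im z)) with (- (PI / 2 - (- atan (Re z / Im z)))) by lra.
    rewrite cos_neg, sin_neg.
    rewrite cos_shift, sin_shift, sin_neg, cos_neg, cos_atan, sin_atan. pose proof (sqrt_1_sqr_neq_0 (Re z / Im z)). split; field; lra.
  - rewrite carg_Re_neg by assumption. rewrite cos_PI, sin_PI, H1.
    replace (Cmod z) with (- Re z); [split; ring|].
    unfold Cmod. change (fst z) with (Re z). change (snd z) with (Im z). rewrite H1.
    replace (Re z ^ 2 + 0 ^ 2) with ((- Re z) ^ 2) by ring. symmetry. apply sqrt_pow2. lra.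
Qed.

Lemma cexp_clog (z : C) : z <> 0%C -> cexp (clog z) = z.
Proof.
  intros H. destruct (carg_polar z) as [H1 H2]. unfold cexp, clog.
  apply C_eq; simpl; rewrite exp_ln by (apply Cmod_gt_0; exact H); assumption.
Qed.

Lemma cos_eq_1_small x : - (2 * PI) < x < 2 * PI -> cos x = 1 -> x = 0.
Proof.
  intros H1 H2. pose proof PI_RGT_0.
  destruct (Req_dec x 0) as [E | N]; [exact E | exfalso].
  assert (H3 : sin (x / 2) = 0).
  { replace x with (2 * (x / 2)) in H2 by lra. rewrite cos_2a_sin in H2. nra. }
  destruct (Rlt_dec 0 x).
  - assert (0 < sin (x / 2)) by (apply sin_gt_0; lra). lra.
  - assert (0 < sin (- (x / 2))) by (apply sin_gt_0; lra). rewrite sin_neg in H0. lra.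
Qed.

Lemma cexp_inj a b : cexp a = cexp b -> - (2 * PI) < Im a - Im b < 2 * PI -> a = b.
Proof.
  intros E H.
  assert (E1 : cexp (a - b) = 1%C) by (rewrite cexp_minus, E; field; apply cexp_neq_0).
  assert (E2 : Re (a - b) = 0).
  { assert (M := Cmod_cexp (a - b)). rewrite E1, Cmod_1 in M.
    apply exp_inv. rewrite exp_0. symmetry; exact M. }
  assert (E3 : cos (Im (a - b)) = 1).
  { assert (M := f_equal Re E1). simpl in M. unfold Re, Im in *; simpl in *. rewrite E2, exp_0 in M. lra. }
  apply cos_eq_1_small in E3; [|exact H].
  apply C_eq; unfold Re, Im in *; simpl in *; lra.
Qed.

Lemma clog_cexp w : - PI < Im w <= PI -> clog (cexp w) = w.
Proof.
  intros H. apply cexp_inj.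
  - apply cexp_clog. apply cexp_neq_0.
  - pose proof (carg_bound (cexp w)). simpl. lra.
Qed.

Lemma clog_unique z w : z = cexp w -> - PI < Im w <= PI -> clog z = w.
Proof. intros ->. apply clog_cexp. Qed.

Lemma clog_RtoC (x : R) : 0 < x -> clog (RtoC x) = RtoC (ln x).
Proof.
  intros H. pose proof PI_RGT_0. apply clog_unique; [|simpl; lra]. rewrite cexp_RtoC, exp_ln by assumption. reflexivity.
Qed.

Lemma ln_Cmod (z : C) : z <> 0%C -> ln (Cmod z) = / 2 * ln (Re z * Re z + Im z * Im z).
Proof.
  intros H. assert (0 < Cmod z) by (apply Cmod_gt_0; exact H).
  replace (Re z * Re z + Im z * Im z) with (Cmod z * Cmod z).
  - rewrite ln_mult by assumption. lra.
  - pose proof (Cmod2_alt z). lra.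
Qed.

Lemma locally_pos (f : R -> R) x : ex_derive f x -> 0 < f x -> locally x (fun t => 0 < f t).
Proof.
  intros H1 H2. apply (@ex_derive_continuous R_AbsRing R_NormedModule f x H1 (fun y => 0 < y)).
  apply (open_gt 0). exact H2.
Qed.

Lemma is_derive_atan_R (f : R -> R) x a : is_derive f x a ->
  is_derive (fun t => atan (f t)) x (a * / (1 + Rsqr (f x))).
Proof. intros H. apply (is_derive_comp atan f x); [apply is_derive_atan | exact H]. Qed.

Lemma is_derive_ln_R (f : R -> R) x a : is_derive f x a -> 0 < f x ->
  is_derive (fun t => ln (f t)) x (a * / f x).
Proof. intros H H2. apply (is_derive_comp ln f x); [apply is_derive_ln; exact H2 | exact H]. Qed.

Lemma is_derive_div_R (f g : R -> R) x a b : is_derive f x a -> is_derive g x b -> g x <> 0 ->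
  is_derive (fun t => f t / g t) x ((a * g x - f x * b) / (g x * g x)).
Proof.
  intros H1 H2 H3. evar_last; [apply is_derive_div; eassumption|]. field. exact H3.
Qed.

(** Three open half-planes cover [slit]; on each the argument is a single arctangent formula, valid
    in a neighbourhood of the point. *)
Lemma Cder_clog f x a : Cder f x a -> slit (f x) -> Cder (fun t => clog (f t)) x (a / f x)%C.
Proof.
  intros [H1 H2] Hs. pose proof (slit_neq_0 _ Hs) as N. pose proof (Cnz_sq _ N) as N2.
  assert (P : 0 < Re (f x) * Re (f x) + Im (f x) * Im (f x)) by nra.
  assert (E1 : ex_derive (fun t => Re (f t)) x) by (eexists; exact H1).
  assert (E2 : ex_derive (fun t => Im (f t)) x) by (eexists; exact H2).
  assert (HN : is_derive (fun t => Re (f t) * Re (f t) + Im (f t) * Im (f t)) x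
    (Re a * Re (f x) + Re (f x) * Re a + (Im a * Im (f x) + Im (f x) * Im a))).
  { apply @is_derive_plus; apply is_derive_mult_R; assumption. }
  split.
  - apply (is_derive_ext_loc (fun t => / 2 * ln (Re (f t) * Re (f t) + Im (f t) * Im (f t)))).
    + generalize (locally_pos _ _ (ex_intro _ _ HN) P). apply filter_imp. intros t Ht.
      symmetry. apply ln_Cmod. intros E. rewrite E in Ht. simpl in Ht. lra.
    + evar_last; [apply is_derive_scal; apply is_derive_ln_R; [exact HN | exact P]|].
      unfold Re, Im in *; simpl in *. field. lra.
  - destruct Hs as [Hs | Hs]; [|destruct (Rlt_dec 0 (Im (f x)))].
    + apply (is_derive_ext_loc (fun t => atan (Im (f t) / Re (f t)))).
      * generalize (locally_pos _ _ E1 Hs). apply filter_imp. intros t Ht. symmetry. apply carg_Re_pos. exact Ht.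
      * evar_last; [apply is_derive_atan_R; apply is_derive_div_R; [exact H2 | exact H1 | lra]|].
        unfold Rsqr, Re, Im in *; simpl in *. field. repeat split; nra.
    + apply (is_derive_ext_loc (fun t => PI / 2 - atan (Re (f t) / Im (f t)))).
      * generalize (locally_pos _ _ E2 r). apply filter_imp. intros t Ht. symmetry. apply carg_Im_pos. exact Ht.
      * evar_last; [apply @is_derive_minus; [apply @is_derive_const | apply is_derive_atan_R; apply is_derive_div_R; [exact H1 | exact H2 | lra]]|].
        unfold minus, plus, opp, zero, Rsqr, Re, Im in *; simpl in *. field. repeat split; nra.
    + apply (is_derive_ext_loc (fun t => - PI / 2 - atan (Re (f t) / Im (f t)))).
      * assert (r : 0 < - Im (f x)) by lra.
        generalize (locally_pos (fun t => - Im (f t)) x (ex_derive_opp (V := R_NormedModule) _ _ E2) r). apply filter_imp. intros t Ht. symmetry. apply carg_Im_neg. lra.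
      * evar_last; [apply @is_derive_minus; [apply @is_derive_const | apply is_derive_atan_R; apply is_derive_div_R; [exact H1 | exact H2 | lra]]|].
        unfold minus, plus, opp, zero, Rsqr, Re, Im in *; simpl in *. field. repeat split; nra.
Qed.

Lemma CL_clog {T} {F : (T -> Prop) -> Prop} {FF : Filter F} u z :
  CL F u z -> slit z -> CL F (fun t => clog (u t)) (clog z).
Proof.
  intros [H1 H2] Hs. pose proof (slit_neq_0 _ Hs) as N. pose proof (Cnz_sq _ N) as N2.
  assert (P : 0 < Re z * Re z + Im z * Im z) by nra.
  assert (HN : filterlim (fun t => Re (u t) * Re (u t) + Im (u t) * Im (u t)) F (locally (Re z * Re z + Im z * Im z))).
  { apply filterlim_plus_R; apply filterlim_mult_R; assumption. }
  assert (HE : forall a, 0 < a -> locally a (fun y => 0 < y)).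
  { intros a Ha. apply (open_gt 0). exact Ha. }
  split.
  - apply (filterlim_ext_loc (fun t => / 2 * ln (Re (u t) * Re (u t) + Im (u t) * Im (u t)))).
    + generalize (HN _ (HE _ P)). unfold filtermap. apply filter_imp. intros t Ht.
      symmetry. apply ln_Cmod. intros E. rewrite E in Ht. simpl in Ht. lra.
    + simpl Re. rewrite ln_Cmod by assumption. apply (filterlim_cont_R (fun y => / 2 * ln y)); [exact HN|].
      auto_derive. exact P.
  - simpl Im. destruct Hs as [Hs | Hs]; [|destruct (Rlt_dec 0 (Im z))].
    + apply (filterlim_ext_loc (fun t => atan (Im (u t) * / Re (u t)))).
      * generalize (H1 _ (HE _ Hs)). unfold filtermap. apply filter_imp. intros t Ht. symmetry. apply carg_Re_pos. exact Ht.
      * rewrite carg_Re_pos by assumption. apply filterlim_cont_R; [|auto_derive; trivial].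
        apply filterlim_mult_R; [exact H2|]. apply filterlim_cont_R; [exact H1 | auto_derive; lra].
    + apply (filterlim_ext_loc (fun t => PI / 2 + - atan (Re (u t) * / Im (u t)))).
      * generalize (H2 _ (HE _ r)). unfold filtermap. apply filter_imp. intros t Ht. symmetry. apply carg_Im_pos. exact Ht.
      * rewrite carg_Im_pos by assumption. apply filterlim_plus_R; [apply filterlim_const|].
        apply filterlim_opp_R. apply filterlim_cont_R; [|auto_derive; trivial].
        apply filterlim_mult_R; [exact H1|]. apply filterlim_cont_R; [exact H2 | auto_derive; lra].
    + apply (filterlim_ext_loc (fun t => - PI / 2 + - atan (Re (u t) * / Im (u t)))).
      * assert (r : 0 < - Im z) by lra.
        generalize (filterlim_opp_R _ _ H2 _ (HE _ r)). unfold filtermap. apply filter_imp. intros t Ht. symmetry. apply carg_Im_neg. lra.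
      * rewrite carg_Im_neg by lra. apply filterlim_plus_R; [apply filterlim_const|].
        apply filterlim_opp_R. apply filterlim_cont_R; [|auto_derive; trivial].
        apply filterlim_mult_R; [exact H1|]. apply filterlim_cont_R; [exact H2 | auto_derive; lra].
Qed.

Lemma clog_scal (r : R) (z : C) : 0 < r -> z <> 0%C -> clog (r * z) = (ln r + clog z)%C.
Proof.
  intros Hr Hz. apply clog_unique.
  - rewrite cexp_plus, cexp_RtoC, exp_ln, cexp_clog by assumption. reflexivity.
  - replace (Im (ln r + clog z)) with (carg z) by (unfold Im; simpl; ring). apply carg_bound.
Qed.

(** * Primitives on star-shaped domains *)


Lemma CL_filterlim {T} {F : (T -> Prop) -> Prop} {FF : Filter F} (u : T -> C) (l : C) :
  CL F u l <-> filterlim u F (locally l).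
Proof.
  split.
  - intros H P [eps HP]. unfold filtermap.
    generalize (proj1 (CL_eps _ _) H _ (cond_pos eps)). apply filter_imp.
    intros n A. apply HP. split.
    + eapply Rle_lt_trans; [exact (re_le_Cmod (u n - l)) | exact A].
    + eapply Rle_lt_trans; [exact (Im_le_Cmod (u n - l)) | exact A].
  - intros H. split; intros P HP; [apply (H (fun z => P (Re z))) | apply (H (fun z => P (Im z)))];
    destruct HP as [eps HP]; exists eps; intros y [A B]; apply HP; assumption.
Qed.

Lemma CL_self (z : C) : CL (locally z) (fun w => w) z.
Proof. apply CL_filterlim. intros P H. exact H. Qed.

Lemma CL_compose {T} {F : (T -> Prop) -> Prop} {FF : Filter F} (k : C -> C) (u : T -> C) (z : C) :
  CL F u z -> CL (locally z) k (k z) -> CL F (fun t => k (u t)) (k z).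
Proof. intros H1 H2. eapply CL_comp; [apply CL_filterlim; exact H1 | exact H2]. Qed.

Definition CInt (g : R -> C) : C := (RInt (fun t => Re (g t)) 0 1, RInt (fun t => Im (g t)) 0 1).

Lemma CInt_ext g h : (forall t, 0 < t < 1 -> g t = h t) -> CInt g = CInt h.
Proof.
  intros E. unfold CInt. f_equal; apply RInt_ext; intros t Ht; rewrite Rmin_left, Rmax_right in Ht by lra;
  rewrite E by lra; reflexivity.
Qed.

Lemma ex_RInt_CL g : (forall t, 0 <= t <= 1 -> CL (locally t) g (g t)) ->
  ex_RInt (fun t => Re (g t)) 0 1 /\ ex_RInt (fun t => Im (g t)) 0 1.
Proof.
  intros H; split; apply (@ex_RInt_continuous R_CompleteNormedModule); intros t Ht;
  rewrite Rmin_left, Rmax_right in Ht by lra; destruct (H t Ht) as [A B]; assumption.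
Qed.

(** The factor 2 is the price of bounding real and imaginary parts separately. *)
Lemma CInt_bound g B : (forall t, 0 <= t <= 1 -> CL (locally t) g (g t)) ->
  (forall t, 0 <= t <= 1 -> Cmod (g t) <= B) -> Cmod (CInt g) <= 2 * B.
Proof.
  intros H1 H2. destruct (ex_RInt_CL g H1) as [E1 E2].
  eapply Rle_trans; [apply Cmod_le_sum|]. unfold CInt; simpl.
  assert (A1 : Rabs (RInt (fun t => Re (g t)) 0 1) <= (1 - 0) * B).
  { apply abs_RInt_le_const; [lra | exact E1|]. intros t Ht. eapply Rle_trans; [apply re_le_Cmod | auto]. }
  assert (A2 : Rabs (RInt (fun t => Im (g t)) 0 1) <= (1 - 0) * B).
  { apply abs_RInt_le_const; [lra | exact E2|]. intros t Ht. eapply Rle_trans; [apply Im_le_Cmod | auto]. }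
  unfold Re, Im in *; simpl in *. lra.
Qed.

Lemma CInt_FTC G g : (forall t, 0 <= t <= 1 -> Cder G t (g t)) ->
  (forall t, 0 <= t <= 1 -> CL (locally t) g (g t)) -> CInt g = (G 1 - G 0)%C.
Proof.
  intros H1 H2. unfold CInt. apply C_eq; simpl; apply is_RInt_unique;
  [apply (@is_RInt_derive R_CompleteNormedModule (fun t => Re (G t)) (fun t => Re (g t)))
  | apply (@is_RInt_derive R_CompleteNormedModule (fun t => Im (G t)) (fun t => Im (g t)))];
  intros t Ht; rewrite Rmin_left, Rmax_right in Ht by lra; destruct (H1 t Ht), (H2 t Ht); assumption.
Qed.

Lemma CInt_param (g dg : R -> R -> C) (x0 : R) :
  locally x0 (fun x => forall t, Cder (fun y => g y t) x (dg x t)) ->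
  locally x0 (fun x => forall t, 0 <= t <= 1 -> CL (locally t) (g x) (g x t)) ->
  (forall t, 0 <= t <= 1 -> CL (locally (x0, t)) (fun p => dg (fst p) (snd p)) (dg x0 t)) ->
  Cder (fun x => CInt (g x)) x0 (CInt (dg x0)).
Proof.
  intros H1 H2 H3.
  (* Stated for a projection [p], so that one argument serves both [Re] and [Im]. *)
  assert (HX : forall (p : C -> R), (forall h x l, Cder h x l -> is_derive (fun t => p (h t)) x (p l)) ->
     (forall T (F : (T -> Prop) -> Prop) h l, CL F h l -> filterlim (fun t => p (h t)) F (locally (p l))) ->
     is_derive (fun x => RInt (fun t => p (g x t)) 0 1) x0 (RInt (fun t => p (dg x0 t)) 0 1)).
  { intros p P1 P2.
    replace (RInt (fun t => p (dg x0 t)) 0 1) with (RInt (fun t => Derive (fun y => p (g y t)) x0) 0 1).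
    - apply (is_derive_RInt_param (fun x t => p (g x t))).
      + revert H1. apply filter_imp. intros x H t _. eexists. apply P1. apply H.
      + intros t Ht. rewrite Rmin_left, Rmax_right in Ht by lra.
        apply continuity_2d_pt_filterlim.
        assert (E : Derive (fun z => p (g z t)) x0 = p (dg x0 t)).
        { apply is_derive_unique. apply P1. apply (locally_singleton _ _ H1). }
        rewrite E.
        apply (filterlim_ext_loc (fun q => p (dg (fst q) (snd q)))).
        * destruct H1 as [eps H1]. exists eps. intros [y s] [A B]. simpl in *. symmetry.
          apply is_derive_unique. apply P1. apply H1. exact A.
        * apply (P2 _ _ (fun q => dg (fst q) (snd q))). apply H3. exact Ht.
      + revert H2. apply filter_imp. intros x H.
        apply (@ex_RInt_continuous R_CompleteNormedModule); intros t Ht;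
        rewrite Rmin_left, Rmax_right in Ht by lra. apply (P2 _ _ (g x)). apply H. exact Ht.
    - apply RInt_ext. intros t _. apply is_derive_unique. apply P1. apply (locally_singleton _ _ H1). }
  split; simpl.
  - apply (HX Re); [intros h x l [A B]; exact A | intros T F h l [A B]; exact A].
  - apply (HX Im); [intros h x l [A B]; exact B | intros T F h l [A B]; exact B].
Qed.

(* Differentiation under the integral asks for a derivative near, not only on, [0,1]; composing with clip avoids leaving D there. *)
Definition clip (t : R) : R := Rmin 1 (Rmax 0 t).

Lemma clip_id t : 0 <= t <= 1 -> clip t = t.
Proof. intros H. unfold clip. rewrite Rmax_right by lra. apply Rmin_right. lra. Qed.
Lemma clip_range t : clip t = 0 \/ 0 < clip t <= 1.
Proof.
  unfold clip. unfold Rmin, Rmax. destruct (Rle_dec 0 t); destruct (Rle_dec 1 _); lra.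
Qed.
Lemma clip_lip s t : Rabs (clip s - clip t) <= Rabs (s - t).
Proof.
  unfold clip, Rmin, Rmax.
  destruct (Rle_dec 0 s), (Rle_dec 0 t); repeat destruct (Rle_dec 1 _); unfold Rabs; repeat destruct (Rcase_abs _); lra.
Qed.

Lemma clip_CL {T} {F : (T -> Prop) -> Prop} {FF : Filter F} (u : T -> R) a :
  filterlim u F (locally a) -> filterlim (fun t => clip (u t)) F (locally (clip a)).
Proof.
  intros H. apply filterlim_R_eps. intros eps He.
  generalize (proj1 (filterlim_R_eps _ _) H eps He). apply filter_imp.
  intros t Ht. eapply Rle_lt_trans; [apply clip_lip | exact Ht].
Qed.

(** The difference quotient of [t * h t] at 0 is [h] itself, so continuity suffices. This serves the
    end of a ray at the origin, where the integrand may have no derivative. *)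
Lemma is_derive_mul_id (h : R -> R) : filterlim h (locally 0) (locally (h 0)) ->
  is_derive (fun t => t * h t) 0 (h 0).
Proof.
  intros H. apply is_derive_Reals. intros eps He.
  destruct (proj1 (filterlim_R_eps _ _) H eps He) as [d Hd]. exists d.
  intros s Hs1 Hs2. replace ((0 + s) * h (0 + s) - 0 * h 0) with (s * h s) by (rewrite Rplus_0_l; ring).
  replace (s * h s / s) with (h s) by (field; exact Hs1).
  apply Hd. unfold ball; simpl; unfold AbsRing_ball, abs, minus, plus, opp; simpl.
  replace (s + - 0) with s by ring. exact Hs2.
Qed.

Lemma Cder_mul_id (h : R -> C) : CL (locally 0) h (h 0) -> Cder (fun t => RtoC t * h t)%C 0 (h 0).
Proof.
  intros [H1 H2]; split; simpl.
  - apply (is_derive_ext (fun t => t * Re (h t))); [intros; unfold Re; simpl; ring|].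
    apply (is_derive_mul_id (fun t => Re (h t))). exact H1.
  - apply (is_derive_ext (fun t => t * Im (h t))); [intros; unfold Im; simpl; ring|].
    apply (is_derive_mul_id (fun t => Im (h t))). exact H2.
Qed.

(* The origin need not belong to D: it is a branch point of the integrand, where only the two limits below are available. *)
Record star_holo (D : C -> Prop) (f df : C -> C) : Prop := {
  sh_open : forall z, D z -> locally z D;
  sh_star : forall z (t : R), D z -> 0 < t <= 1 -> D (t * z)%C;
  sh_der : forall g x a, Cder g x a -> D (g x) -> Cder (fun t => f (g t)) x (a * df (g x))%C;
  sh_cont : forall z, D z -> CL (locally z) df (df z);
  sh_0 : CL (locally (RtoC 0)) f (f 0%C);
  sh_0' : CL (locally (RtoC 0)) (fun x => x * df x)%C 0%C
}.

Definition ray_prim (f : C -> C) (z : C) : C := CInt (fun t => z * f (t * z))%C.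

Lemma sh_fcont D f df : star_holo D f df -> forall z, D z -> CL (locally z) f (f z).
Proof.
  intros S z Hz. pose proof (sh_cont _ _ _ S z Hz) as Hc.
  apply CL_eps. intros eps He.
  (* f is Lipschitz near z since df is bounded there *)
  destruct (filter_and _ _ (sh_open _ _ _ S z Hz) (proj1 (CL_eps _ _) Hc 1 Rlt_0_1)) as [d Hd].
  set (B := Cmod (df z) + 1). assert (HB : 0 < B) by (unfold B; pose proof (Cmod_ge_0 (df z)); lra).
  assert (Hloc : locally z (fun w => Cmod (w - z) < Rmin d (eps / B))).
  { apply (proj1 (CL_eps _ _) (CL_self z)). apply Rmin_glb_lt; [apply cond_pos | apply Rdiv_lt_0_compat; assumption]. }
  revert Hloc. apply filter_imp. intros w0. generalize (w0 : C). clear w0. intros w Hw.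
  assert (Hw1 : Cmod (w - z) < d) by (eapply Rlt_le_trans; [exact Hw | apply Rmin_l]).
  assert (Hw2 : Cmod (w - z) < eps / B) by (eapply Rlt_le_trans; [exact Hw | apply Rmin_r]).
  assert (HD : forall x, 0 <= x <= 1 -> D (z + x * (w - z))%C /\ Cmod (df (z + x * (w - z))%C) <= B).
  { intros x Hx. assert (Hb : ball z d (z + x * (w - z))%C).
    { assert (Hs : Cmod (x * (w - z)) < d).
      { rewrite Cmod_mult, Cmod_R, Rabs_pos_eq by lra. pose proof (Cmod_ge_0 (w - z)). nra. }
      split; unfold ball; simpl; unfold AbsRing_ball, abs, minus, plus, opp; simpl.
      - eapply Rle_lt_trans; [|exact Hs]. eapply Rle_trans; [|apply re_le_Cmod]. right. f_equal. unfold Re; simpl. ring.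
      - eapply Rle_lt_trans; [|exact Hs]. eapply Rle_trans; [|apply Im_le_Cmod]. right. f_equal. unfold Im; simpl. ring. }
    destruct (Hd _ Hb) as [A1 A2]. split; [exact A1|].
    unfold B. pose proof (Cmod_triangle (df (z + x * (w - z))%C - df z) (df z)).
    replace (df (z + x * (w - z))%C - df z + df z)%C with (df (z + x * (w - z))%C) in H by ring. lra. }
  assert (M := mean_value_C_const (fun x => f (z + x * (w - z))%C) (fun x => (w - z) * df (z + x * (w - z)))%C
     (Cmod (w - z) * B) 0 1).
  cbv beta in M. replace (z + 1 * (w - z))%C with w in M by ring. replace (z + 0 * (w - z))%C with z in M by ring.
  eapply Rle_lt_trans; [apply M|].
  - lra.
  - intros x Hx. apply (sh_der _ _ _ S (fun x => z + x * (w - z))%C); [apply Cder_line | apply HD; exact Hx].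
  - intros x Hx. rewrite Cmod_mult. apply Rmult_le_compat_l; [apply Cmod_ge_0 | apply HD; exact Hx].
  - replace eps with (eps / B * B) by (field; lra). rewrite Rminus_0_r, Rmult_1_r. apply Rmult_lt_compat_r; assumption.
Qed.

Lemma sh_fcont0 D f df : star_holo D f df -> forall z, D z \/ z = 0%C -> CL (locally z) f (f z).
Proof. intros S z [H | ->]; [eapply sh_fcont; eassumption | apply (sh_0 _ _ _ S)]. Qed.

(** [f x + x * df x] is the derivative of [x * f x]; with [x = t z] it is the integrand that remains
    after differentiating [ray_prim] under the integral. *)
Lemma sh_kcont D f df : star_holo D f df -> forall z, D z \/ z = 0%C ->
  CL (locally z) (fun x => f x + x * df x)%C (f z + z * df z)%C.
Proof.
  intros S z [H | ->].
  - apply CL_plus; [eapply sh_fcont; eassumption|]. apply CL_mult; [apply CL_self | apply (sh_cont _ _ _ S); exact H].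
  - apply CL_plus; [apply (sh_0 _ _ _ S)|]. eapply CL_eq; [apply (sh_0' _ _ _ S)|]. ring.
Qed.

Lemma sh_ray_CL D f df : star_holo D f df -> forall z, D z -> forall t, 0 <= t <= 1 ->
  CL (locally t) (fun t => z * f (clip t * z))%C (z * f (clip t * z))%C.
Proof.
  intros S z Hz t Ht. apply CL_mult; [apply CL_const|].
  apply (CL_compose f (fun t => clip t * z)%C).
  - apply CL_mult; [|apply CL_const]. apply CL_RtoC. apply clip_CL. apply filterlim_id.
  - apply (sh_fcont0 _ _ _ S). destruct (clip_range t) as [-> | H]; [right; ring | left; apply (sh_star _ _ _ S); assumption].
Qed.

Lemma ray_prim_clip f z : ray_prim f z = CInt (fun t => z * f (clip t * z))%C.
Proof. apply CInt_ext. intros t Ht. rewrite clip_id by lra. reflexivity. Qed.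

(** The integrand is the derivative of [t * (v * f (t z))] in [t], so the fundamental theorem leaves
    the value at [t = 1]. *)
Lemma sh_k_int D f df : star_holo D f df -> forall z, D z -> forall v,
  CInt (fun t => v * (f (clip t * z) + clip t * z * df (clip t * z)))%C = (v * f z)%C.
Proof.
  intros S z Hz v.
  (* For [t <= 0] the point [t z] may leave [D], so [f] is frozen at its value at 0; the product is
     then differentiable at 0 by [Cder_mul_id]. *)
  rewrite (CInt_FTC (fun t => t * (v * (if Rle_dec t 0 then f 0%C else f (t * z))))%C).
  - destruct (Rle_dec 1 0); [lra|]. replace (1 * z)%C with z by ring. ring.
  - intros t Ht. destruct (Req_dec t 0) as [-> | N].
    + eapply Cder_eq; [apply (Cder_mul_id (fun t => v * (if Rle_dec t 0 then f 0%C else f (t * z)))%C)|].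
      * destruct (Rle_dec 0 0); [|lra]. apply CL_mult; [apply CL_const|].
        apply (CL_ext (fun t => f (Rmax 0 t * z)%C)).
        { intros s. destruct (Rle_dec s 0).
          - rewrite Rmax_left by lra. f_equal. ring.
          - rewrite Rmax_right by lra. reflexivity. }
        apply (CL_compose f (fun t => Rmax 0 t * z)%C); [|apply (sh_0 _ _ _ S)].
        eapply CL_eq; [apply CL_mult; [apply CL_RtoC | apply CL_const]|].
        { apply filterlim_R_eps. intros eps He. exists (mkposreal _ He). intros y Hy.
          instantiate (1 := 0). rewrite Rminus_0_r.
          unfold ball in Hy; simpl in Hy; unfold AbsRing_ball, abs, minus, plus, opp in Hy; simpl in Hy.
          revert Hy. unfold Rmax, Rabs. destruct (Rle_dec 0 y); repeat destruct (Rcase_abs _); lra. }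
        ring.
      * cbv beta. rewrite clip_id by lra. destruct (Rle_dec 0 0); [|lra]. replace (0 * z)%C with (RtoC 0) by ring. ring.
    + apply (Cder_ext_loc (fun t => t * (v * f (t * z)))%C).
      { assert (Ht0 : 0 < t) by lra. generalize (open_gt 0 t Ht0). apply filter_imp. intros s Hs.
        destruct (Rle_dec s 0); [lra | reflexivity]. }
      eapply Cder_eq.
      { apply Cder_mult; [apply Cder_id|]. apply Cder_scal. apply (sh_der _ _ _ S (fun t => t * z)%C).
        - apply Cder_mult; [apply Cder_id | apply Cder_const].
        - apply (sh_star _ _ _ S); [exact Hz | lra]. }
      cbv beta. rewrite clip_id by lra. ring.
  - intros t Ht. apply CL_mult; [apply CL_const|].
    apply (CL_compose (fun x => f x + x * df x)%C (fun t => clip t * z)%C).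
    + apply CL_mult; [|apply CL_const]. apply CL_RtoC. apply clip_CL. apply filterlim_id.
    + apply (sh_kcont _ _ _ S). destruct (clip_range t) as [-> | H]; [right; ring | left; apply (sh_star _ _ _ S); assumption].
Qed.

(** Differentiation under the integral sign reduces the claim to [sh_k_int]. This is the substitute
    for Cauchy's theorem. *)
Lemma Cder_ray_prim D f df : star_holo D f df -> forall p v (u : R), D (p + u * v)%C ->
  Cder (fun u => ray_prim f (p + u * v))%C u (v * f (p + u * v))%C.
Proof.
  intros S p v u Hu. rewrite <- (sh_k_int _ _ _ S _ Hu v).
  apply (Cder_ext (fun u => CInt (fun t => (p + u * v) * f (clip t * (p + u * v)))%C)).
  { intros t. symmetry. apply ray_prim_clip. }
  assert (HL : locally u (fun x : R => D (p + x * v)%C)).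
  { apply (proj1 (CL_filterlim (fun x : R => p + x * v)%C _) (Cder_CL _ _ _ (Cder_line p v u)) D).
    apply (sh_open _ _ _ S). exact Hu. }
  apply (CInt_param (fun u t => (p + u * v) * f (clip t * (p + u * v)))%C
    (fun u t => v * (f (clip t * (p + u * v)) + clip t * (p + u * v) * df (clip t * (p + u * v))))%C).
  (* At [clip t = 0] no derivative of [f] is available, but there the integrand is affine in the
     parameter. *)
  - revert HL. apply filter_imp. intros x Hx t. destruct (clip_range t) as [E | H].
    + rewrite E. apply (Cder_ext (fun y : R => (p + y * v) * f 0)%C).
      { intros y. replace (0 * (p + y * v))%C with (RtoC 0) by ring. reflexivity. }
      eapply Cder_eq; [apply Cder_mult; [apply Cder_line | apply Cder_const]|].
      cbv beta. replace (0 * (p + x * v))%C with (RtoC 0) by ring. ring.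
    + eapply Cder_eq.
      { apply Cder_mult; [apply Cder_line|]. apply (sh_der _ _ _ S (fun y : R => clip t * (p + y * v))%C).
        - apply Cder_scal. apply Cder_line.
        - apply (sh_star _ _ _ S); assumption. }
      cbv beta. ring.
  - revert HL. apply filter_imp. intros x Hx t Ht. apply (sh_ray_CL _ _ _ S); assumption.
  - intros t Ht. apply CL_mult; [apply CL_const|].
    apply (CL_compose (fun x => f x + x * df x)%C (fun q : R * R => clip (snd q) * (p + fst q * v))%C).
    + apply CL_mult; [|apply CL_plus; [apply CL_const | apply CL_mult; [|apply CL_const]]]; apply CL_RtoC.
      * apply clip_CL. intros P [eps HP]. exists eps. intros y [A B]. apply HP. exact B.
      * intros P [eps HP]. exists eps. intros y [A B]. apply HP. exact A.
    + apply (sh_kcont _ _ _ S). destruct (clip_range t) as [-> | H]; [right; ring | left; apply (sh_star _ _ _ S); assumption].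
Qed.

Lemma ray_prim_0 f : ray_prim f 0 = 0%C.
Proof.
  unfold ray_prim, CInt. apply C_eq; simpl; rewrite (RInt_ext _ (fun _ => 0)), RInt_const;
  try (unfold scal; simpl; unfold mult; simpl; ring); intros; unfold Re, Im; simpl; ring.
Qed.

Lemma ray_prim_bound D f df : star_holo D f df -> forall z B, D z ->
  (forall t, 0 <= t <= 1 -> Cmod (f (t * z)%C) <= B) -> Cmod (ray_prim f z) <= 2 * (Cmod z * B).
Proof.
  intros S z B Hz H. rewrite ray_prim_clip. apply CInt_bound.
  - intros t Ht. apply (sh_ray_CL _ _ _ S); assumption.
  - intros t Ht. rewrite clip_id by exact Ht. rewrite Cmod_mult. apply Rmult_le_compat_l; [apply Cmod_ge_0 | auto].
Qed.

Lemma ray_prim_diff D f df : star_holo D f df -> forall z1 z2 B,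
  (forall t : R, 0 <= t <= 1 -> D (z1 + t * (z2 - z1))%C) ->
  (forall t : R, 0 <= t <= 1 -> Cmod (f (z1 + t * (z2 - z1))%C) <= B) ->
  Cmod (ray_prim f z2 - ray_prim f z1) <= Cmod (z2 - z1) * B.
Proof.
  intros S z1 z2 B H1 H2.
  assert (M := mean_value_C_const (fun x => ray_prim f (z1 + x * (z2 - z1))%C)
     (fun x => (z2 - z1) * f (z1 + x * (z2 - z1)))%C
     (Cmod (z2 - z1) * B) 0 1).
  cbv beta in M. replace (z1 + 1 * (z2 - z1))%C with z2 in M by ring. replace (z1 + 0 * (z2 - z1))%C with z1 in M by ring.
  rewrite Rminus_0_r, Rmult_1_r in M. apply M; [lra | |].
  - intros x Hx. apply (Cder_ray_prim _ _ _ S). apply H1. exact Hx.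
  - intros x Hx. rewrite Cmod_mult. apply Rmult_le_compat_l; [apply Cmod_ge_0 | apply H2; exact Hx].
Qed.

(** * The integrand of Riemann's auxiliary function *)


(** The plane cut along the real axis outside the interval from 0 to 1: it avoids the integers,
    where [Sn] vanishes, and the branch cut of the logarithm, and it is star-shaped about 0 without
    containing 0. *)
Definition Dom (x : C) : Prop := Im x <> 0 \/ 0 < Re x < 1.

(** [Sn] is [2 i sin(pi x)] and [Cs] is [2 cos(pi x)], kept as exponentials to match the
    integrand. *)
Definition Sn (x : C) : C := (cexp (PI * Ci * x) - cexp (- (PI * Ci * x)))%C.
Definition Cs (x : C) : C := (cexp (PI * Ci * x) + cexp (- (PI * Ci * x)))%C.

(** The integrand without the case distinction of [cpow] at 0, so that the derivative and limit
    rules apply. *)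
Definition Rint_exp (s x : C) : C := (cexp (- s * clog x + PI * Ci * (x * x)) / Sn x)%C.

Definition dRint (s x : C) : C :=
  (Rintegrand s x * (- s / x + 2 * (PI * Ci) * x - PI * Ci * Cs x / Sn x))%C.

Lemma cpow_cexp (x w : C) : x <> 0%C -> cpow x w = cexp (w * clog x).
Proof. intros H. unfold cpow. destruct (Ceq_dec x 0); [contradiction | reflexivity]. Qed.

Lemma cpow_0 w : cpow 0 w = 0%C.
Proof. unfold cpow. destruct (Ceq_dec 0 0); [reflexivity | congruence]. Qed.

(* Junk value: cpow 0 _ = 0, hence 0 / 0 = 0 at the origin, which agrees with the limit when Re s is very negative. *)
Lemma Rintegrand_0 s : Rintegrand s 0 = 0%C.
Proof. unfold Rintegrand. rewrite cpow_0. unfold Cdiv. ring. Qed.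

Lemma Rintegrand_exp s (x : C) : x <> 0%C -> Rintegrand s x = Rint_exp s x.
Proof. intros H. unfold Rintegrand, Rint_exp. rewrite cpow_cexp by exact H. rewrite <- cexp_plus. reflexivity. Qed.

Lemma Dom_slit x : Dom x -> slit x.
Proof. intros [H | H]; [right; exact H | left; lra]. Qed.

Lemma Dom_open z : Dom z -> locally z Dom.
Proof.
  destruct (CL_self z) as [H1 H2]. intros [H | H].
  - generalize (H2 (fun y => y <> 0) (open_neq 0 _ H)). unfold filtermap. apply filter_imp. intros x Hx; left; exact Hx.
  - generalize (H1 (fun y => 0 < y < 1) (open_and _ _ (open_gt 0) (open_lt 1) _ H)). unfold filtermap. apply filter_imp.
    intros x Hx; right; exact Hx.
Qed.

Lemma Dom_star z (t : R) : Dom z -> 0 < t <= 1 -> Dom (t * z)%C.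
Proof.
  intros [H | H] Ht; [left | right]; unfold Re, Im in *; simpl in *.
  - intros E. ring_simplify in E. apply Rmult_integral in E. lra.
  - nra.
Qed.

Lemma Re_iPI x : Re (PI * Ci * x) = - (PI * Im x).
Proof. unfold Re, Im; simpl; ring. Qed.
Lemma Cmod_iPI x : Cmod (PI * Ci * x) = PI * Cmod x.
Proof.
  pose proof PI_RGT_0. rewrite !Cmod_mult, Cmod_R, Rabs_pos_eq by lra.
  replace (Cmod Ci) with 1; [ring|]. unfold Cmod; simpl. rewrite <- sqrt_1 at 1. f_equal. ring.
Qed.

(** A zero means [e^(2 pi i x) = 1]; the modulus forces [Im x = 0], and for [0 < Re x < 1] the angle
    [2 pi Re x] lies within the range of [cexp_inj]. *)
Lemma Sn_neq_0 x : Dom x -> Sn x <> 0%C.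
Proof.
  intros HD E. pose proof PI_RGT_0.
  assert (E1 : cexp (PI * Ci * x + PI * Ci * x) = cexp 0).
  { rewrite cexp_plus, cexp_0. apply Ceq_minus in E. rewrite E at 1. rewrite <- cexp_plus, <- cexp_0. f_equal. ring. }
  assert (E2 : Re (PI * Ci * x + PI * Ci * x) = 0).
  { assert (M := f_equal Cmod E1). rewrite !Cmod_cexp in M. apply exp_inv in M. exact M. }
  assert (E3 : Im x = 0) by (unfold Re, Im in *; simpl in *; nra).
  destruct HD as [HD | HD]; [contradiction|].
  apply cexp_inj in E1.
  - assert (M := f_equal Im E1). unfold Re, Im in *; simpl in *. nra.
  - unfold Re, Im in *; simpl in *. nra.
Qed.

Lemma Cder_Sn g x a : Cder g x a -> Cder (fun t => Sn (g t)) x (a * (PI * Ci * Cs (g x)))%C.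
Proof.
  intros H. eapply Cder_eq.
  { apply Cder_minus; apply Cder_cexp; [|apply Cder_opp]; apply Cder_scal; exact H. }
  unfold Cs. ring.
Qed.

Lemma CL_Sn {T} {F : (T -> Prop) -> Prop} {FF : Filter F} u z : CL F u z -> CL F (fun t => Sn (u t)) (Sn z).
Proof.
  intros H. apply CL_minus; apply CL_cexp; [|apply CL_opp]; (apply CL_mult; [apply CL_const | exact H]).
Qed.
Lemma CL_Cs {T} {F : (T -> Prop) -> Prop} {FF : Filter F} u z : CL F u z -> CL F (fun t => Cs (u t)) (Cs z).
Proof.
  intros H. apply CL_plus; apply CL_cexp; [|apply CL_opp]; (apply CL_mult; [apply CL_const | exact H]).
Qed.

Lemma Cder_Rintegrand s g x a : Cder g x a -> Dom (g x) ->
  Cder (fun t => Rintegrand s (g t)) x (a * dRint s (g x))%C.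
Proof.
  intros Hg HD. pose proof (slit_neq_0 _ (Dom_slit _ HD)) as N.
  apply (Cder_ext_loc (fun t => Rint_exp s (g t))).
  { generalize (proj1 (CL_filterlim _ _) (Cder_CL _ _ _ Hg) Dom (Dom_open _ HD)).
    unfold filtermap. apply filter_imp. intros t Ht. symmetry. apply Rintegrand_exp.
    apply slit_neq_0, Dom_slit, Ht. }
  eapply Cder_eq.
  { apply Cder_mult.
    - apply Cder_cexp. apply Cder_plus.
      + apply Cder_scal. apply Cder_clog; [exact Hg | apply Dom_slit; exact HD].
      + apply Cder_scal. apply Cder_mult; exact Hg.
    - apply Cder_inv; [apply Cder_Sn; exact Hg | apply Sn_neq_0; exact HD]. }
  cbv beta. unfold dRint. rewrite Rintegrand_exp by exact N. unfold Rint_exp.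
  pose proof (Sn_neq_0 _ HD) as N2. field. split; assumption.
Qed.

Lemma CL_Rint_exp {T} {F : (T -> Prop) -> Prop} {FF : Filter F} s u z : CL F u z -> Dom z ->
  CL F (fun t => Rint_exp s (u t)) (Rint_exp s z).
Proof.
  intros H HD. apply CL_div; [|apply CL_Sn; exact H | apply Sn_neq_0; exact HD].
  apply CL_cexp. apply CL_plus; (apply CL_mult; [apply CL_const|]).
  - apply CL_clog; [exact H | apply Dom_slit; exact HD].
  - apply CL_mult; exact H.
Qed.

Lemma CL_dRint s z : Dom z -> CL (locally z) (dRint s) (dRint s z).
Proof.
  intros HD. pose proof (slit_neq_0 _ (Dom_slit _ HD)) as N. pose proof (CL_self z) as HS.
  unfold dRint. apply CL_mult.
  - apply (CL_ext_loc (fun x => Rint_exp s x)).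
    + generalize (Dom_open _ HD). apply filter_imp. intros x Hx. symmetry.
      apply Rintegrand_exp. apply slit_neq_0, Dom_slit, Hx.
    + rewrite Rintegrand_exp by exact N. apply CL_Rint_exp; assumption.
  - apply CL_minus; [apply CL_plus|].
    + apply CL_div; [apply CL_const | exact HS | exact N].
    + apply CL_mult; [apply CL_const | exact HS].
    + apply CL_div; [apply CL_mult; [apply CL_const | apply CL_Cs; exact HS] | apply CL_Sn; exact HS | apply Sn_neq_0; exact HD].
Qed.

Lemma exp_quarter : exp (1 / 4) <= 4 / 3.
Proof.
  pose proof (exp_ineq1_le (- (1 / 4))). rewrite exp_Ropp in H. pose proof (exp_pos (1 / 4)).
  assert (exp (1 / 4) * / exp (1 / 4) = 1) by (field; lra).
  assert (0 < / exp (1 / 4)) by (apply Rinv_0_lt_compat; lra). nra.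
Qed.

(** The difference of exponentials is [2 w] up to two Taylor remainders, each at most [|w|/3]
    because [|w| e^(1/4) <= 1/3]. *)
Lemma Cmod_sinh_ge (w : C) : Cmod w <= 1 / 4 -> Cmod w <= Cmod (cexp w - cexp (- w)).
Proof.
  intros H. pose proof (Cmod_ge_0 w).
  pose proof (Cmod_cexp_m1z w) as H1. pose proof (Cmod_cexp_m1z (- w)) as H2. rewrite Cmod_opp in H2.
  assert (H3 : Cmod w ^ 2 * exp (Cmod w) <= Cmod w / 3).
  { assert (exp (Cmod w) <= 4 / 3) by (eapply Rle_trans; [apply exp_le; exact H | exact exp_quarter]).
    pose proof (exp_pos (Cmod w)). nra. }
  assert (H4 : Cmod (2 * w) = 2 * Cmod w) by (rewrite Cmod_mult, Cmod_R, Rabs_pos_eq by lra; reflexivity).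
  pose proof (Cmod_sub_ge (2 * w) (2 * w - (cexp w - cexp (- w)))) as H5.
  replace (2 * w - (2 * w - (cexp w - cexp (- w))))%C with (cexp w - cexp (- w))%C in H5 by ring.
  assert (H6 : Cmod (2 * w - (cexp w - cexp (- w))) <= Cmod (cexp (- w) - 1 - - w) + Cmod (cexp w - 1 - w)).
  { replace (2 * w - (cexp w - cexp (- w)))%C with ((cexp (- w) - 1 - - w) - (cexp w - 1 - w))%C by ring.
    apply Cmod_triangle_minus. }
  lra.
Qed.

Lemma Cmod_cpow_le (x s : C) : x <> 0%C ->
  Cmod (cpow x (- s)) <= exp (- Re s * ln (Cmod x)) * exp (PI * Rabs (Im s)).
Proof.
  intros H. rewrite cpow_cexp by exact H. rewrite Cmod_cexp, <- exp_plus. apply exp_le.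
  replace (Re (- s * clog x)) with (- Re s * ln (Cmod x) + Im s * carg x) by (unfold Re, Im; simpl; ring).
  apply Rplus_le_compat_l. pose proof (carg_bound x).
  assert (Rabs (carg x) <= PI) by (apply Rabs_le; lra).
  pose proof (Rle_abs (Im s * carg x)). rewrite Rabs_mult in H2.
  pose proof (Rabs_pos (Im s)). pose proof (Rabs_pos (carg x)). nra.
Qed.

(** [Re s <= -4] gives [|x|^4], and the simple zero of [Sn] at 0 costs one power. The radius [1/16]
    ensures [pi |x| <= 1/4], as [Cmod_sinh_ge] requires. *)
Lemma Rintegrand_small (s x : C) : Re s <= -4 -> Cmod x <= 1 / 16 ->
  Cmod (Rintegrand s x) <= 3 * exp (PI * Rabs (Im s)) * Cmod x ^ 3 /\
  Cmod (x * dRint s x) <= 3 * exp (PI * Rabs (Im s)) * (Cmod s + 20) * Cmod x ^ 3.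
Proof.
  intros Hs Hx. pose proof PI_RGT_0 as HP. pose proof PI_4 as HP4. set (A := exp (PI * Rabs (Im s))).
  assert (HA : 0 < A) by apply exp_pos.
  assert (Hs0 : 0 <= Cmod s) by apply Cmod_ge_0.
  destruct (Ceq_dec x 0) as [-> | N].
  { unfold dRint. rewrite Rintegrand_0.
    replace (0 * (0 * (- s / 0 + 2 * (PI * Ci) * 0 - PI * Ci * Cs 0 / Sn 0)))%C with (RtoC 0) by ring.
    rewrite Cmod_0. split; right; ring. }
  assert (Hx0 : 0 < Cmod x) by (apply Cmod_gt_0; exact N).
  set (w := (PI * Ci * x)%C).
  assert (Hw : Cmod w <= 1 / 4) by (unfold w; rewrite Cmod_iPI; nra).
  assert (Hwx : Cmod x <= Cmod w) by (unfold w; rewrite Cmod_iPI; pose proof PI2_1; unfold PI2 in *; nra).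
  assert (HSn : Cmod x <= Cmod (Sn x)) by (eapply Rle_trans; [exact Hwx | apply Cmod_sinh_ge; exact Hw]).
  assert (HSn0 : Sn x <> 0%C) by (apply Cmod_gt_0; lra).
  assert (HCs : Cmod (Cs x) <= 3).
  { assert (HE : forall z, Cmod z <= 1 / 4 -> Cmod (cexp z) <= 4 / 3).
    { intros z Hz. rewrite Cmod_cexp. eapply Rle_trans; [apply exp_le | exact exp_quarter].
      pose proof (re_le_Cmod z). pose proof (Rle_abs (Re z)). lra. }
    unfold Cs. fold w. eapply Rle_trans; [apply Cmod_triangle|].
    pose proof (HE w Hw). assert (H2 := HE (- w)%C). rewrite Cmod_opp in H2. specialize (H2 Hw). lra. }
  assert (HP1 : Cmod (cpow x (- s)) <= Cmod x ^ 4 * A).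
  { eapply Rle_trans; [apply Cmod_cpow_le; exact N|]. fold A. apply Rmult_le_compat_r; [lra|].
    replace (Cmod x ^ 4) with (exp (4 * ln (Cmod x))).
    - apply exp_le. assert (ln (Cmod x) <= 0); [|nra]. rewrite <- ln_1. apply ln_le; lra.
    - replace (4 * ln (Cmod x)) with (INR 4 * ln (Cmod x)) by (simpl; ring).
      rewrite <- (Rpower_pow 4 (Cmod x) Hx0). unfold Rpower. reflexivity. }
  assert (HE : Cmod (cexp (PI * Ci * (x * x))) <= 3).
  { rewrite Cmod_cexp. pose proof exp_le_3. eapply Rle_trans; [apply exp_le with (b := 1)|exact H].
    pose proof (re_le_Cmod (PI * Ci * (x * x))). pose proof (Rle_abs (Re (PI * Ci * (x * x)))).
    rewrite Cmod_iPI, Cmod_mult in H0. nra. }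
  assert (Hf : Cmod (Rintegrand s x) <= 3 * A * Cmod x ^ 3).
  { unfold Rintegrand. fold (Sn x). rewrite Cmod_div by exact HSn0. rewrite Cmod_mult.
    apply (Rmult_le_reg_r (Cmod (Sn x))); [lra|]. unfold Rdiv. rewrite Rmult_assoc, Rinv_l by lra. rewrite Rmult_1_r.
    pose proof (Cmod_ge_0 (cpow x (- s))). pose proof (Cmod_ge_0 (cexp (PI * Ci * (x * x)))).
    apply Rle_trans with (Cmod x ^ 4 * A * 3); [apply Rmult_le_compat; assumption|].
    replace (Cmod x ^ 4 * A * 3) with (3 * A * Cmod x ^ 3 * Cmod x) by ring.
    apply Rmult_le_compat_l; [|exact HSn]. pose proof (pow_lt _ 3 Hx0). nra. }
  split; [exact Hf|].
  unfold dRint.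
  replace (x * (Rintegrand s x * (- s / x + 2 * (PI * Ci) * x - PI * Ci * Cs x / Sn x)))%C
    with (Rintegrand s x * (- s + 2 * (PI * Ci * (x * x)) - PI * Ci * (x * Cs x / Sn x)))%C by (field; split; assumption).
  rewrite Cmod_mult.
  assert (HB : Cmod (- s + 2 * (PI * Ci * (x * x)) - PI * Ci * (x * Cs x / Sn x)) <= Cmod s + 20).
  { eapply Rle_trans; [apply Cmod_triangle_minus|]. eapply Rle_trans; [apply Rplus_le_compat_r; apply Cmod_triangle|].
    rewrite Cmod_opp, (Cmod_mult 2), !Cmod_iPI, Cmod_R, Rabs_pos_eq, Cmod_mult, Cmod_div, Cmod_mult by (lra || assumption).
    assert (Cmod x * Cmod (Cs x) / Cmod (Sn x) <= 3).
    { apply (Rmult_le_reg_r (Cmod (Sn x))); [lra|]. unfold Rdiv. rewrite Rmult_assoc, Rinv_l by lra.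
      pose proof (Cmod_ge_0 (Cs x)). nra. }
    nra. }
  replace (3 * A * (Cmod s + 20) * Cmod x ^ 3) with (3 * A * Cmod x ^ 3 * (Cmod s + 20)) by ring.
  apply Rmult_le_compat; try apply Cmod_ge_0; assumption.
Qed.

Lemma CL_0_lin (g : C -> C) (l : C) B : (forall x, Cmod x <= 1 / 16 -> Cmod (g x - l) <= B * Cmod x) ->
  CL (locally (RtoC 0)) g l.
Proof.
  intros H. apply CL_eps. intros eps He.
  assert (HB : 0 < Rabs B + 1) by (pose proof (Rabs_pos B); lra).
  assert (Hd : 0 < Rmin (1 / 16) (eps / (Rabs B + 1))).
  { apply Rmin_glb_lt; [lra | apply Rdiv_lt_0_compat; lra]. }
  generalize (proj1 (CL_eps _ _) (CL_self (RtoC 0)) _ Hd). apply filter_imp.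
  intros x0. generalize (x0 : C). clear x0. intros x Hx.
  replace (x - 0)%C with x in Hx by ring.
  assert (H1 := Rlt_le_trans _ _ _ Hx (Rmin_l _ _)). assert (H2 := Rlt_le_trans _ _ _ Hx (Rmin_r _ _)).
  eapply Rle_lt_trans; [apply H; lra|].
  apply Rle_lt_trans with ((Rabs B + 1) * Cmod x).
  - pose proof (Rle_abs B). pose proof (Cmod_ge_0 x). nra.
  - replace eps with ((Rabs B + 1) * (eps / (Rabs B + 1))) by (field; lra). apply Rmult_lt_compat_l; assumption.
Qed.

Lemma star_holo_Rintegrand s : Re s <= -4 -> star_holo Dom (Rintegrand s) (dRint s).
Proof.
  intros Hs.
  assert (HC : forall A x, 0 <= A -> 0 <= x <= 1 / 16 -> A * x ^ 3 <= A * x).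
  { intros A x HA Hx. apply Rmult_le_compat_l; [exact HA|]. nra. }
  pose proof (exp_pos (PI * Rabs (Im s))). pose proof (Cmod_ge_0 s).
  split.
  - exact Dom_open.
  - exact Dom_star.
  - intros; apply Cder_Rintegrand; assumption.
  - intros; apply CL_dRint; assumption.
  - rewrite Rintegrand_0. eapply CL_0_lin. intros x Hx. replace (Rintegrand s x - 0)%C with (Rintegrand s x) by ring.
    eapply Rle_trans; [apply (Rintegrand_small s x Hs Hx)|]. apply HC; [nra|]. split; [apply Cmod_ge_0 | exact Hx].
  - eapply CL_0_lin. intros x Hx. replace (x * dRint s x - 0)%C with (x * dRint s x)%C by ring.
    eapply Rle_trans; [apply (Rintegrand_small s x Hs Hx)|]. apply HC; [nra|]. split; [apply Cmod_ge_0 | exact Hx].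
Qed.

(** The coefficient is chosen so that [x = eta * rho] turns the exponent into [- Lam eta * rho^2],
    the quadratic part of the phase at the saddle. *)
Definition gauss (x : C) : C := cexp (2 * (PI * Ci) * (x * x)).

Lemma star_holo_gauss : star_holo (fun _ => True) gauss (fun x => 4 * (PI * Ci) * x * gauss x)%C.
Proof.
  assert (HG : forall z, CL (locally z) gauss (gauss z)).
  { intros z. apply CL_cexp. apply CL_mult; [apply CL_const | apply CL_mult; apply CL_self]. }
  split; trivial.
  - intros z _. apply filter_forall. trivial.
  - intros g x a H _. eapply Cder_eq; [apply Cder_cexp; apply Cder_scal; apply Cder_mult; exact H|].
    unfold gauss. ring.
  - intros z _. apply CL_mult; [apply CL_mult; [apply CL_const | apply CL_self] | apply HG].
  - eapply CL_eq; [apply CL_mult; [apply CL_self|]; apply CL_mult; [apply CL_mult; [apply CL_const | apply CL_self] | apply HG]|].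
    ring.
Qed.

(** * Reduction of the contour to rays *)


(** For [k > 0], a closed sector with vertex 0 inside the first quadrant; there
    [Im (x^2) >= 2 k^2 |x|^2], so [e^(pi i x^2)] decays like a Gaussian. *)
Definition in_sector (k : R) (x : C) : Prop := k * Cmod x <= Re x /\ k * Cmod x <= Im x.

Lemma filterlim_inv_p_infty B : filterlim (fun r => B / r) (Rbar_locally p_infty) (locally 0).
Proof.
  apply filterlim_R_eps. intros eps He. exists (Rabs B / eps + 1). intros r Hr.
  assert (0 <= Rabs B / eps) by (apply Rmult_le_pos; [apply Rabs_pos | left; apply Rinv_0_lt_compat; exact He]).
  rewrite Rminus_0_r. unfold Rdiv. rewrite Rabs_mult, Rabs_inv, (Rabs_pos_eq r) by lra.
  apply (Rmult_lt_reg_r r); [lra|]. rewrite Rmult_assoc, Rinv_l, Rmult_1_r by lra.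
  apply Rle_lt_trans with (eps * (Rabs B / eps)); [right; field; lra|]. apply Rmult_lt_compat_l; lra.
Qed.

(** The segment joining the two far points has length [O(r)] and stays in the sector at distance
    comparable to [r], where [f] is [O(r^-2)]; the difference is thus [O(1/r)]. The offsets [d] and
    [e] absorb the crossing point [c] and the shift [1/4]. *)
Lemma ray_prim_same_limit D f df k B kap (p q d e : C) :
  star_holo D f df -> 0 < kap -> 0 < k <= kap / 4 ->
  (forall x, in_sector k x -> 1 <= Cmod x -> D x /\ Cmod (f x) * Cmod x ^ 2 <= B) ->
  kap <= Re p -> kap <= Im p -> kap <= Re q -> kap <= Im q ->
  Cmod p <= 1 -> Cmod q <= 1 -> Cmod d <= 1 -> Cmod e <= 1 ->
  CL (Rbar_locally p_infty) (fun r : R => ray_prim f (r * p + d) - ray_prim f (r * q + e))%C 0%C.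
Proof.
  intros S Hkap Hk Hdec P1 P2 Q1 Q2 P3 Q3 Hd He.
  (* The point [1 + i] lies in the sector, since [k <= 1/4] here, so the decay hypothesis itself
     shows that [B] is nonnegative. *)
  assert (HB : 0 <= B).
  { destruct (Hdec (1, 1)) as [_ H].
    - assert (Cmod (1, 1) <= 2) by (eapply Rle_trans; [apply Cmod_le_sum|]; simpl; rewrite Rabs_R1; lra).
      pose proof (re_le_Cmod p). pose proof (Rle_abs (Re p)).
      split; simpl; nra.
    - pose proof (re_le_Cmod (1, 1)). simpl in H. rewrite Rabs_R1 in H. exact H.
    - pose proof (Cmod_ge_0 (f (1, 1))). pose proof (pow2_ge_0 (Cmod (1, 1))). nra. }
  apply (CL_squeeze _ _ (fun r => (16 * B / kap ^ 2) / r)); [|apply filterlim_inv_p_infty].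
  assert (Hk2 : 0 < / kap) by (apply Rinv_0_lt_compat; exact Hkap).
  (* Beyond this threshold [kap * r > 2], so offsets of modulus at most 1 cost at most half of
     [kap * r], and moduli stay below [2 r]; hence [k <= kap / 4]. *)
  exists (2 / kap + 1). intros r Hr.
  assert (Hr1 : 1 < r) by (unfold Rdiv in Hr; lra).
  assert (Hr2 : 2 < kap * r).
  { replace 2 with (kap * (2 / kap)) by (field; lra). apply Rmult_lt_compat_l; lra. }
  replace (ray_prim f (r * p + d) - ray_prim f (r * q + e) - 0)%C with (ray_prim f (r * p + d) - ray_prim f (r * q + e))%C by ring.
  assert (HX : forall t, 0 <= t <= 1 ->
     let x := (r * q + e + t * (r * p + d - (r * q + e)))%C in
     in_sector k x /\ 1 <= Cmod x /\ kap * r / 2 <= Cmod x).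
  { intros t Ht x.
    assert (Hre : kap * r - 1 <= Re x).
    { replace (Re x) with (r * ((1 - t) * Re q + t * Re p) + ((1 - t) * Re e + t * Re d)) by (unfold x, Re, Im; simpl; ring).
      pose proof (re_le_Cmod d). pose proof (re_le_Cmod e).
      assert (- 1 <= Re d) by (pose proof (Rle_abs (- Re d)); rewrite Rabs_Ropp in *; lra).
      assert (- 1 <= Re e) by (pose proof (Rle_abs (- Re e)); rewrite Rabs_Ropp in *; lra).
      assert (kap <= (1 - t) * Re q + t * Re p) by nra.
      assert (-1 <= (1 - t) * Re e + t * Re d) by nra. nra. }
    assert (Him : kap * r - 1 <= Im x).
    { replace (Im x) with (r * ((1 - t) * Im q + t * Im p) + ((1 - t) * Im e + t * Im d)) by (unfold x, Re, Im; simpl; ring).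
      pose proof (Im_le_Cmod d). pose proof (Im_le_Cmod e).
      assert (- 1 <= Im d) by (pose proof (Rle_abs (- Im d)); rewrite Rabs_Ropp in *; lra).
      assert (- 1 <= Im e) by (pose proof (Rle_abs (- Im e)); rewrite Rabs_Ropp in *; lra).
      assert (kap <= (1 - t) * Im q + t * Im p) by nra.
      assert (-1 <= (1 - t) * Im e + t * Im d) by nra. nra. }
    assert (Hmod : Cmod x <= r + 1).
    { replace x with (RtoC r * ((1 - t)%R * q + t * p) + ((1 - t)%R * e + t * d))%C by (unfold x; rewrite RtoC_minus; ring).
      eapply Rle_trans; [apply Cmod_triangle|]. rewrite Cmod_mult, Cmod_R, Rabs_pos_eq by lra.
      assert (HQ : forall a b, Cmod a <= 1 -> Cmod b <= 1 -> Cmod ((1 - t)%R * a + t * b) <= 1).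
      { intros a b Ha Hb. eapply Rle_trans; [apply Cmod_triangle|]. rewrite !Cmod_mult, !Cmod_R, !Rabs_pos_eq by lra. nra. }
      pose proof (HQ q p Q3 P3). pose proof (HQ e d He Hd). nra. }
    assert (Hx2 : Re x <= Cmod x) by (eapply Rle_trans; [apply Rle_abs | apply re_le_Cmod]).
    pose proof (Cmod_ge_0 x).
    repeat split; nra. }
  eapply Rle_trans; [apply (ray_prim_diff _ _ _ S _ _ (4 * B / (kap * r) ^ 2))|].
  - intros t Ht. destruct (HX t Ht) as [A1 [A2 A3]]. apply Hdec; assumption.
  - intros t Ht. destruct (HX t Ht) as [A1 [A2 A3]]. destruct (Hdec _ A1 A2) as [_ A4].
    set (x := (r * q + e + t * (r * p + d - (r * q + e)))%C) in *. pose proof (Cmod_ge_0 (f x)).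
    apply (Rmult_le_reg_r ((kap * r) ^ 2)); [nra|].
    replace (4 * B / (kap * r) ^ 2 * (kap * r) ^ 2) with (4 * B) by (field; nra).
    apply Rle_trans with (Cmod (f x) * (4 * Cmod x ^ 2)); [apply Rmult_le_compat_l; [assumption|]; nra | lra].
  - assert (Cmod (r * p + d - (r * q + e)) <= 4 * r).
    { eapply Rle_trans; [apply Cmod_triangle_minus|].
      pose proof (Cmod_triangle (r * p) d). pose proof (Cmod_triangle (r * q) e).
      rewrite Cmod_mult, Cmod_R, Rabs_pos_eq in H, H0 by lra. nra. }
    replace (16 * B / kap ^ 2 / r) with (4 * r * (4 * B / (kap * r) ^ 2)) by (field; split; nra).
    apply Rmult_le_compat_r; [|assumption]. apply Rmult_le_pos; [lra|]. left. apply Rinv_0_lt_compat. nra.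
Qed.

Lemma CL_cauchy_inv (Phi : R -> C) B : (forall a b, 1 <= a <= b -> Cmod (Phi b - Phi a) <= B / a) ->
  exists L, CL (Rbar_locally p_infty) Phi L.
Proof.
  intros H.
  assert (HP : forall eps, 0 < eps -> exists M, forall u v, M < u -> M < v -> Cmod (Phi v - Phi u) < eps).
  { intros eps He. destruct (proj1 (filterlim_R_eps _ _) (filterlim_inv_p_infty B) eps He) as [M HM].
    exists (Rmax 1 M).
    assert (HW : forall u v, Rmax 1 M < u -> u <= v -> Cmod (Phi v - Phi u) < eps).
    { intros u v Hu Huv. pose proof (Rmax_l 1 M). pose proof (Rmax_r 1 M).
      eapply Rle_lt_trans; [apply H; lra|]. assert (Hu2 : M < u) by lra. specialize (HM u Hu2).
      rewrite Rminus_0_r in HM. eapply Rle_lt_trans; [apply Rle_abs | exact HM]. }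
    intros u v Hu Hv. destruct (Rle_dec u v); [apply HW; assumption|].
    rewrite Cmod_minus_sym. apply HW; lra. }
  apply CL_cauchy. intros eps He. destruct (HP eps He) as [M HM]. exists (fun r => M < r). split; [exists M; trivial | exact HM].
Qed.

Lemma Sn_ge x : 0 < Im x -> Im x <= Cmod (Sn x).
Proof.
  intros H. pose proof PI2_1. unfold PI2 in H0.
  unfold Sn. rewrite Cmod_minus_sym. eapply Rle_trans; [|apply Cmod_sub_ge].
  rewrite !Cmod_cexp. replace (Re (- (PI * Ci * x))) with (PI * Im x) by (unfold Re, Im; simpl; ring).
  rewrite Re_iPI. pose proof (exp_ineq1_le (PI * Im x)).
  assert (exp (- (PI * Im x)) <= 1) by (rewrite <- exp_0; apply exp_le; nra). nra.
Qed.

Lemma exp_neg_le u : 0 <= u -> exp (- u) <= / (1 + u).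
Proof.
  intros H. rewrite exp_Ropp. apply Rinv_le_contravar; [lra | apply exp_ineq1_le].
Qed.

Lemma exp_quad_bound a m x : 0 < a -> m * x - a * x ^ 2 <= m ^ 2 / (4 * a).
Proof.
  intros Ha. apply (Rmult_le_reg_r (4 * a)); [lra|].
  replace (m ^ 2 / (4 * a) * (4 * a)) with (m ^ 2) by (field; lra). pose proof (pow2_ge_0 (m - 2 * a * x)). nra.
Qed.

Lemma Rintegrand_decay s k : Re s <= -4 -> 0 < k -> exists B, forall x, in_sector k x -> 1 <= Cmod x ->
  Dom x /\ Cmod (Rintegrand s x) * Cmod x ^ 2 <= B.
Proof.
  (* With [m = |x|], the exponent [(2 - Re s) m - k^2 m^2] is maximised by completing the square:
     [ln m <= m] bounds the power, [m^2 <= e^(2m)] accounts for the 2, and [|Sn x| >= Im x >= k] for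
     the division by [k]. *)
  intros Hs Hk. exists (exp (PI * Rabs (Im s)) * exp ((2 - Re s) ^ 2 / (4 * k ^ 2)) / k).
  intros x [H1 H2] Hx. pose proof PI2_1 as HPI. unfold PI2 in HPI.
  assert (Hk1 : k <= k * Cmod x) by nra.
  assert (HD : Dom x) by (left; lra).
  split; [exact HD|].
  assert (HS := Sn_ge x ltac:(lra)).
  pose proof (Sn_neq_0 _ HD) as HS0. pose proof (slit_neq_0 _ (Dom_slit _ HD)) as N.
  set (m := Cmod x) in *. set (A := exp (PI * Rabs (Im s))). assert (HA : 0 < A) by apply exp_pos.
  assert (HP : Cmod (cpow x (- s)) <= exp (- Re s * m) * A).
  { eapply Rle_trans; [apply Cmod_cpow_le; exact N|]. apply Rmult_le_compat_r; [left; exact HA|]. apply exp_le.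
    fold m. apply Rmult_le_compat_l; [lra|]. pose proof (exp_ineq1_le (ln m)). rewrite exp_ln in H by lra. lra. }
  assert (HE : Cmod (cexp (PI * Ci * (x * x))) <= exp (- k ^ 2 * m ^ 2)).
  { rewrite Cmod_cexp, Re_iPI. apply exp_le.
    replace (Im (x * x)) with (2 * Re x * Im x) by (unfold Re, Im; simpl; ring).
    assert (k * m * (k * m) <= Re x * Im x) by (apply Rmult_le_compat; nra).
    assert (0 <= Re x * Im x) by nra. nra. }
  assert (Hm2 : m ^ 2 <= exp (2 * m)).
  { replace (2 * m) with (m + m) by ring. rewrite exp_plus. pose proof (exp_ineq1_le m). nra. }
  unfold Rintegrand. fold (Sn x). rewrite Cmod_div, Cmod_mult by exact HS0.
  apply Rle_trans with (exp (- Re s * m) * A * exp (- k ^ 2 * m ^ 2) / k * exp (2 * m)).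
  - apply Rmult_le_compat; [|apply pow2_ge_0| |exact Hm2].
    + apply Rmult_le_pos; [apply Rmult_le_pos; apply Cmod_ge_0 | left; apply Rinv_0_lt_compat; lra].
    + apply Rmult_le_compat; [apply Rmult_le_pos; apply Cmod_ge_0 | left; apply Rinv_0_lt_compat; lra | |].
      * apply Rmult_le_compat; try apply Cmod_ge_0; assumption.
      * apply Rinv_le_contravar; lra.
  - replace (exp (- Re s * m) * A * exp (- k ^ 2 * m ^ 2) / k * exp (2 * m)) with
      (A * (exp (- Re s * m) * exp (- k ^ 2 * m ^ 2) * exp (2 * m)) / k) by (field; lra).
    rewrite <- !exp_plus. apply Rmult_le_compat_r; [left; apply Rinv_0_lt_compat; exact Hk|].
    apply Rmult_le_compat_l; [lra|]. apply exp_le.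
    assert (Hk2 : 0 < k ^ 2) by nra.
    pose proof (exp_quad_bound (k ^ 2) (2 - Re s) m Hk2). lra.
Qed.

Lemma clog_opp x : 0 < Im x -> clog (- x) = (clog x - PI * Ci)%C.
Proof.
  intros H. assert (N : x <> 0%C) by (apply slit_neq_0; right; lra).
  apply clog_unique.
  - rewrite cexp_minus, cexp_clog by exact N.
    replace (cexp (PI * Ci)) with (RtoC (-1)); [field; intros E; apply RtoC_inj in E; lra|].
    unfold cexp; apply C_eq; simpl.
    + replace (PI * 0 - 0 * 1) with 0 by ring. replace (PI * 1 + 0 * 0) with PI by ring. rewrite exp_0, cos_PI. ring.
    + replace (PI * 0 - 0 * 1) with 0 by ring. replace (PI * 1 + 0 * 0) with PI by ring. rewrite exp_0, sin_PI. ring.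
  - pose proof (carg_Im_pos_bound x H). unfold Im; simpl. change (snd (clog x)) with (carg x). lra.
Qed.

Lemma Rintegrand_opp s x : 0 < Im x -> Rintegrand s (- x) = (- (cexp (PI * Ci * s) * Rintegrand s x))%C.
Proof.
  intros H. assert (HD : Dom x) by (left; lra). pose proof (Sn_neq_0 _ HD) as NS.
  assert (N : x <> 0%C) by (apply slit_neq_0; right; lra).
  assert (N' : (- x)%C <> 0%C) by (intros E; apply N; replace x with (- - x)%C by ring; rewrite E; ring).
  rewrite !Rintegrand_exp by assumption. unfold Rint_exp. rewrite clog_opp by exact H.
  replace (Sn (- x)) with (- Sn x)%C.
  - replace (- s * (clog x - PI * Ci) + PI * Ci * (- x * - x))%C with (PI * Ci * s + (- s * clog x + PI * Ci * (x * x)))%C by ring.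
    rewrite cexp_plus. field. exact NS.
  - unfold Sn. replace (- (PI * Ci * - x))%C with (PI * Ci * x)%C by ring.
    replace (PI * Ci * - x)%C with (- (PI * Ci * x))%C by ring. ring.
Qed.

Lemma CInt_scal_l (c : C) g : (forall t, 0 <= t <= 1 -> CL (locally t) g (g t)) ->
  CInt (fun t => c * g t)%C = (c * CInt g)%C.
Proof.
  intros H. destruct (ex_RInt_CL g H) as [E1 E2].
  apply (@RInt_correct R_CompleteNormedModule) in E1. apply (@RInt_correct R_CompleteNormedModule) in E2.
  unfold CInt. apply C_eq.
  - apply is_RInt_unique.
    apply (@is_RInt_minus R_NormedModule (fun t => Re c * Re (g t)) (fun t => Im c * Im (g t)));
    apply (@is_RInt_scal R_NormedModule); assumption.
  - apply is_RInt_unique.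
    apply (@is_RInt_plus R_NormedModule (fun t => Re c * Im (g t)) (fun t => Im c * Re (g t)));
    apply (@is_RInt_scal R_NormedModule); assumption.
Qed.

Lemma ray_prim_Rintegrand_opp s z : Re s <= -4 -> 0 < Im z ->
  ray_prim (Rintegrand s) (- z) = (cexp (PI * Ci * s) * ray_prim (Rintegrand s) z)%C.
Proof.
  intros Hs Hz. assert (HD : Dom z) by (left; lra).
  rewrite !ray_prim_clip. rewrite <- CInt_scal_l.
  - apply CInt_ext. intros t Ht. rewrite clip_id by lra.
    replace (t * - z)%C with (- (t * z))%C by ring. rewrite Rintegrand_opp; [ring|].
    replace (Im (t * z)) with (t * Im z) by (unfold Im; simpl; ring). nra.
  - intros t Ht. apply (sh_ray_CL _ _ _ (star_holo_Rintegrand s Hs)); assumption.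
Qed.

Lemma omega_parts : Re omega = - / sqrt 2 /\ Im omega = - / sqrt 2.
Proof.
  unfold omega, cexp; simpl. rewrite exp_0, cos_neg, sin_neg.
  replace (3 * PI / 4) with (3 * (PI / 4)) by lra. rewrite cos_3PI4, sin_3PI4.
  pose proof Rlt_sqrt2_0. split; field; lra.
Qed.

Lemma inv_sqrt2_bound : 1 / 2 <= / sqrt 2.
Proof.
  pose proof Rlt_sqrt2_0. pose proof (sqrt_sqrt 2 ltac:(lra)).
  unfold Rdiv; rewrite Rmult_1_l. apply Rinv_le_contravar; [exact H|]. nra.
Qed.

Lemma Cmod_omega : Cmod omega = 1.
Proof. unfold omega. rewrite Cmod_cexp; simpl. apply exp_0. Qed.

Lemma Dom_line c (u : R) : 0 < c < 1 -> Dom (c + u * omega)%C.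
Proof.
  intros Hc. destruct omega_parts as [H1 H2]. pose proof inv_sqrt2_bound.
  destruct (Req_dec u 0) as [-> | N].
  - right. replace (Re (c + 0 * omega)) with c by (unfold Re; simpl; ring). exact Hc.
  - left. replace (Im (c + u * omega)) with (u * Im omega) by (unfold Im; simpl; ring). rewrite H2. nra.
Qed.

Lemma is_RInt_Cder (F f : R -> C) (a b : R) : (forall u, Cder F u (f u)) -> (forall u, CL (locally u) f (f u)) ->
  @is_RInt C_R_CompleteNormedModule f a b (F b - F a)%C.
Proof.
  intros HF HC.
  assert (H1 : is_RInt (fun u => Re (f u)) a b (minus (Re (F b)) (Re (F a)))).
  { apply (@is_RInt_derive R_CompleteNormedModule (fun u => Re (F u)) (fun u => Re (f u)));
      intros u _; [apply HF | apply HC]. }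
  assert (H2 : is_RInt (fun u => Im (f u)) a b (minus (Im (F b)) (Im (F a)))).
  { apply (@is_RInt_derive R_CompleteNormedModule (fun u => Im (F u)) (fun u => Im (f u)));
      intros u _; [apply HF | apply HC]. }
  exact (@is_RInt_fct_extend_pair R_NormedModule R_NormedModule f a b _ _ H1 H2).
Qed.

Lemma is_RInt_line s c (a b : R) : 0 < c < 1 -> Re s <= -4 ->
  @is_RInt C_R_CompleteNormedModule (fun u : R => Rintegrand s (c + u * omega) * omega)%C a b
   (ray_prim (Rintegrand s) (c + b * omega) - ray_prim (Rintegrand s) (c + a * omega))%C.
Proof.
  intros Hc Hs. pose proof (star_holo_Rintegrand s Hs) as S.
  assert (HF : forall u : R, Cder (fun u : R => ray_prim (Rintegrand s) (c + u * omega))%C u (Rintegrand s (c + u * omega) * omega)%C).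
  { intros u. eapply Cder_eq; [apply (Cder_ray_prim _ _ _ S); apply Dom_line; exact Hc|]. ring. }
  assert (HC : forall u : R, CL (locally u) (fun u : R => Rintegrand s (c + u * omega) * omega)%C (Rintegrand s (c + u * omega) * omega)%C).
  { intros u. eapply Cder_CL. apply Cder_mult; [|apply Cder_const].
    apply (sh_der _ _ _ S (fun u : R => c + u * omega)%C); [apply Cder_line | apply Dom_line; exact Hc]. }
  exact (is_RInt_Cder _ _ a b HF HC).
Qed.

(** As [u] tends to [+oo] the line runs into the third quadrant, which the symmetry reflects into
    the first; so [e^(pi i s)] falls on the upper limit and the lower limit contributes [L]
    alone. *)
Lemma RiemannR_ray s c (e : C) kap : 0 < c < 1 -> Re s <= -4 -> Cmod e = 1 -> 0 < kap <= 1 / 2 ->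
  kap <= Re e -> kap <= Im e ->
  exists L, CL (Rbar_locally p_infty) (fun r : R => ray_prim (Rintegrand s) (r * e)) L /\
    RiemannR c s = ((cexp (PI * Ci * s) - 1) * L)%C.
Proof.
  intros Hc Hs He Hkap He1 He2. pose proof (star_holo_Rintegrand s Hs) as S.
  destruct (Rintegrand_decay s (kap / 4) Hs ltac:(lra)) as [B HB].
  assert (HB2 : forall r, 1 <= r -> Dom (r * e)%C /\ Cmod (Rintegrand s (r * e)%C) * r ^ 2 <= B).
  { intros r Hr. assert (E : Cmod (r * e) = r) by (rewrite Cmod_mult, Cmod_R, Rabs_pos_eq, He by lra; ring).
    destruct (HB (r * e)%C) as [A1 A2]; [| lra | rewrite E in A2; split; assumption].
    split; rewrite E.
    - replace (Re (r * e)) with (r * Re e) by (unfold Re; simpl; ring). nra.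
    - replace (Im (r * e)) with (r * Im e) by (unfold Im; simpl; ring). nra. }
  destruct (CL_cauchy_inv (fun r => ray_prim (Rintegrand s) (r * e)%C) B) as [L HL].
  { intros a b Hab.
    assert (HB0 : 0 <= B).
    { destruct (HB2 1 ltac:(lra)) as [_ H]. pose proof (Cmod_ge_0 (Rintegrand s (1 * e)%C)). lra. }
    assert (M := mean_value_C (fun r => ray_prim (Rintegrand s) (0 + r * e)%C) (fun r => e * Rintegrand s (0 + r * e)%C)%C
      (fun r => - B / r) (fun r => B / r ^ 2) a b).
    cbv beta in M. replace (0 + a * e)%C with (a * e)%C in M by ring. replace (0 + b * e)%C with (b * e)%C in M by ring.
    eapply Rle_trans; [apply M; [lra | | |]|].
    - intros x Hx. apply (Cder_ray_prim _ _ _ S). replace (0 + x * e)%C with (x * e)%C by ring. apply HB2; lra.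
    - intros x Hx. auto_derive; [lra | field; lra].
    - intros x Hx. cbv beta. replace (0 + x * e)%C with (x * e)%C by ring. rewrite Cmod_mult, He, Rmult_1_l.
      destruct (HB2 x ltac:(lra)) as [_ H]. apply (Rmult_le_reg_r (x ^ 2)); [nra|].
      replace (B / x ^ 2 * x ^ 2) with B by (field; nra). exact H.
    - assert (0 <= B / b) by (apply Rmult_le_pos; [exact HB0 | left; apply Rinv_0_lt_compat; lra]).
      unfold Rdiv in *. lra. }
  exists L. split; [exact HL|].
  destruct omega_parts as [O1 O2]. pose proof inv_sqrt2_bound as O3.
  (* [- omega] is the direction [e^(pi i/4)] of the upper end of the line; [d] will be [c] for that
     end and [- c] for the reflected one. *)
  assert (HS : forall d : C, Cmod d <= 1 -> CL (Rbar_locally p_infty) (fun r : R => ray_prim (Rintegrand s) (r * - omega + d)%C) L).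
  { intros d Hd.
    apply (CL_ext (fun r : R => (ray_prim (Rintegrand s) (r * - omega + d) - ray_prim (Rintegrand s) (r * e + 0)) + ray_prim (Rintegrand s) (r * e)))%C.
    { intros r. replace (r * e + 0)%C with (r * e)%C by ring. ring. }
    eapply CL_eq; [apply CL_plus; [|exact HL]|].
    - apply (ray_prim_same_limit _ _ _ (kap / 4) B kap _ _ _ _ S); try lra; try exact HB.
      + unfold Re in *; simpl in *; lra.
      + unfold Im in *; simpl in *; lra.
      + rewrite Cmod_opp, Cmod_omega. lra.
      + rewrite Cmod_0. lra.
    - ring. }
  assert (Hc1 : Cmod c <= 1) by (rewrite Cmod_R, Rabs_pos_eq; lra).
  assert (Hplus : CL (Rbar_locally p_infty) (fun b : R => ray_prim (Rintegrand s) (c + b * omega)%C) (cexp (PI * Ci * s) * L)%C).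
  { apply (CL_ext_loc (fun b : R => cexp (PI * Ci * s) * ray_prim (Rintegrand s) (b * - omega + - c))%C).
    - exists 0. intros b Hb. rewrite <- ray_prim_Rintegrand_opp; [f_equal; ring | exact Hs|].
      replace (Im (b * - omega + - c)) with (- (b * Im omega)) by (unfold Im; simpl; ring). rewrite O2. nra.
    - apply CL_mult; [apply CL_const | apply HS]. rewrite Cmod_opp. exact Hc1. }
  assert (Hminus : CL (Rbar_locally m_infty) (fun a : R => ray_prim (Rintegrand s) (c + a * omega)%C) L).
  { apply (CL_ext (fun a : R => ray_prim (Rintegrand s) ((- a)%R * - omega + c)%C)).
    - intros a. f_equal. rewrite RtoC_opp. ring.
    - apply (CL_comp (G := Rbar_locally p_infty) (fun a => - a) (fun r : R => ray_prim (Rintegrand s) (r * - omega + c)%C)).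
      + intros P [M HM]. exists (- M). intros x Hx. apply HM. lra.
      + apply HS. exact Hc1. }
  unfold RiemannR. refine (@is_RInt_gen_unique C_R_CompleteNormedModule _ _ _ _ _ _ _).
  assert (HT : CL (filter_prod (Rbar_locally m_infty) (Rbar_locally p_infty))
     (fun ab : R * R => ray_prim (Rintegrand s) (c + snd ab * omega) - ray_prim (Rintegrand s) (c + fst ab * omega))%C
     ((cexp (PI * Ci * s) - 1) * L)%C).
  { eapply CL_eq; [apply CL_minus|].
    - apply (CL_comp (fun ab : R * R => snd ab) (fun b : R => ray_prim (Rintegrand s) (c + b * omega)%C) _ filterlim_snd Hplus).
    - apply (CL_comp (fun ab : R * R => fst ab) (fun b : R => ray_prim (Rintegrand s) (c + b * omega)%C) _ filterlim_fst Hminus).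
    - ring. }
  intros P HP. generalize (proj1 (CL_filterlim _ _) HT P HP). unfold filtermap, filtermapi. apply filter_imp.
  intros [a b] Hab. simpl in *. eexists; split; [|exact Hab]. apply is_RInt_line; assumption.
Qed.

(** * The Gaussian integral *)


Lemma omega_sq : (omega * omega)%C = Ci.
Proof.
  destruct omega_parts as [H1 H2]. pose proof Rlt_sqrt2_0. pose proof (sqrt_sqrt 2 ltac:(lra)).
  assert (E : / sqrt 2 * / sqrt 2 = 1 / 2) by (rewrite <- Rinv_mult, H0; lra).
  apply C_eq; unfold Re, Im in *; simpl in *; rewrite H1, H2; lra.
Qed.

Lemma omega_neq_0 : omega <> 0%C.
Proof. apply Cmod_gt_0. rewrite Cmod_omega. lra. Qed.

(* 2 pi gaussA^2 + gaussB is constant, which gives the Gaussian integral since gaussB tends to 0. *)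
Definition gaussA (x : R) : R := RInt (fun t => x * exp (- (2 * PI * x ^ 2) * t ^ 2)) 0 1.
Definition gaussB (x : R) : R := RInt (fun t => exp (- (2 * PI * x ^ 2) * (1 + t ^ 2)) / (1 + t ^ 2)) 0 1.

Lemma gauss_ray (x : R) : gauss (x * - omega) = RtoC (exp (- (2 * PI * x ^ 2))).
Proof.
  unfold gauss. rewrite <- cexp_RtoC. f_equal.
  replace (x * - omega * (x * - omega))%C with (x * x * (omega * omega))%C by ring. rewrite omega_sq.
  apply C_eq; unfold Re, Im; simpl; ring.
Qed.

Lemma ray_prim_gauss_ray (x : R) : ray_prim gauss (x * - omega) = (- omega * gaussA x)%C.
Proof.
  assert (HC : forall t : R, CL (locally t) (fun t : R => RtoC (x * exp (- (2 * PI * x ^ 2) * t ^ 2))) (RtoC (x * exp (- (2 * PI * x ^ 2) * t ^ 2)))).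
  { intros t. apply (CL_RtoC (fun t : R => x * exp (- (2 * PI * x ^ 2) * t ^ 2))). apply (@ex_derive_continuous R_AbsRing R_NormedModule (fun t => x * exp (- (2 * PI * x ^ 2) * t ^ 2))). auto_derive; trivial. }
  unfold ray_prim. rewrite (CInt_ext _ (fun t : R => - omega * RtoC (x * exp (- (2 * PI * x ^ 2) * t ^ 2)))%C).
  - rewrite CInt_scal_l by (intros; apply HC). f_equal. unfold CInt, gaussA, RtoC. apply C_eq; simpl; [reflexivity|].
    rewrite RInt_const. unfold scal; simpl; unfold mult; simpl. ring.
  - intros t Ht. replace (t * (x * - omega))%C with ((t * x)%R * - omega)%C by (rewrite RtoC_mult; ring).
    rewrite gauss_ray, RtoC_mult. replace (- (2 * PI * (t * x) ^ 2)) with (- (2 * PI * x ^ 2) * t ^ 2) by ring. ring.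
Qed.

(** Up to the constant [- omega], [gaussA] is the ray primitive of [gauss], so [Cder_ray_prim]
    already contains its derivative. *)
Lemma is_derive_gaussA x : is_derive gaussA x (exp (- (2 * PI * x ^ 2))).
Proof.
  assert (H : Cder (fun u : R => / (- omega) * ray_prim gauss (0 + u * - omega))%C x (RtoC (exp (- (2 * PI * x ^ 2))))).
  { eapply Cder_eq; [apply Cder_scal; apply (Cder_ray_prim _ _ _ star_holo_gauss); trivial|].
    replace (0 + x * - omega)%C with (x * - omega)%C by ring. rewrite gauss_ray. field.
    intros E. apply omega_neq_0. replace omega with (- - omega)%C by ring. rewrite E. ring. }
  destruct H as [H _]. revert H. apply is_derive_ext. intros u.
  replace (0 + u * - omega)%C with (u * - omega)%C by ring. rewrite ray_prim_gauss_ray.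
  replace (/ - omega * (- omega * gaussA u))%C with (RtoC (gaussA u)); [reflexivity|]. field.
  intros E. apply omega_neq_0. replace omega with (- - omega)%C by ring. rewrite E. ring.
Qed.

Lemma is_derive_gaussB x : is_derive gaussB x (- (4 * PI) * exp (- (2 * PI * x ^ 2)) * gaussA x).
Proof.
  set (f := fun y t => exp (- (2 * PI * y ^ 2) * (1 + t ^ 2)) / (1 + t ^ 2)).
  set (df := fun y t => - (4 * PI * y) * exp (- (2 * PI * y ^ 2) * (1 + t ^ 2))).
  assert (Hd : forall y t : R, is_derive (fun u => f u t) y (df y t)).
  { intros y t. unfold f, df. auto_derive; [nra|]. replace (- (2 * PI * (y * (y * 1))) * (1 + t * (t * 1))) with (- (2 * PI * y ^ 2) * (1 + t ^ 2)) by ring. field. nra. }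
  replace (- (4 * PI) * exp (- (2 * PI * x ^ 2)) * gaussA x) with (RInt (fun t => Derive (fun u => f u t) x) 0 1).
  - apply (is_derive_RInt_param f).
    + apply filter_forall. intros y t _. eexists; apply Hd.
    + intros t _. apply continuity_2d_pt_filterlim.
      apply (filterlim_ext (fun p => df (fst p) (snd p))).
      { intros p. symmetry. apply is_derive_unique. apply Hd. }
      assert (E : Derive (fun z : R => f z t) x = df x t) by (apply is_derive_unique; apply Hd).
      rewrite E. unfold df.
      assert (Hf : filterlim (fun p : R * R => fst p) (locally (x, t)) (locally x)).
      { intros P [eps HP]. exists eps. intros y [A B]. apply HP. exact A. }
      assert (Hs : filterlim (fun p : R * R => snd p) (locally (x, t)) (locally t)).
      { intros P [eps HP]. exists eps. intros y [A B]. apply HP. exact B. }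
      apply filterlim_mult_R.
      * apply (filterlim_cont_R (fun y => - (4 * PI * y))); [exact Hf | auto_derive; trivial].
      * apply (filterlim_cont_R exp (fun p : R * R => - (2 * PI * fst p ^ 2) * (1 + snd p ^ 2))); [|auto_derive; trivial].
        apply filterlim_mult_R.
        -- apply (filterlim_cont_R (fun y => - (2 * PI * y ^ 2))); [exact Hf | auto_derive; trivial].
        -- apply (filterlim_cont_R (fun y => 1 + y ^ 2)); [exact Hs | auto_derive; trivial].
    + apply filter_forall. intros y. apply (@ex_RInt_continuous R_CompleteNormedModule). intros t _.
      apply (@ex_derive_continuous R_AbsRing R_NormedModule). unfold f. auto_derive. nra.
  - unfold gaussA.
    rewrite (RInt_ext _ (fun t => scal (- (4 * PI) * exp (- (2 * PI * x ^ 2))) (x * exp (- (2 * PI * x ^ 2) * t ^ 2)))).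
    + apply is_RInt_unique. apply (@is_RInt_scal R_NormedModule). apply (@RInt_correct R_CompleteNormedModule).
      apply (@ex_RInt_continuous R_CompleteNormedModule). intros t _.
      apply (@ex_derive_continuous R_AbsRing R_NormedModule). auto_derive. trivial.
    + intros t _. assert (E : Derive (fun u : R => f u t) x = df x t) by (apply is_derive_unique; apply Hd).
      rewrite E. unfold df, scal; simpl; unfold mult; simpl.
      replace (- (2 * PI * (x * (x * 1))) * (1 + t * (t * 1))) with (- (2 * PI * (x * (x * 1))) + - (2 * PI * (x * (x * 1))) * (t * (t * 1))) by ring.
      rewrite exp_plus. ring.
Qed.

Lemma gaussA_0 : gaussA 0 = 0.
Proof.
  unfold gaussA. rewrite (RInt_ext _ (fun _ => 0)), RInt_const; [unfold scal; simpl; unfold mult; simpl; ring|].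
  intros; apply Rmult_0_l.
Qed.

Lemma gaussB_0 : gaussB 0 = PI / 4.
Proof.
  transitivity (minus (atan 1) (atan 0)); [|rewrite atan_0, atan_1; unfold minus, plus, opp; simpl; lra].
  apply is_RInt_unique. apply (@is_RInt_derive R_CompleteNormedModule atan).
  - intros t _. evar_last; [apply is_derive_atan|].
    replace (- (2 * PI * 0 ^ 2) * (1 + t ^ 2)) with 0 by ring. rewrite exp_0. unfold Rsqr. field. nra.
  - intros t _. apply (@ex_derive_continuous R_AbsRing R_NormedModule). auto_derive. nra.
Qed.

Lemma gauss_identity x : 2 * PI * gaussA x ^ 2 + gaussB x = PI / 4.
Proof.
  rewrite <- gaussB_0. replace (gaussB 0) with (2 * PI * gaussA 0 ^ 2 + gaussB 0) by (rewrite gaussA_0; ring).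
  set (h := fun x => 2 * PI * gaussA x ^ 2 + gaussB x). change (h x = h 0).
  assert (Hd : forall y, is_derive h y 0).
  { intros y. unfold h.
    apply (is_derive_ext (fun x => 2 * PI * (gaussA x * gaussA x) + gaussB x)).
    { intros z. change (2 * PI * (gaussA z * gaussA z) + gaussB z = 2 * PI * gaussA z ^ 2 + gaussB z). ring. }
    evar_last.
    - apply @is_derive_plus; [apply is_derive_scal; apply is_derive_mult_R; apply is_derive_gaussA | apply is_derive_gaussB].
    - unfold plus; simpl. ring. }
  destruct (MVT_gen h 0 x (fun _ => 0)) as [c [_ E]].
  - intros; apply Hd.
  - intros y _. apply continuity_pt_filterlim. apply (@ex_derive_continuous R_AbsRing R_NormedModule). eexists; apply Hd.
  - lra.
Qed.

Lemma gaussB_bound x : 0 <= gaussB x <= exp (- (2 * PI * x ^ 2)).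
Proof.
  pose proof PI_RGT_0.
  assert (E : ex_RInt (fun t => exp (- (2 * PI * x ^ 2) * (1 + t ^ 2)) / (1 + t ^ 2)) 0 1).
  { apply (@ex_RInt_continuous R_CompleteNormedModule). intros t _.
    apply (@ex_derive_continuous R_AbsRing R_NormedModule). auto_derive. nra. }
  assert (P : forall t, 0 <= exp (- (2 * PI * x ^ 2) * (1 + t ^ 2)) / (1 + t ^ 2) <= exp (- (2 * PI * x ^ 2))).
  { intros t. pose proof (pow2_ge_0 t). pose proof (pow2_ge_0 x).
    assert (exp (- (2 * PI * x ^ 2) * (1 + t ^ 2)) <= exp (- (2 * PI * x ^ 2))).
    { apply exp_le. assert (0 <= 2 * PI * x ^ 2 * t ^ 2) by (apply Rmult_le_pos; [apply Rmult_le_pos; lra | lra]). lra. }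
    pose proof (exp_pos (- (2 * PI * x ^ 2) * (1 + t ^ 2))).
    split; [apply Rmult_le_pos; [lra | left; apply Rinv_0_lt_compat; lra]|].
    set (A := exp (- (2 * PI * x ^ 2) * (1 + t ^ 2))) in *.
    apply (Rmult_le_reg_r (1 + t ^ 2)); [lra|]. replace (A / (1 + t ^ 2) * (1 + t ^ 2)) with A by (field; lra).
    pose proof (exp_pos (- (2 * PI * x ^ 2))). nra. }
  unfold gaussB. split.
  - apply RInt_ge_0; [lra | exact E|]. intros; apply P.
  - apply Rle_trans with (RInt (fun _ => exp (- (2 * PI * x ^ 2))) 0 1).
    + apply RInt_le; [lra | exact E | apply ex_RInt_const|]. intros; apply P.
    + rewrite RInt_const. unfold scal; simpl; unfold mult; simpl. lra.
Qed.

(** The limit is half the integral of [e^(-2 pi x^2)] over the real line. Reading [gauss_identity]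
    as a difference of squares bounds the distance to it by a multiple of [gaussB]. *)
Lemma gaussA_limit : filterlim gaussA (Rbar_locally p_infty) (locally (/ (2 * sqrt 2))).
Proof.
  pose proof PI_RGT_0. pose proof PI2_1 as HP. unfold PI2 in HP. pose proof Rlt_sqrt2_0. pose proof (sqrt_sqrt 2 ltac:(lra)).
  set (l := / (2 * sqrt 2)). assert (Hl : 0 < l) by (apply Rinv_0_lt_compat; lra).
  assert (Hl2 : l * l = / 8) by (unfold l; rewrite <- Rinv_mult; f_equal; nra).
  apply filterlim_R_eps. intros eps He.
  destruct (proj1 (filterlim_R_eps _ _) (filterlim_inv_p_infty (/ l)) eps He) as [M HM].
  exists (Rmax 1 M). intros x Hx. pose proof (Rmax_l 1 M). pose proof (Rmax_r 1 M).
  assert (HA : 0 <= gaussA x).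
  { rewrite <- gaussA_0. apply (mean_value_R gaussA (fun x => exp (- (2 * PI * x ^ 2)))); [lra | |].
    - intros; apply is_derive_gaussA.
    - intros; left; apply exp_pos. }
  pose proof (gauss_identity x). destruct (gaussB_bound x) as [B1 B2].
  assert (B3 : exp (- (2 * PI * x ^ 2)) <= / x).
  { rewrite exp_Ropp. apply Rinv_le_contravar; [lra|].
    pose proof (exp_ineq1_le (2 * PI * x ^ 2)).
    assert (x * 1 <= x * (PI * x)) by (apply Rmult_le_compat_l; nra). nra. }
  assert (E : (l - gaussA x) * (l + gaussA x) = gaussB x / (2 * PI)).
  { apply (Rmult_eq_reg_l (2 * PI)); [|lra]. replace (2 * PI * (gaussB x / (2 * PI))) with (gaussB x) by (field; lra). nra. }
  assert (HM2 : M < x) by lra. specialize (HM x HM2). rewrite Rminus_0_r in HM.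
  assert (Hx0 : 0 < / x) by (apply Rinv_0_lt_compat; lra).
  assert (Hl0 : 0 < / l) by (apply Rinv_0_lt_compat; lra).
  rewrite Rabs_pos_eq in HM by (apply Rmult_le_pos; lra).
  rewrite Rabs_minus_sym.
  assert (D0 : 0 <= gaussB x / (2 * PI) <= / x).
  { split; [apply Rmult_le_pos; [lra | left; apply Rinv_0_lt_compat; lra]|].
    apply (Rmult_le_reg_r (2 * PI)); [lra|]. unfold Rdiv. rewrite Rmult_assoc, Rinv_l by lra. nra. }
  assert (D1 : 0 <= l - gaussA x) by nra.
  rewrite Rabs_pos_eq by exact D1.
  eapply Rle_lt_trans; [|exact HM]. apply (Rmult_le_reg_l l); [exact Hl|].
  replace (l * (/ l / x)) with (/ x) by (field; lra). nra.
Qed.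

(** [True] stands for membership in the domain, in the shape that [ray_prim_same_limit] expects. *)
Lemma gauss_decay k : 0 < k -> exists B, forall x, in_sector k x -> 1 <= Cmod x ->
  True /\ Cmod (gauss x) * Cmod x ^ 2 <= B.
Proof.
  intros Hk. exists (exp (2 ^ 2 / (4 * k ^ 2))). intros x [H1 H2] Hx. split; [trivial|].
  pose proof PI2_1 as HP. unfold PI2 in HP.
  set (m := Cmod x) in *.
  assert (Hm2 : m ^ 2 <= exp (2 * m)).
  { replace (2 * m) with (m + m) by ring. rewrite exp_plus. pose proof (exp_ineq1_le m). nra. }
  assert (HE : Cmod (gauss x) <= exp (- k ^ 2 * m ^ 2)).
  { unfold gauss. rewrite Cmod_cexp. apply exp_le.
    replace (Re (2 * (PI * Ci) * (x * x))) with (- (4 * PI * (Re x * Im x))) by (unfold Re, Im; simpl; ring).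
    assert (k * m * (k * m) <= Re x * Im x) by (apply Rmult_le_compat; nra).
    assert (0 <= Re x * Im x) by nra. nra. }
  apply Rle_trans with (exp (- k ^ 2 * m ^ 2) * exp (2 * m)).
  - apply Rmult_le_compat; [apply Cmod_ge_0 | apply pow2_ge_0 | exact HE | exact Hm2].
  - rewrite <- exp_plus. apply exp_le.
    assert (Hk2 : 0 < k ^ 2) by nra.
    pose proof (exp_quad_bound (k ^ 2) 2 m Hk2). lra.
Qed.

Lemma ray_prim_gauss_limit (e d : C) kap : 0 < kap <= 1 / 2 -> Cmod e = 1 -> kap <= Re e -> kap <= Im e -> Cmod d <= 1 ->
  CL (Rbar_locally p_infty) (fun r : R => ray_prim gauss (r * e + d)) (- omega / (2 * sqrt 2)%R)%C.
Proof.
  intros Hk He He1 He2 Hd.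
  destruct omega_parts as [O1 O2]. pose proof inv_sqrt2_bound as O3. pose proof Rlt_sqrt2_0.
  destruct (gauss_decay (kap / 4) ltac:(lra)) as [B HB].
  apply (CL_ext (fun r : R => (ray_prim gauss (r * e + d) - ray_prim gauss (r * - omega + 0)) + ray_prim gauss (r * - omega)))%C.
  { intros r. replace (r * - omega + 0)%C with (r * - omega)%C by ring. ring. }
  eapply CL_eq; [apply CL_plus|].
  - apply (ray_prim_same_limit _ _ _ (kap / 4) B kap _ _ _ _ star_holo_gauss); try lra; try exact HB.
    + unfold Re in *; simpl in *; lra.
    + unfold Im in *; simpl in *; lra.
    + rewrite Cmod_opp, Cmod_omega. lra.
    + rewrite Cmod_0. lra.
  - apply (CL_ext (fun r => - omega * gaussA r)%C).
    { intros r. symmetry. apply ray_prim_gauss_ray. }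
    apply CL_mult; [apply CL_const | apply CL_RtoC; apply gaussA_limit].
  - rewrite RtoC_inv by lra. unfold Cdiv. ring.
Qed.

Lemma ray_prim_gauss_opp z : ray_prim gauss (- z) = (- ray_prim gauss z)%C.
Proof.
  replace (- ray_prim gauss z)%C with (- RtoC 1 * ray_prim gauss z)%C by ring.
  rewrite !ray_prim_clip. rewrite <- CInt_scal_l.
  - apply CInt_ext. intros t Ht. unfold gauss. replace (clip t * - z * (clip t * - z))%C with (clip t * z * (clip t * z))%C by ring.
    ring.
  - intros t Ht. apply (sh_ray_CL _ _ _ star_holo_gauss); trivial.
Qed.

(** * Laplace's method on the ray through the saddle point *)


(** Normalised so that [phi] vanishes at its critical point 1, where the second derivative is [-2];
    hence the local model [- (r - 1)^2]. *)
Definition phi (r : R) : R := ln r - r ^ 2 / 2 + 1 / 2.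

(** [ln r <= r - 1] in other terms: a global bound with half of the true curvature, complementing
    the local cubic estimate. *)
Lemma phi_le r : 0 < r -> phi r <= - (r - 1) ^ 2 / 2.
Proof.
  intros H. pose proof (exp_ineq1_le (ln r)). rewrite exp_ln in H0 by exact H. unfold phi. nra.
Qed.

(** [phi r + (r - 1)^2] vanishes at 1 and has derivative [(r - 1)^2 / r], which lies between 0 and
    [3 (r - 1)^2] once [r >= 1/2]. *)
Lemma phi_cubic r : 1 / 2 <= r -> Rabs (phi r + (r - 1) ^ 2) <= Rabs (r - 1) ^ 3.
Proof.
  intros Hr. set (psi := fun x => phi x + (x - 1) ^ 2).
  assert (Hd : forall x, 0 < x -> is_derive psi x ((x - 1) ^ 2 / x)).
  { intros x Hx. unfold psi, phi. auto_derive; [exact Hx | field; lra]. }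
  assert (Hd2 : forall x, 0 < x -> is_derive (fun x => (x - 1) ^ 3 - psi x) x (3 * (x - 1) ^ 2 - (x - 1) ^ 2 / x)).
  { intros x Hx. apply (is_derive_minus (K := R_AbsRing) (V := R_NormedModule) (fun x => (x - 1) ^ 3)); [|apply Hd; exact Hx].
    auto_derive; [trivial | ring]. }
  assert (Hp : psi 1 = 0) by (unfold psi, phi; rewrite ln_1; lra).
  assert (H1 : forall x, 0 < x -> 0 <= (x - 1) ^ 2 / x).
  { intros x Hx. apply Rmult_le_pos; [apply pow2_ge_0 | left; apply Rinv_0_lt_compat; exact Hx]. }
  assert (H2 : forall x, 1 / 2 <= x -> 0 <= 3 * (x - 1) ^ 2 - (x - 1) ^ 2 / x).
  { intros x Hx. replace (3 * (x - 1) ^ 2 - (x - 1) ^ 2 / x) with ((x - 1) ^ 2 * (3 - / x)) by (field; lra).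
    apply Rmult_le_pos; [apply pow2_ge_0|]. assert (/ x <= / (1 / 2)) by (apply Rinv_le_contravar; lra). lra. }
  change (Rabs (psi r) <= Rabs (r - 1) ^ 3).
  destruct (Rle_dec 1 r).
  - assert (A : psi 1 <= psi r).
    { apply (mean_value_R psi (fun x => (x - 1) ^ 2 / x)); [lra | intros; apply Hd; lra | intros; apply H1; lra]. }
    assert (B := mean_value_R (fun x => (x - 1) ^ 3 - psi x) (fun x => 3 * (x - 1) ^ 2 - (x - 1) ^ 2 / x) 1 r r0
      ltac:(intros; apply Hd2; lra) ltac:(intros; apply H2; lra)). cbv beta in B.
    rewrite !Rabs_pos_eq by lra. lra.
  - assert (A : psi r <= psi 1).
    { apply (mean_value_R psi (fun x => (x - 1) ^ 2 / x)); [lra | intros; apply Hd; lra | intros; apply H1; lra]. }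
    assert (B := mean_value_R (fun x => (x - 1) ^ 3 - psi x) (fun x => 3 * (x - 1) ^ 2 - (x - 1) ^ 2 / x) r 1 ltac:(lra)
      ltac:(intros; apply Hd2; lra) ltac:(intros; apply H2; lra)). cbv beta in B.
    rewrite (Rabs_left1 (psi r)), (Rabs_left1 (r - 1)) by lra.
    replace ((- (r - 1)) ^ 3) with (- (r - 1) ^ 3) by ring. lra.
Qed.

Definition Lam (eta : C) : C := (- (2 * (PI * Ci) * (eta * eta)))%C.

(** The integrand along [x = r * eta] without its factors independent of [r]. The denominator joins
    the [1/r] of [x^(Lam - 1)] to the factor [1 - e^(2 pi i x)] of [Sn x]. *)
Definition Jfun (eta : C) (r : R) : C :=
  (cexp (Lam eta * phi r + PI * Ci * eta * (r - 1)%R) / (r * (1 - cexp (2 * (PI * Ci) * eta * r))))%C.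

(** The Gaussian model at the saddle, [rho = r - 1]: [phi] is replaced by [- rho^2] and the
    denominator by 1. *)
Definition J0fun (eta : C) (rho : R) : C :=
  cexp (Lam eta * (- rho ^ 2)%R + PI * Ci * eta * rho).

Lemma Re_Lam eta : Re (Lam eta) = 4 * PI * (Re eta * Im eta).
Proof. unfold Lam, Re, Im; simpl; ring. Qed.
Lemma Cmod_Lam eta : Cmod (Lam eta) = 2 * PI * Cmod eta ^ 2.
Proof.
  unfold Lam. rewrite Cmod_opp. replace (2 * (PI * Ci) * (eta * eta))%C with (2 * (PI * Ci * (eta * eta)))%C by ring.
  rewrite Cmod_mult, Cmod_iPI, Cmod_mult, Cmod_R, Rabs_pos_eq by lra. ring.
Qed.

Lemma Re_Lam_ge eta kap : 0 < kap -> in_sector kap eta -> 4 * PI * kap ^ 2 * Cmod eta ^ 2 <= Re (Lam eta).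
Proof.
  intros Hk [H1 H2]. rewrite Re_Lam. pose proof PI_RGT_0. pose proof (Cmod_ge_0 eta).
  assert (kap * Cmod eta * (kap * Cmod eta) <= Re eta * Im eta) by (apply Rmult_le_compat; nra). nra.
Qed.

Lemma one_plus_pow_exp y n : 0 <= y -> (1 + y) ^ n <= exp (INR n * y).
Proof.
  intros Hy. induction n as [|n IH].
  - simpl. rewrite Rmult_0_l, exp_0. lra.
  - rewrite S_INR. replace ((INR n + 1) * y) with (y + INR n * y) by ring. rewrite exp_plus. simpl.
    apply Rmult_le_compat; [lra | apply pow_le; lra | apply exp_ineq1_le | exact IH].
Qed.

Lemma poly_gauss_bound mu y : 0 < mu -> 0 <= y ->
  (1 + y) ^ 5 * exp (PI * y - mu * y ^ 2 / 2) <= exp ((PI + 5) ^ 2 / (2 * mu)).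
Proof.
  intros Hm Hy. apply Rle_trans with (exp (INR 5 * y) * exp (PI * y - mu * y ^ 2 / 2)).
  - apply Rmult_le_compat_r; [left; apply exp_pos | apply one_plus_pow_exp; exact Hy].
  - rewrite <- exp_plus. apply exp_le. pose proof (exp_quad_bound (mu / 2) (PI + 5) y ltac:(lra)).
    replace (4 * (mu / 2)) with (2 * mu) in H by field. simpl INR. lra.
Qed.

(** Of the five powers allowed by [poly_gauss_bound], three cover the error polynomial and two buy
    the integrable weight, since [1 + y^2 <= (1 + y)^2]. *)
Lemma poly_gauss_div mu y a N X : 0 < mu -> 0 <= y -> 0 < N -> 0 <= a ->
  X <= a / N * (1 + y) ^ 3 * exp (PI * y - mu * y ^ 2 / 2) ->
  X <= a * exp ((PI + 5) ^ 2 / (2 * mu)) / N * / (1 + y ^ 2).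
Proof.
  intros Hm Hy HN Ha HX. pose proof (poly_gauss_bound mu y Hm Hy) as HB.
  set (W := exp (PI * y - mu * y ^ 2 / 2)) in *. assert (HW : 0 < W) by apply exp_pos.
  apply Rle_trans with (1 := HX). apply (Rmult_le_reg_r (1 + y ^ 2)); [nra|].
  set (Cc := exp ((PI + 5) ^ 2 / (2 * mu))) in *.
  replace (a * Cc / N * / (1 + y ^ 2) * (1 + y ^ 2)) with (a / N * Cc) by (field; split; nra).
  assert (HaN : 0 <= a / N) by (apply Rmult_le_pos; [exact Ha | left; apply Rinv_0_lt_compat; exact HN]).
  rewrite !Rmult_assoc. apply Rmult_le_compat_l; [exact HaN|]. eapply Rle_trans; [|exact HB].
  replace ((1 + y) ^ 5 * W) with ((1 + y) ^ 3 * (W * (1 + y) ^ 2)) by ring.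
  apply Rmult_le_compat_l; [apply pow_le; lra|]. apply Rmult_le_compat_l; nra.
Qed.

Lemma J0fun_bound eta kap rho : 0 < kap -> in_sector kap eta ->
  Cmod (J0fun eta rho) <= exp (PI * (Cmod eta * Rabs rho) - 4 * PI * kap ^ 2 * (Cmod eta * Rabs rho) ^ 2).
Proof.
  intros Hk Hs. unfold J0fun. rewrite Cmod_cexp. apply exp_le.
  pose proof (Re_Lam_ge eta kap Hk Hs). pose proof PI_RGT_0.
  replace (Re (Lam eta * (- rho ^ 2)%R + PI * Ci * eta * rho)) with (- (Re (Lam eta) * rho ^ 2) - PI * (Im eta * rho))
    by (unfold Re, Im; simpl; ring).
  replace ((Cmod eta * Rabs rho) ^ 2) with (Cmod eta ^ 2 * rho ^ 2) by (rewrite Rpow_mult_distr, pow2_abs; reflexivity).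
  pose proof (Im_le_Cmod eta). pose proof (Rle_abs (- (Im eta * rho))). rewrite Rabs_Ropp, Rabs_mult in H2.
  pose proof (Rabs_pos rho). pose proof (pow2_ge_0 rho).
  assert (Rabs (Im eta) * Rabs rho <= Cmod eta * Rabs rho) by (apply Rmult_le_compat_r; assumption).
  assert (4 * PI * kap ^ 2 * Cmod eta ^ 2 * rho ^ 2 <= Re (Lam eta) * rho ^ 2) by (apply Rmult_le_compat_r; assumption).
  nra.
Qed.

(** The bound of [poly_gauss_bound] at [mu = 4 pi kap^2], the lower bound of [Re Lam / |eta|^2] in
    the sector. *)
Definition poly_gauss_const (kap : R) : R := exp ((PI + 5) ^ 2 / (2 * (4 * PI * kap ^ 2))).

(** Away from the saddle [y = N |rho|] is at least [N/2], so a power of [1 + y] can be traded for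
    the factor [1/N]. *)
Lemma J0fun_tail eta kap rho : 0 < kap -> in_sector kap eta -> 1 <= Cmod eta -> 1 / 2 <= Rabs rho ->
  Cmod (J0fun eta rho) <= 2 * poly_gauss_const kap / Cmod eta * / (1 + (Cmod eta * Rabs rho) ^ 2).
Proof.
  intros Hk Hs HN Hr. pose proof PI_RGT_0. set (N := Cmod eta) in *. set (y := N * Rabs rho).
  assert (Hmu : 0 < 4 * PI * kap ^ 2) by (apply Rmult_lt_0_compat; nra).
  assert (Hy : N / 2 <= y) by (unfold y; nra).
  apply poly_gauss_div; try lra.
  eapply Rle_trans; [apply (J0fun_bound eta kap); assumption|]. fold N. fold y.
  assert (HW : exp (PI * y - 4 * PI * kap ^ 2 * y ^ 2) <= exp (PI * y - 4 * PI * kap ^ 2 * y ^ 2 / 2)).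
  { apply exp_le. assert (0 <= 4 * PI * kap ^ 2 * y ^ 2) by (apply Rmult_le_pos; [lra | apply pow2_ge_0]). lra. }
  assert (1 <= 2 / N * (1 + y) ^ 3).
  { apply (Rmult_le_reg_l N); [lra|]. replace (N * (2 / N * (1 + y) ^ 3)) with (2 * (1 + y) ^ 3) by (field; lra).
    assert (1 <= (1 + y) ^ 2) by nra. assert ((1 + y) * 1 <= (1 + y) * (1 + y) ^ 2) by (apply Rmult_le_compat_l; lra).
    simpl in *. lra. }
  pose proof (exp_pos (PI * y - 4 * PI * kap ^ 2 * y ^ 2 / 2)). nra.
Qed.

Lemma Cmod_1_minus_ge q : 1 - Cmod q <= Cmod (1 - q).
Proof. pose proof (Cmod_sub_ge 1 q). rewrite Cmod_1 in H. exact H. Qed.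

Section Jestimate.
Context (kap : R) (eta : C).
Context (Hk : 0 < kap) (Hs : in_sector kap eta) (HN1 : 1 <= Cmod eta) (HkN : 1 <= PI * kap * Cmod eta)
  (HL2 : 2 <= Re (Lam eta)).
Let N := Cmod eta.
Let mu := 4 * PI * kap ^ 2.

Lemma mu_pos : 0 < mu.
Proof. unfold mu. pose proof PI_RGT_0. apply Rmult_lt_0_compat; nra. Qed.

Lemma Cmod_osc_le r : Cmod (cexp (PI * Ci * eta * (r - 1)%R)) <= exp (PI * (N * Rabs (r - 1))).
Proof.
  rewrite Cmod_cexp. apply exp_le. pose proof PI_RGT_0.
  replace (Re (PI * Ci * eta * (r - 1)%R)) with (PI * - (Im eta * (r - 1))) by (unfold Re, Im; simpl; ring).
  apply Rmult_le_compat_l; [lra|]. eapply Rle_trans; [apply Rle_abs|]. rewrite Rabs_Ropp, Rabs_mult.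
  apply Rmult_le_compat_r; [apply Rabs_pos | apply Im_le_Cmod].
Qed.

Lemma Cmod_q r : 0 <= r -> Cmod (cexp (2 * (PI * Ci) * eta * r)) <= exp (- (2 * r)).
Proof.
  intros Hr. rewrite Cmod_cexp. apply exp_le. pose proof PI_RGT_0.
  replace (Re (2 * (PI * Ci) * eta * r)) with (- (2 * (PI * Im eta * r))) by (unfold Re, Im; simpl; ring).
  destruct Hs as [H1 H2].
  assert (PI * (kap * Cmod eta) * r <= PI * Im eta * r).
  { apply Rmult_le_compat_r; [exact Hr|]. apply Rmult_le_compat_l; lra. }
  assert (1 * r <= PI * kap * Cmod eta * r) by (apply Rmult_le_compat_r; lra). lra.
Qed.

Lemma Cmod_q_half r : 1 / 2 <= r -> Cmod (cexp (2 * (PI * Ci) * eta * r)) <= / (1 + PI * kap * N).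
Proof.
  intros Hr. rewrite Cmod_cexp. pose proof PI_RGT_0.
  eapply Rle_trans; [|apply exp_neg_le; unfold N; lra]. apply exp_le.
  replace (Re (2 * (PI * Ci) * eta * r)) with (- (2 * (PI * Im eta * r))) by (unfold Re, Im; simpl; ring).
  destruct Hs as [H1 H2]. fold N in H1, H2.
  assert (PI * (kap * N) * r <= PI * Im eta * r).
  { apply Rmult_le_compat_r; [lra|]. apply Rmult_le_compat_l; lra. }
  assert (PI * kap * N * (1 / 2) <= PI * kap * N * r) by (apply Rmult_le_compat_l; unfold N; lra). lra.
Qed.

Lemma Re_Lam_phi r : 0 < r -> Re (Lam eta) * phi r <= - (mu * (N * Rabs (r - 1)) ^ 2 / 2).
Proof.
  intros Hr. pose proof (Re_Lam_ge eta kap Hk Hs). pose proof (phi_le r Hr). pose proof (pow2_ge_0 (r - 1)).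
  replace ((N * Rabs (r - 1)) ^ 2) with (N ^ 2 * (r - 1) ^ 2) by (rewrite Rpow_mult_distr, pow2_abs; reflexivity).
  apply Rle_trans with (Re (Lam eta) * (- (r - 1) ^ 2 / 2)); [apply Rmult_le_compat_l; lra|].
  assert (4 * PI * kap ^ 2 * Cmod eta ^ 2 * (r - 1) ^ 2 <= Re (Lam eta) * (r - 1) ^ 2) by (apply Rmult_le_compat_r; assumption).
  unfold mu, N. lra.
Qed.

(** As [r] tends to 0 the lower bound for the denominator is only of order [r^2]. The compensating
    [r^2] is taken from [exp (2 phi r)], that is from 2 units of [Re Lam]; the remaining
    [Re Lam - 2] still gives Gaussian decay. *)
Lemma Jfun_far r : 0 < r <= 1 / 2 ->
  Cmod (Jfun eta r) <= 36 * poly_gauss_const kap / N * / (1 + (N * Rabs (r - 1)) ^ 2).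
Proof.
  intros Hr. pose proof PI_RGT_0. set (y := N * Rabs (r - 1)).
  assert (Hy : N / 2 <= y).
  { unfold y, N. rewrite Rabs_left1 by lra. nra. }
  assert (HN : 1 <= N) by exact HN1.
  apply poly_gauss_div; try lra; [exact mu_pos|].
  assert (Hq : r / 2 <= Cmod (1 - cexp (2 * (PI * Ci) * eta * r))).
  { eapply Rle_trans; [|apply Cmod_1_minus_ge]. pose proof (Cmod_q r ltac:(lra)).
    pose proof (exp_neg_le (2 * r) ltac:(lra)).
    assert (/ (1 + 2 * r) <= 1 - r / 2); [|lra].
    apply (Rmult_le_reg_l (1 + 2 * r)); [lra|]. rewrite Rinv_r by lra. nra. }
  assert (Hq0 : (1 - cexp (2 * (PI * Ci) * eta * r))%C <> 0%C) by (apply Cmod_gt_0; lra).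
  assert (Hr0 : RtoC r <> 0%C) by (apply RtoC_neq; lra).
  assert (HE : Cmod (cexp (Lam eta * phi r)) <= 9 * r ^ 2 * exp (- (mu * y ^ 2 / 2))).
  { rewrite Cmod_cexp. replace (Re (Lam eta * phi r)) with (2 * phi r + (Re (Lam eta) - 2) * phi r) by (unfold Re; simpl; ring).
    rewrite exp_plus.
    assert (A1 : exp (2 * phi r) <= 3 * r ^ 2).
    { unfold phi. replace (2 * (ln r - r ^ 2 / 2 + 1 / 2)) with (ln r + ln r + (1 - r ^ 2)) by field.
      rewrite !exp_plus, exp_ln by lra. assert (exp (1 - r ^ 2) <= 3); [|nra].
      eapply Rle_trans; [apply exp_le with (b := 1); nra | exact exp_le_3]. }
    (* Putting [Re Lam] back in place of [Re Lam - 2] costs [exp ((r - 1)^2)], at most [e]. *)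
    assert (A2 : exp ((Re (Lam eta) - 2) * phi r) <= 3 * exp (- (mu * y ^ 2 / 2))).
    { apply Rle_trans with (exp (1 + - (mu * y ^ 2 / 2))).
      - apply exp_le.
        assert (HP2 : (Re (Lam eta) - 2) * phi r <= (Re (Lam eta) - 2) * (- (r - 1) ^ 2 / 2)).
        { apply Rmult_le_compat_l; [lra | apply phi_le; lra]. }
        pose proof (Re_Lam_ge eta kap Hk Hs) as HL.
        assert (Hy2 : y ^ 2 = Cmod eta ^ 2 * (r - 1) ^ 2) by (unfold y, N; rewrite Rpow_mult_distr, pow2_abs; reflexivity).
        assert (HL' : 4 * PI * kap ^ 2 * Cmod eta ^ 2 * (r - 1) ^ 2 <= Re (Lam eta) * (r - 1) ^ 2) by (apply Rmult_le_compat_r; [apply pow2_ge_0 | assumption]).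
        assert (Hmu : mu * y ^ 2 <= Re (Lam eta) * (r - 1) ^ 2) by (unfold mu; rewrite Hy2; lra).
        assert ((r - 1) ^ 2 <= 1) by nra. lra.
      - rewrite exp_plus. apply Rmult_le_compat_r; [left; apply exp_pos | exact exp_le_3]. }
    replace (9 * r ^ 2 * exp (- (mu * y ^ 2 / 2))) with (3 * r ^ 2 * (3 * exp (- (mu * y ^ 2 / 2)))) by ring.
    apply Rmult_le_compat; try (left; apply exp_pos); assumption. }
  unfold Jfun. rewrite cexp_plus, Cmod_div, !Cmod_mult, Cmod_R, Rabs_pos_eq by (lra || (apply Cmult_neq_0; assumption)).
  pose proof (Cmod_osc_le r) as HO. fold y in HO.
  assert (HrI : 0 < r * (r / 2)) by nra.
  apply Rle_trans with (9 * r ^ 2 * exp (- (mu * y ^ 2 / 2)) * exp (PI * y) / (r * (r / 2))).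
  - apply Rmult_le_compat.
    + apply Rmult_le_pos; apply Cmod_ge_0.
    + left. apply Rinv_0_lt_compat. nra.
    + apply Rmult_le_compat; try apply Cmod_ge_0; assumption.
    + apply Rinv_le_contravar; [exact HrI|]. apply Rmult_le_compat_l; lra.
  - replace (9 * r ^ 2 * exp (- (mu * y ^ 2 / 2)) * exp (PI * y) / (r * (r / 2))) with
      (18 * exp (PI * y - mu * y ^ 2 / 2)).
    + apply Rmult_le_compat_r; [left; apply exp_pos|].
      apply (Rmult_le_reg_l N); [lra|]. replace (N * (36 / N * (1 + y) ^ 3)) with (36 * (1 + y) ^ 3) by (field; lra).
      assert (1 <= (1 + y) ^ 2) by nra. assert ((1 + y) * 1 <= (1 + y) * (1 + y) ^ 2) by (apply Rmult_le_compat_l; lra).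
      simpl in *. lra.
    + replace (PI * y - mu * y ^ 2 / 2) with (- (mu * y ^ 2 / 2) + PI * y) by ring. rewrite exp_plus. field. lra.
Qed.

(** Three deviations from the model, each [1/N] times a polynomial in [y = N |r - 1|]: [1/r] against
    1 gives [y/N], the exponentially small [q] is bounded by a multiple of [1/N], and the cubic
    phase error gives [N^2 |r - 1|^3 = y^3/N]. *)
Lemma Jfun_near r : 1 / 2 <= r ->
  Cmod (Jfun eta r - J0fun eta (r - 1)) <= (12 + / kap) * poly_gauss_const kap / N * / (1 + (N * Rabs (r - 1)) ^ 2).
Proof.
  intros Hr. pose proof PI_RGT_0. pose proof PI2_1 as HP1. unfold PI2 in HP1. pose proof PI_4 as HP4.
  set (y := N * Rabs (r - 1)).
  assert (HN : 1 <= N) by exact HN1.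
  assert (Hy : 0 <= y) by (unfold y; apply Rmult_le_pos; [lra | apply Rabs_pos]).
  assert (Hik : 0 < / kap) by (apply Rinv_0_lt_compat; exact Hk).
  apply poly_gauss_div; try lra; [exact mu_pos|]. fold mu.
  set (q := cexp (2 * (PI * Ci) * eta * r)).
  assert (Hq1 : Cmod q <= / (1 + PI * kap * N)) by (apply Cmod_q_half; exact Hr).
  assert (HkN' : 1 <= PI * kap * N) by exact HkN.
  assert (Hq2 : Cmod q <= 1 / 2).
  { eapply Rle_trans; [exact Hq1|]. replace (1 / 2) with (/ 2) by lra. apply Rinv_le_contravar; lra. }
  assert (Hq3 : Cmod q <= / kap / (2 * N)).
  { eapply Rle_trans; [exact Hq1|]. replace (/ kap / (2 * N)) with (/ (2 * kap * N)) by (field; lra).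
    apply Rinv_le_contravar; [apply Rmult_lt_0_compat; lra|].
    assert (2 * (kap * N) <= PI * (kap * N)) by (apply Rmult_le_compat_r; [apply Rmult_le_pos; lra | lra]). lra. }
  assert (Hq4 : 1 / 2 <= Cmod (1 - q)) by (pose proof (Cmod_1_minus_ge q); lra).
  assert (Hq0 : (1 - q)%C <> 0%C) by (apply Cmod_gt_0; lra).
  assert (Hr0 : RtoC r <> 0%C) by (apply RtoC_neq; lra).
  set (g := (/ (r * (1 - q)))%C).
  (* Both [1/r] and [1/(1 - q)] are at most 2 here, which doubles the sum of the first two
     deviations. *)
  assert (Hg : Cmod (g - 1) <= (4 * y + / kap) / N).
  { replace (g - 1)%C with ((((1 - r) / r)%R + q) / (1 - q))%C.
    - rewrite Cmod_div by exact Hq0. apply Rle_trans with ((2 * Rabs (r - 1) + / kap / (2 * N)) / (1 / 2)).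
      + apply Rmult_le_compat; [apply Cmod_ge_0 | left; apply Rinv_0_lt_compat; lra | | apply Rinv_le_contravar; lra].
        eapply Rle_trans; [apply Cmod_triangle|]. apply Rplus_le_compat; [|exact Hq3].
        rewrite Cmod_R. unfold Rdiv. rewrite Rabs_mult, Rabs_minus_sym, Rabs_inv, (Rabs_pos_eq r) by lra.
        assert (/ r <= 2) by (replace 2 with (/ (1 / 2)) by lra; apply Rinv_le_contravar; lra).
        pose proof (Rabs_pos (r - 1)). nra.
      + right. unfold y. field. lra.
    - unfold g. rewrite RtoC_div, RtoC_minus by lra. field. split; assumption. }
  set (A := cexp (Lam eta * phi r)). set (A0 := cexp (Lam eta * (- (r - 1) ^ 2)%R)). set (O := cexp (PI * Ci * eta * (r - 1)%R)).
  assert (HJ : (Jfun eta r - J0fun eta (r - 1) = O * (A * (g - 1) + (A - A0)))%C).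
  { unfold Jfun, J0fun. rewrite !cexp_plus. fold A A0 O. fold q. unfold g. field. split; assumption. }
  assert (HA : Cmod A <= exp (- (mu * y ^ 2 / 2))).
  { unfold A. rewrite Cmod_cexp. apply exp_le. replace (Re (Lam eta * phi r)) with (Re (Lam eta) * phi r) by (unfold Re; simpl; ring).
    apply Re_Lam_phi. lra. }
  assert (HA0 : Cmod A0 <= exp (- (mu * y ^ 2 / 2))).
  { unfold A0. rewrite Cmod_cexp. apply exp_le.
    replace (Re (Lam eta * (- (r - 1) ^ 2)%R)) with (- (Re (Lam eta) * (r - 1) ^ 2)) by (unfold Re; simpl; ring).
    unfold y. replace ((N * Rabs (r - 1)) ^ 2) with (N ^ 2 * (r - 1) ^ 2) by (rewrite Rpow_mult_distr, pow2_abs; reflexivity).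
    pose proof (Re_Lam_ge eta kap Hk Hs). pose proof (pow2_ge_0 (r - 1)).
    assert (4 * PI * kap ^ 2 * Cmod eta ^ 2 * (r - 1) ^ 2 <= Re (Lam eta) * (r - 1) ^ 2) by (apply Rmult_le_compat_r; assumption).
    assert (0 <= Re (Lam eta) * (r - 1) ^ 2) by (apply Rmult_le_pos; lra).
    unfold mu, N. lra. }
  (* The 8 bounds [|Lam| / N^2 = 2 pi]. The phase error [d] need not be small: [|A0| max(1, |e^d|)]
     is the larger of [|A0|] and [|A|], and both obey the same Gaussian bound. *)
  assert (HD : Cmod (A - A0) <= 8 * y ^ 3 / N * exp (- (mu * y ^ 2 / 2))).
  { set (d := (Lam eta * (phi r + (r - 1) ^ 2)%R)%C).
    assert (E : A = (A0 * cexp d)%C).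
    { unfold A, A0, d. rewrite <- cexp_plus. f_equal. rewrite RtoC_opp, RtoC_plus. ring. }
    replace (A - A0)%C with (A0 * (cexp d - 1))%C by (rewrite E; ring).
    rewrite Cmod_mult.
    assert (Hd : Cmod d <= 8 * y ^ 3 / N).
    { unfold d. rewrite Cmod_mult, Cmod_Lam, Cmod_R. fold N.
      replace (8 * y ^ 3 / N) with (8 * N ^ 2 * Rabs (r - 1) ^ 3) by (unfold y; field; lra).
      apply Rmult_le_compat; [|apply Rabs_pos | | apply phi_cubic; exact Hr]; nra. }
    apply Rle_trans with (Cmod d * (Cmod A0 * Rmax 1 (exp (Re d)))).
    - replace (Cmod d * (Cmod A0 * Rmax 1 (exp (Re d)))) with (Cmod A0 * (Cmod d * Rmax 1 (exp (Re d)))) by ring.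
      apply Rmult_le_compat_l; [apply Cmod_ge_0 | apply Cmod_cexp_m1].
    - apply Rmult_le_compat; [apply Cmod_ge_0 | | exact Hd |].
      + apply Rmult_le_pos; [apply Cmod_ge_0 | eapply Rle_trans; [|apply Rmax_l]; lra].
      + unfold Rmax. destruct (Rle_dec 1 (exp (Re d))).
        * rewrite <- Cmod_cexp, <- Cmod_mult, <- E. exact HA.
        * rewrite Rmult_1_r. exact HA0. }
  rewrite HJ, Cmod_mult.
  pose proof (Cmod_osc_le r) as HO. fold O in HO. fold y in HO.
  set (W := exp (- (mu * y ^ 2 / 2))) in *. assert (HW : 0 < W) by apply exp_pos.
  replace (exp (PI * y - mu * y ^ 2 / 2)) with (exp (PI * y) * W) by (unfold W; rewrite <- exp_plus; f_equal; ring).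
  replace ((12 + / kap) / N * (1 + y) ^ 3 * (exp (PI * y) * W)) with (exp (PI * y) * ((12 + / kap) / N * (1 + y) ^ 3 * W)) by ring.
  apply Rmult_le_compat; [apply Cmod_ge_0 | apply Cmod_ge_0 | exact HO|].
  eapply Rle_trans; [apply Cmod_triangle|]. rewrite Cmod_mult.
  apply Rle_trans with (W * ((4 * y + / kap) / N) + 8 * y ^ 3 / N * W).
  - apply Rplus_le_compat; [|exact HD]. apply Rmult_le_compat; try apply Cmod_ge_0; assumption.
  - replace (W * ((4 * y + / kap) / N) + 8 * y ^ 3 / N * W) with ((4 * y + / kap + 8 * y ^ 3) * (W / N)) by (field; lra).
    replace ((12 + / kap) / N * (1 + y) ^ 3 * W) with ((12 + / kap) * (1 + y) ^ 3 * (W / N)) by (field; lra).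
    apply Rmult_le_compat_r; [apply Rmult_le_pos; [lra | left; apply Rinv_0_lt_compat; lra]|].
    assert (0 <= y ^ 2) by apply pow2_ge_0. assert (0 <= y ^ 3) by (apply pow_le; exact Hy).
    replace ((1 + y) ^ 3) with (1 + 3 * y + 3 * y ^ 2 + y ^ 3) by ring.
    assert (0 <= / kap * (3 * y + 3 * y ^ 2 + y ^ 3)) by (apply Rmult_le_pos; lra). lra.
Qed.

(** Far from the saddle both functions are small separately, whence [38 = 36 + 2]; this also
    dominates the 12 of the near case. *)
Lemma Jfun_J0fun r : 0 < r ->
  Cmod (Jfun eta r - J0fun eta (r - 1)) <= (38 + / kap) * poly_gauss_const kap / N * / (1 + (N * (r - 1)) ^ 2).
Proof.
  intros Hr. assert (Hik : 0 < / kap) by (apply Rinv_0_lt_compat; exact Hk).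
  assert (HN : 1 <= N) by exact HN1. assert (HK : 0 < poly_gauss_const kap) by apply exp_pos.
  assert (E : (N * (r - 1)) ^ 2 = (N * Rabs (r - 1)) ^ 2) by (rewrite !Rpow_mult_distr, pow2_abs; reflexivity).
  rewrite E. set (w := / (1 + (N * Rabs (r - 1)) ^ 2)).
  assert (Hw : 0 < w) by (apply Rinv_0_lt_compat; pose proof (pow2_ge_0 (N * Rabs (r - 1))); lra).
  assert (HX : 0 <= poly_gauss_const kap / N * w) by (apply Rmult_le_pos; [apply Rmult_le_pos; [lra | left; apply Rinv_0_lt_compat; lra] | lra]).
  destruct (Rle_dec (1 / 2) r).
  - eapply Rle_trans; [apply Jfun_near; exact r0|]. fold w.
    replace ((12 + / kap) * poly_gauss_const kap / N * w) with ((12 + / kap) * (poly_gauss_const kap / N * w)) by (unfold Rdiv; ring).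
    replace ((38 + / kap) * poly_gauss_const kap / N * w) with ((38 + / kap) * (poly_gauss_const kap / N * w)) by (unfold Rdiv; ring).
    apply Rmult_le_compat_r; lra.
  - eapply Rle_trans; [apply Cmod_triangle_minus|].
    pose proof (Jfun_far r ltac:(lra)) as H1. fold w in H1.
    assert (H2 : 1 / 2 <= Rabs (r - 1)) by (rewrite Rabs_left1; lra).
    pose proof (J0fun_tail eta kap (r - 1) Hk Hs HN1 H2) as H3. fold N w in H3.
    replace (36 * poly_gauss_const kap / N * w) with (36 * (poly_gauss_const kap / N * w)) in H1 by (unfold Rdiv; ring).
    replace (2 * poly_gauss_const kap / N * w) with (2 * (poly_gauss_const kap / N * w)) in H3 by (unfold Rdiv; ring).
    replace ((38 + / kap) * poly_gauss_const kap / N * w) with ((38 + / kap) * (poly_gauss_const kap / N * w)) by (unfold Rdiv; ring).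
    nra.
Qed.
End Jestimate.


(** The part of [eta * f (r eta)] that does not depend on [r]; the sign comes from
    [Sn x = - e^(-pi i x) (1 - e^(2 pi i x))]. *)
Definition ray_factor (eta : C) : C := (- cexp (Lam eta * clog eta - Lam eta / 2 + PI * Ci * eta))%C.

Lemma ray_factor_neq_0 eta : ray_factor eta <> 0%C.
Proof.
  apply Cmod_gt_0. unfold ray_factor. rewrite Cmod_opp, Cmod_cexp. apply exp_pos.
Qed.

Lemma Rintegrand_Jfun eta (r : R) : 0 < Im eta -> 0 < r ->
  (eta * Rintegrand (1 - Lam eta) (r * eta))%C = (ray_factor eta * Jfun eta r)%C.
Proof.
  intros He Hr.
  assert (N : eta <> 0%C) by (apply slit_neq_0; right; lra).
  assert (Hr0 : RtoC r <> 0%C) by (apply RtoC_neq; lra).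
  assert (HI : 0 < Im (r * eta)) by (replace (Im (r * eta)) with (r * Im eta) by (unfold Im; simpl; ring); nra).
  assert (HD : Dom (r * eta)%C) by (left; lra).
  assert (Nr : (r * eta)%C <> 0%C) by (apply slit_neq_0, Dom_slit, HD).
  pose proof (Sn_neq_0 _ HD) as NS.
  set (q := cexp (2 * (PI * Ci) * eta * r)).
  assert (ES : Sn (r * eta) = (- (cexp (- (PI * Ci * (r * eta))) * (1 - q)))%C).
  { unfold Sn, q. replace (2 * (PI * Ci) * eta * r)%C with (PI * Ci * (r * eta) + PI * Ci * (r * eta))%C by ring.
    rewrite cexp_plus, cexp_opp. field. apply cexp_neq_0. }
  assert (Hq : (1 - q)%C <> 0%C) by (intros E; apply NS; rewrite ES, E; ring).
  rewrite Rintegrand_exp by exact Nr. unfold Rint_exp. rewrite ES, clog_scal by assumption.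
  unfold ray_factor, Jfun. fold q.
  (* With [eta] and [r] themselves written as exponentials, everything collects in one exponent,
     where the identity is algebraic. *)
  assert (HE : (eta * cexp (- (1 - Lam eta) * (ln r + clog eta) + PI * Ci * (r * eta * (r * eta))) * cexp (PI * Ci * (r * eta)) * cexp (ln r)
    = cexp (Lam eta * clog eta - Lam eta / 2 + PI * Ci * eta) * cexp (Lam eta * phi r + PI * Ci * eta * (r - 1)%R))%C).
  { rewrite <- (cexp_clog eta N) at 1.
    rewrite <- !cexp_plus. f_equal. unfold phi, Lam. rewrite RtoC_minus, RtoC_plus, RtoC_minus, !RtoC_div, RtoC_pow by lra.
    field. }
  rewrite cexp_RtoC, exp_ln in HE by exact Hr.
  rewrite cexp_opp. pose proof (cexp_neq_0 (PI * Ci * (r * eta))).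
  transitivity (- (eta * cexp (- (1 - Lam eta) * (ln r + clog eta) + PI * Ci * (r * eta * (r * eta))) * cexp (PI * Ci * (r * eta)) * r)
     / (r * (1 - q)))%C.
  - field. repeat split; assumption.
  - rewrite HE. field. split; assumption.
Qed.

Definition c8 : C := cexp (- (PI * Ci / 8)).

(** A primitive of the model: with [x = 1/4 + eta * (r - 1)] the exponent of [J0fun eta (r - 1)]
    equals [2 pi i x^2 - pi i/8], which is the origin of [c8]. *)
Definition Gfun (eta : C) (r : R) : C := (c8 / eta * ray_prim gauss ((1 / 4)%R - eta + r * eta))%C.

Lemma Cder_Gfun (eta : C) r : eta <> 0%C -> Cder (Gfun eta) r (J0fun eta (r - 1)).
Proof.
  intros N. eapply Cder_eq; [apply Cder_scal; apply (Cder_ray_prim _ _ _ star_holo_gauss); trivial|].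
  unfold c8, gauss, J0fun.
  replace (cexp (- (PI * Ci / 8)) / eta * (eta * cexp (2 * (PI * Ci) * (((1 / 4)%R - eta + r * eta) * ((1 / 4)%R - eta + r * eta)))))%C
    with (cexp (- (PI * Ci / 8)) * cexp (2 * (PI * Ci) * (((1 / 4)%R - eta + r * eta) * ((1 / 4)%R - eta + r * eta))))%C by (field; exact N).
  rewrite <- cexp_plus. f_equal. unfold Lam. rewrite RtoC_opp, RtoC_pow, RtoC_minus, RtoC_div by lra. field.
Qed.

Lemma is_derive_atan_scaled a N x : 0 < N ->
  is_derive (fun r => a / N * atan (N * (r - 1))) x (a * / (1 + (N * (x - 1)) ^ 2)).
Proof.
  intros HN. evar_last.
  - apply is_derive_scal. apply (is_derive_atan_R (fun r => N * (r - 1)) x N). auto_derive; [trivial | ring].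
  - unfold Rsqr. field. split; [|lra]. pose proof (pow2_ge_0 (N * (x - 1))). nra.
Qed.

(** The origin is outside [Dom], so [Cder_ray_prim] says nothing there; continuity comes from the
    smallness of the integrand. *)
Lemma ray_prim_Rintegrand_0 s (e : C) : Re s <= -4 -> 0 < Im e ->
  CL (at_right 0) (fun r : R => ray_prim (Rintegrand s) (r * e)) 0%C.
Proof.
  intros Hs He. pose proof (star_holo_Rintegrand s Hs) as S.
  assert (HN : 0 < Cmod e) by (pose proof (Im_le_Cmod e); pose proof (Rle_abs (Im e)); lra).
  set (A := 3 * exp (PI * Rabs (Im s))). assert (HA : 0 < A) by (unfold A; pose proof (exp_pos (PI * Rabs (Im s))); lra).
  apply (CL_squeeze _ _ (fun r => 2 * (r * Cmod e * A))).
  - assert (Hd : 0 < / (16 * Cmod e)) by (apply Rinv_0_lt_compat; lra).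
    exists (mkposreal _ Hd). intros r Hr Hr0. unfold ball in Hr; simpl in Hr. unfold AbsRing_ball, abs, minus, plus, opp in Hr; simpl in Hr.
    rewrite Ropp_0, Rplus_0_r, Rabs_pos_eq in Hr by lra.
    assert (E : Cmod (r * e) = r * Cmod e) by (rewrite Cmod_mult, Cmod_R, Rabs_pos_eq by lra; reflexivity).
    assert (Hr16 : r * Cmod e <= 1 / 16).
    { replace (1 / 16) with (/ (16 * Cmod e) * Cmod e) by (field; lra). apply Rmult_le_compat_r; lra. }
    replace (ray_prim (Rintegrand s) (r * e) - 0)%C with (ray_prim (Rintegrand s) (r * e)) by ring.
    rewrite <- E. apply (ray_prim_bound _ _ _ S).
    + left. replace (Im (r * e)) with (r * Im e) by (unfold Im; simpl; ring). nra.
    + intros t Ht.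
      assert (Ht2 : Cmod (t * (r * e)) <= 1 / 16) by (rewrite Cmod_mult, E, Cmod_R, Rabs_pos_eq by lra; nra).
      eapply Rle_trans; [apply (Rintegrand_small s _ Hs Ht2)|]. fold A.
      pose proof (Cmod_ge_0 (t * (r * e))).
      assert (Cmod (t * (r * e)) ^ 3 <= 1) by (rewrite <- (pow1 3); apply pow_incr; lra). nra.
  - assert (H : filterlim (fun r => 2 * (r * Cmod e * A)) (locally 0) (locally (2 * (0 * Cmod e * A)))).
    { apply (@ex_derive_continuous R_AbsRing R_NormedModule (fun r => 2 * (r * Cmod e * A))). auto_derive; trivial. }
    replace (2 * (0 * Cmod e * A)) with 0 in H by ring.
    intros P HP. specialize (H P HP). unfold filtermap in *. destruct H as [eps H]. exists eps. intros y Hy _. apply H. exact Hy.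
Qed.

(** The ray only covers [r > 0], but the model lives on the whole line; its part on [r < 0] is
    within the tail bound. As [R] grows, [Gfun R - Gfun (- R)] becomes the complete Gaussian
    integral. The constant is [40 = 38 + 2]. *)
Lemma laplace_limit kap eta L : 0 < kap <= 1 / 2 -> in_sector kap eta -> 1 <= Cmod eta ->
  1 <= PI * kap * Cmod eta -> 5 <= Re (Lam eta) ->
  CL (Rbar_locally p_infty) (fun r : R => ray_prim (Rintegrand (1 - Lam eta)) (r * (eta / Cmod eta)))%C L ->
  Cmod (L / ray_factor eta - c8 / eta * (- omega / sqrt 2)) <= (40 + / kap) * poly_gauss_const kap * PI / Cmod eta ^ 2.
Proof.
  intros Hk Hsec HN HkN HL5 HL. set (N := Cmod eta) in *. pose proof PI_RGT_0 as HPI.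
  assert (HIm : 0 < Im eta) by (destruct Hsec as [_ H]; fold N in H; nra).
  assert (Neta : eta <> 0%C) by (apply slit_neq_0; right; lra).
  assert (NN : RtoC N <> 0%C) by (apply RtoC_neq; lra).
  set (s := (1 - Lam eta)%C) in *.
  assert (Hs : Re s <= -4) by (change (1 + - Re (Lam eta) <= -4); lra).
  pose proof (star_holo_Rintegrand s Hs) as S. pose proof (ray_factor_neq_0 eta) as Hcf.
  set (K1 := (38 + / kap) * poly_gauss_const kap / N). set (K2 := 2 * poly_gauss_const kap / N).
  assert (Hik : 0 < / kap) by (apply Rinv_0_lt_compat; lra).
  assert (HKm : 0 < poly_gauss_const kap) by apply exp_pos.
  assert (HiN : 0 < / N) by (apply Rinv_0_lt_compat; lra).
  assert (HK1 : 0 <= K1) by (unfold K1, Rdiv; apply Rmult_le_pos; [apply Rmult_le_pos|]; lra).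
  assert (HK2 : 0 <= K2) by (unfold K2, Rdiv; apply Rmult_le_pos; [apply Rmult_le_pos|]; lra).
  (* The total increase of an arctangent is below [pi]; its scaling by [1/N] turns a bound of order
     [1/N] into [N^-2]. *)
  assert (Hat : forall a x y, 0 <= a -> a / N * atan x - a / N * atan y <= a * PI / N).
  { intros a x y Ha. pose proof (atan_bound x). pose proof (atan_bound y).
    replace (a * PI / N) with (a / N * PI) by (unfold Rdiv; ring).
    assert (0 <= a / N) by (apply Rmult_le_pos; lra). nra. }
  set (h := fun r : R => (/ ray_factor eta * ray_prim (Rintegrand s) (0 + r * eta) - Gfun eta r)%C).
  assert (Hh : forall r, 0 < r -> Cder h r (Jfun eta r - J0fun eta (r - 1))%C).
  { intros r Hr. eapply Cder_eq.
    - apply Cder_minus; [|apply Cder_Gfun; exact Neta]. apply Cder_scal. apply (Cder_ray_prim _ _ _ S).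
      replace (0 + r * eta)%C with (r * eta)%C by ring. left.
      replace (Im (r * eta)) with (r * Im eta) by (unfold Im; simpl; ring). nra.
    - cbv beta. replace (0 + r * eta)%C with (r * eta)%C by ring. unfold s. rewrite Rintegrand_Jfun by assumption.
      field. exact Hcf. }
  assert (H1 : forall R e, 0 < e <= R -> Cmod (h R - h e) <= K1 * PI / N).
  { intros R e He. eapply Rle_trans; [|apply (Hat K1 (N * (R - 1)) (N * (e - 1)) HK1)].
    apply (mean_value_C h (fun r => Jfun eta r - J0fun eta (r - 1))%C (fun r => K1 / N * atan (N * (r - 1)))
       (fun r => K1 * / (1 + (N * (r - 1)) ^ 2))); [lra | | |].
    - intros x Hx. apply Hh. lra.
    - intros x Hx. apply is_derive_atan_scaled. lra.
    - intros x Hx. apply (Jfun_J0fun kap eta); try lra; assumption. }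
  (* [h] has no known derivative at 0, so this endpoint is reached as a one-sided limit. *)
  assert (H2 : forall R, 0 < R -> Cmod (h R - h 0) <= K1 * PI / N).
  { intros R HR. apply (CL_bound (F := at_right 0) (fun e => h R - h e)%C).
    - apply CL_minus; [apply CL_const|]. unfold h. apply CL_minus.
      + apply CL_mult; [apply CL_const|].
        apply (CL_ext (fun r : Rdefinitions.R => ray_prim (Rintegrand s) (r * eta)%C)).
        { intros r. f_equal. ring. }
        replace (0 + 0 * eta)%C with (RtoC 0) by ring. rewrite ray_prim_0. apply ray_prim_Rintegrand_0; assumption.
      + apply (CL_comp (G := locally 0) (fun x => x)).
        * intros P [eps HP]. exists eps. intros y Hy _. apply HP. exact Hy.
        * eapply Cder_CL. apply Cder_Gfun. exact Neta.
    - exists (mkposreal _ HR). intros e He He0. apply H1. split; [exact He0|].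
      unfold ball in He; simpl in He. unfold AbsRing_ball, abs, minus, plus, opp in He; simpl in He.
      rewrite Ropp_0, Rplus_0_r, Rabs_pos_eq in He by lra. lra. }
  assert (H3 : forall T, 0 <= T -> Cmod (Gfun eta 0 - Gfun eta (- T)) <= K2 * PI / N).
  { intros T HT. eapply Rle_trans; [|apply (Hat K2 (N * (0 - 1)) (N * (- T - 1)) HK2)].
    apply (mean_value_C (Gfun eta) (fun r => J0fun eta (r - 1))%C (fun r => K2 / N * atan (N * (r - 1)))
       (fun r => K2 * / (1 + (N * (r - 1)) ^ 2))); [lra | | |].
    - intros x Hx. apply Cder_Gfun. exact Neta.
    - intros x Hx. apply is_derive_atan_scaled. lra.
    - intros x Hx. replace ((N * (x - 1)) ^ 2) with ((N * Rabs (x - 1)) ^ 2) by (rewrite !Rpow_mult_distr, pow2_abs; reflexivity).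
      apply J0fun_tail; try lra; try assumption. rewrite Rabs_left1; lra. }
  assert (H4 : forall R, 0 < R -> Cmod (/ ray_factor eta * ray_prim (Rintegrand s) (R * eta) - Gfun eta R + Gfun eta (- R)) <= (40 + / kap) * poly_gauss_const kap * PI / N ^ 2).
  { intros R HR.
    replace (/ ray_factor eta * ray_prim (Rintegrand s) (R * eta) - Gfun eta R + Gfun eta (- R))%C with
      ((h R - h 0) - (Gfun eta 0 - Gfun eta (- R)))%C.
    - eapply Rle_trans; [apply Cmod_triangle_minus|].
      replace ((40 + / kap) * poly_gauss_const kap * PI / N ^ 2) with (K1 * PI / N + K2 * PI / N) by (unfold K1, K2; field; split; lra).
      apply Rplus_le_compat; [apply H2; exact HR | apply H3; lra].
    - unfold h. replace (0 + 0 * eta)%C with (RtoC 0) by ring. rewrite ray_prim_0.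
      replace (0 + R * eta)%C with (R * eta)%C by ring. ring. }
  assert (He1 : Cmod (eta / N) = 1).
  { rewrite Cmod_div, Cmod_R, Rabs_pos_eq by (lra || assumption). fold N. field. lra. }
  assert (HeR : Re (eta / N) = Re eta / N) by (unfold Re; simpl; field; lra).
  assert (HeI : Im (eta / N) = Im eta / N) by (unfold Im; simpl; field; lra).
  destruct Hsec as [S1 S2]. fold N in S1, S2.
  assert (HeR2 : kap <= Re (eta / N)).
  { rewrite HeR. apply (Rmult_le_reg_r N); [lra|]. replace (Re eta / N * N) with (Re eta) by (field; lra). exact S1. }
  assert (HeI2 : kap <= Im (eta / N)).
  { rewrite HeI. apply (Rmult_le_reg_r N); [lra|]. replace (Im eta / N * N) with (Im eta) by (field; lra). exact S2. }
  assert (Hquart : Cmod (1 / 4)%R <= 1) by (rewrite Cmod_R, Rabs_pos_eq; lra).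
  assert (Hquart' : Cmod (- (1 / 4)%R) <= 1) by (rewrite Cmod_opp; exact Hquart).
  assert (Hlin : forall c, filterlim (fun r => (r + c) * N) (Rbar_locally p_infty) (Rbar_locally p_infty)).
  { intros c P [M HM]. exists (Rabs M - c). intros x Hx. apply HM. pose proof (Rle_abs M). pose proof (Rabs_pos M). nra. }
  assert (HLr : CL (Rbar_locally p_infty) (fun R : R => / ray_factor eta * ray_prim (Rintegrand s) (R * eta) - Gfun eta R + Gfun eta (- R))%C
    (/ ray_factor eta * L - c8 / eta * (- omega / (2 * sqrt 2)%R) + c8 / eta * - (- omega / (2 * sqrt 2)%R))%C).
  { apply CL_plus; [apply CL_minus|].
    - apply CL_mult; [apply CL_const|].
      apply (CL_ext (fun r : R => ray_prim (Rintegrand s) (((r + 0) * N)%R * (eta / N)))%C).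
      { intros r. f_equal. rewrite RtoC_mult, RtoC_plus. field. exact NN. }
      apply (CL_comp (G := Rbar_locally p_infty) (fun r => (r + 0) * N) (fun r : R => ray_prim (Rintegrand s) (r * (eta / N))%C)); [apply Hlin | exact HL].
    - apply CL_mult; [apply CL_const|].
      apply (CL_ext (fun r : R => ray_prim gauss (((r + Ropp 1) * N)%R * (eta / N) + (1 / 4)%R))%C).
      { intros r. f_equal. rewrite RtoC_mult, RtoC_plus, (RtoC_opp 1). field. exact NN. }
      apply (CL_comp (G := Rbar_locally p_infty) (fun r => (r + Ropp 1) * N) (fun r : R => ray_prim gauss (r * (eta / N) + (1 / 4)%R)%C)); [apply Hlin|].
      apply (ray_prim_gauss_limit _ _ kap); assumption.
    - apply CL_mult; [apply CL_const|].
      apply (CL_ext (fun r : R => - ray_prim gauss (((r + 1) * N)%R * (eta / N) + - (1 / 4)%R))%C).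
      { intros r. rewrite <- ray_prim_gauss_opp. f_equal. rewrite RtoC_mult, RtoC_plus, (RtoC_opp r). field. exact NN. }
      apply CL_opp.
      apply (CL_comp (G := Rbar_locally p_infty) (fun r => (r + 1) * N) (fun r : R => ray_prim gauss (r * (eta / N) + - (1 / 4)%R)%C)); [apply Hlin|].
      apply (ray_prim_gauss_limit _ _ kap); assumption. }
  assert (HB : Cmod (/ ray_factor eta * L - c8 / eta * (- omega / (2 * sqrt 2)%R) + c8 / eta * - (- omega / (2 * sqrt 2)%R))
     <= (40 + / kap) * poly_gauss_const kap * PI / N ^ 2).
  { apply (CL_bound (F := Rbar_locally p_infty) _ _ _ HLr). exists 0. intros R HR. apply H4. exact HR. }
  pose proof Rlt_sqrt2_0.
  assert (Ns2 : RtoC (sqrt 2) <> 0%C) by (apply RtoC_neq; lra).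
  replace (L / ray_factor eta - c8 / eta * (- omega / sqrt 2))%C with
    (/ ray_factor eta * L - c8 / eta * (- omega / (2 * sqrt 2)%R) + c8 / eta * - (- omega / (2 * sqrt 2)%R))%C; [exact HB|].
  rewrite RtoC_mult. field. repeat split; assumption.
Qed.

(** * The sine product *)


Lemma CInt_minus f g : (forall t, 0 <= t <= 1 -> CL (locally t) f (f t)) ->
  (forall t, 0 <= t <= 1 -> CL (locally t) g (g t)) ->
  CInt (fun t => f t - g t)%C = (CInt f - CInt g)%C.
Proof.
  intros Hf Hg. destruct (ex_RInt_CL f Hf) as [E1 E2]. destruct (ex_RInt_CL g Hg) as [E3 E4].
  apply (@RInt_correct R_CompleteNormedModule) in E1. apply (@RInt_correct R_CompleteNormedModule) in E2.
  apply (@RInt_correct R_CompleteNormedModule) in E3. apply (@RInt_correct R_CompleteNormedModule) in E4.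
  unfold CInt. apply C_eq; apply is_RInt_unique.
  - apply (@is_RInt_minus R_NormedModule (fun t => Re (f t)) (fun t => Re (g t))); assumption.
  - apply (@is_RInt_minus R_NormedModule (fun t => Im (f t)) (fun t => Im (g t))); assumption.
Qed.

Lemma CInt_bound_RInt g G : (forall t, 0 <= t <= 1 -> CL (locally t) g (g t)) -> ex_RInt G 0 1 ->
  (forall t, 0 < t < 1 -> Cmod (g t) <= G t) -> Cmod (CInt g) <= 2 * RInt G 0 1.
Proof.
  intros H1 HG H2. destruct (ex_RInt_CL g H1) as [E1 E2].
  assert (HX : forall p : C -> R, (forall z, Rabs (p z) <= Cmod z) -> ex_RInt (fun t => p (g t)) 0 1 ->
    Rabs (RInt (fun t => p (g t)) 0 1) <= RInt G 0 1).
  { intros p Hp E. apply Rabs_le. split.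
    - assert (RInt (fun t => - G t) 0 1 <= RInt (fun t => p (g t)) 0 1).
      { apply RInt_le; [lra | apply (@ex_RInt_opp R_NormedModule); exact HG | exact E|].
        intros t Ht. specialize (H2 t Ht). specialize (Hp (g t)). pose proof (Rle_abs (- p (g t))). rewrite Rabs_Ropp in H. lra. }
      rewrite (@RInt_opp R_CompleteNormedModule) in H by exact HG. exact H.
    - apply RInt_le; [lra | exact E | exact HG|].
      intros t Ht. specialize (H2 t Ht). specialize (Hp (g t)). pose proof (Rle_abs (p (g t))). lra. }
  eapply Rle_trans; [apply Cmod_le_sum|]. unfold CInt.
  pose proof (HX Re re_le_Cmod E1). pose proof (HX Im Im_le_Cmod E2).
  change (Rabs (RInt (fun t => Re (g t)) 0 1) + Rabs (RInt (fun t => Im (g t)) 0 1) <= 2 * RInt G 0 1). lra.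
Qed.

Definition cosq (t : R) : R := cos (PI / 2 * t).
Definition sinq (t : R) : R := sin (PI / 2 * t).

Definition cos_integral (m : nat) (z : C) : C := CInt (fun t => RtoC (cosq t ^ (2 * m)) * Cs (t * z))%C.

Lemma Cder_Cs g x a : Cder g x a -> Cder (fun t => Cs (g t)) x (a * (PI * Ci * Sn (g x)))%C.
Proof.
  intros H. eapply Cder_eq.
  { apply Cder_plus; apply Cder_cexp; [|apply Cder_opp]; apply Cder_scal; exact H. }
  unfold Sn. ring.
Qed.

Lemma Cder_tz z x : Cder (fun t => t * z)%C x z.
Proof. eapply Cder_eq; [apply Cder_mult; [apply Cder_id | apply Cder_const]|]. cbv beta. ring. Qed.

Lemma CL_cos_pow n t : CL (locally t) (fun t => RtoC (cosq t ^ n)) (RtoC (cosq t ^ n)).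
Proof.
  apply (CL_RtoC (fun t => cosq t ^ n)). apply (@ex_derive_continuous R_AbsRing R_NormedModule (fun t => cosq t ^ n)).
  unfold cosq. auto_derive. trivial.
Qed.

Lemma CL_cos_integrand n z (t : R) : CL (locally t) (fun t : R => RtoC (cosq t ^ n) * Cs (t * z))%C (RtoC (cosq t ^ n) * Cs (t * z))%C.
Proof.
  apply CL_mult; [apply CL_cos_pow|]. apply CL_Cs. eapply Cder_CL. apply Cder_tz.
Qed.

(* (u' C - u C')' = u'' C - u C'' with u = cos^(2m+2)(pi t / 2) and C = 2 cos(pi z t) *)
Lemma cos_integral_rec m z : (4 * (RtoC (INR (S m)) * RtoC (INR (S m)) - z * z) * cos_integral (S m) z =
  (2 * INR m + 2)%R * (2 * INR m + 1)%R * cos_integral m z)%C.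
Proof.
  set (n := INR (S m)). assert (Hn : n = INR m + 1) by (unfold n; apply S_INR).
  set (u := fun t => cosq t ^ (2 * m + 2)).
  set (du := fun t => - (PI / 2 * (2 * n)) * (cosq t ^ (2 * m + 1) * sinq t)).
  set (ddu := fun t => (PI / 2) ^ 2 * (2 * n * (2 * n - 1) * cosq t ^ (2 * m) - 4 * n ^ 2 * cosq t ^ (2 * m + 2))).
  assert (Hu : forall t, is_derive u t (du t)).
  { intros t. unfold u, du, cosq, sinq. auto_derive; [trivial|].
    replace (Init.Nat.pred (m + (m + 0) + 2)) with (2 * m + 1)%nat by lia.
    rewrite !plus_INR, Rplus_0_r. simpl INR. rewrite Hn. field. }
  assert (Hdu : forall t, is_derive du t (ddu t)).
  { intros t. unfold du, ddu, cosq, sinq. auto_derive; [trivial|].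
    replace (Init.Nat.pred (m + (m + 0) + 1)) with (2 * m)%nat by lia.
    rewrite !plus_INR, Rplus_0_r. simpl INR. rewrite Hn.
    replace (m + (m + 0))%nat with (2 * m)%nat by lia.
    replace (cos (PI / 2 * t) ^ (2 * m + 1)) with (cos (PI / 2 * t) ^ (2 * m) * cos (PI / 2 * t)) by (rewrite pow_add; ring).
    replace (cos (PI / 2 * t) ^ (2 * m + 2)) with (cos (PI / 2 * t) ^ (2 * m) * (cos (PI / 2 * t) * cos (PI / 2 * t))) by (rewrite pow_add; ring).
    pose proof (sin2_cos2 (PI / 2 * t)) as HS. unfold Rsqr in HS.
    assert (HS' : sin (PI / 2 * t) * sin (PI / 2 * t) = 1 - cos (PI / 2 * t) * cos (PI / 2 * t)) by lra.
    match goal with |- ?l = ?r => ring_simplify l r end.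
    replace (sin (PI / 2 * t) ^ 2) with (1 - cos (PI / 2 * t) * cos (PI / 2 * t)) by (rewrite <- HS'; ring).
    field. }
  set (W := fun t : R => (RtoC (du t) * Cs (t * z) - RtoC (u t) * (z * (PI * Ci * Sn (t * z))))%C).
  set (dW := fun t : R => (RtoC ((PI / 2) ^ 2) * ((2 * INR m + 2)%R * (2 * INR m + 1)%R * (RtoC (cosq t ^ (2 * m)) * Cs (t * z))
      - 4 * (RtoC n * RtoC n - z * z) * (RtoC (cosq t ^ (2 * S m)) * Cs (t * z))))%C).
  assert (HW : forall t, Cder W t (dW t)).
  { intros t. eapply Cder_eq.
    - apply Cder_minus; apply Cder_mult.
      + apply Cder_RtoC. apply Hdu.
      + apply Cder_Cs. apply Cder_tz.
      + apply Cder_RtoC. apply Hu.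
      + apply Cder_scal. apply Cder_scal. apply Cder_Sn. apply Cder_tz.
    - cbv beta. unfold dW, ddu, u. replace (2 * S m)%nat with (2 * m + 2)%nat by lia. fold n.
      set (A := cosq t ^ (2 * m)). set (B := cosq t ^ (2 * m + 2)).
      assert (Ci2 : (Ci * Ci)%C = (- RtoC 1)%C) by (apply C_eq; simpl; ring).
      transitivity (RtoC ((PI / 2) ^ 2 * (2 * n * (2 * n - 1) * A - 4 * n ^ 2 * B)) * Cs (t * z)
        - B * (z * z * (PI * PI * (Ci * Ci)) * Cs (t * z)))%C; [ring|].
      rewrite Ci2. replace (2 * INR m + 2) with (2 * n) by lra. replace (2 * INR m + 1) with (2 * n - 1) by lra.
      replace ((PI / 2) ^ 2) with (PI * PI / 4) by field.
      rewrite !RtoC_mult, !RtoC_minus, !RtoC_mult, RtoC_pow, RtoC_div, RtoC_mult by lra. rewrite ?RtoC_minus, ?RtoC_mult. field. }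
  assert (HI : CInt dW = (W 1 - W 0)%C).
  { apply CInt_FTC; [intros; apply HW|]. intros t Ht. unfold dW. apply CL_mult; [apply CL_const|].
    apply CL_minus; (apply CL_mult; [apply CL_const|]; apply CL_cos_integrand). }
  assert (HW1 : W 1 = 0%C).
  { unfold W, du, u, cosq. rewrite Rmult_1_r, cos_PI2, !pow_i by lia. rewrite Rmult_0_l, Rmult_0_r. ring. }
  assert (HW0 : W 0 = 0%C).
  { unfold W, du, u, sinq. rewrite Rmult_0_r, sin_0, !Rmult_0_r. replace (0 * z)%C with (RtoC 0) by ring.
    replace (Sn 0) with (RtoC 0); [ring|]. unfold Sn. replace (PI * Ci * 0)%C with (RtoC 0) by ring. replace (- 0)%C with (RtoC 0) by ring. ring. }
  rewrite HW1, HW0 in HI.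
  unfold dW in HI. rewrite CInt_scal_l, CInt_minus, !CInt_scal_l in HI.
  - fold (cos_integral m z) in HI. fold (cos_integral (S m) z) in HI.
    assert (HP : RtoC ((PI / 2) ^ 2) <> 0%C).
    { intros E. apply RtoC_inj in E. pose proof PI_RGT_0. nra. }
    replace (0 - 0)%C with (RtoC 0) in HI by ring.
    apply Ceq_minus.
    assert (HZ : ((2 * INR m + 2)%R * (2 * INR m + 1)%R * cos_integral m z - 4 * (n * n - z * z) * cos_integral (S m) z = 0)%C).
    { transitivity (/ RtoC ((PI / 2) ^ 2) * (RtoC ((PI / 2) ^ 2) * ((2 * INR m + 2)%R * (2 * INR m + 1)%R * cos_integral m z - 4 * (n * n - z * z) * cos_integral (S m) z)))%C.
      - field. exact HP.
      - rewrite HI. ring. }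
    transitivity (- ((2 * INR m + 2)%R * (2 * INR m + 1)%R * cos_integral m z - 4 * (n * n - z * z) * cos_integral (S m) z))%C; [ring|].
    rewrite HZ. ring.
  - intros t _. apply CL_cos_integrand.
  - intros t _. apply CL_cos_integrand.
  - intros t _. apply CL_mult; [apply CL_const|]; apply CL_cos_integrand.
  - intros t _. apply CL_mult; [apply CL_const|]; apply CL_cos_integrand.
  - intros t _. apply CL_minus; (apply CL_mult; [apply CL_const|]; apply CL_cos_integrand).
Qed.

(** The Wallis integral of [cos^(2m) (pi t/2)] over the unit interval, as [RInt_cos_pow]
    confirms. *)
Fixpoint wallis (m : nat) : R := match m with O => 1 | S m => wallis m * ((2 * INR m + 1) / (2 * INR m + 2)) end.

Lemma wallis_pos m : 0 < wallis m.
Proof.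
  induction m as [|m IH]; simpl; [lra|]. pose proof (pos_INR m).
  apply Rmult_lt_0_compat; [exact IH | apply Rdiv_lt_0_compat; lra].
Qed.

Lemma Cs_0 : Cs 0 = 2%C.
Proof.
  unfold Cs. replace (PI * Ci * 0)%C with (RtoC 0) by ring. replace (- 0)%C with (RtoC 0) by ring. rewrite cexp_0. ring.
Qed.

Lemma cos_integral_0 z : (PI * Ci * z * cos_integral 0 z = Sn z)%C.
Proof.
  unfold cos_integral. rewrite <- CInt_scal_l by (intros; apply CL_cos_integrand).
  rewrite (CInt_FTC (fun t : R => Sn (t * z)%C)).
  - replace (1 * z)%C with z by ring. replace (0 * z)%C with (RtoC 0) by ring.
    replace (Sn 0) with (RtoC 0); [ring|]. unfold Sn. replace (PI * Ci * 0)%C with (RtoC 0) by ring. replace (- 0)%C with (RtoC 0) by ring. ring.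
  - intros t _. eapply Cder_eq; [apply Cder_Sn; apply Cder_tz|]. cbv beta. simpl pow. ring.
  - intros t _. apply CL_mult; [apply CL_const | apply CL_cos_integrand].
Qed.

Lemma cos_integral_at_0 m : cos_integral m 0 = RtoC (2 * wallis m).
Proof.
  induction m as [|m IH].
  - unfold cos_integral. simpl wallis. rewrite (CInt_ext _ (fun _ => RtoC 2)).
    + unfold CInt, RtoC; apply C_eq; simpl; rewrite RInt_const; unfold scal; simpl; unfold mult; simpl; ring.
    + intros t _. replace (t * 0)%C with (RtoC 0) by ring. rewrite Cs_0. simpl. ring.
  - pose proof (cos_integral_rec m 0) as H. rewrite IH in H. pose proof (pos_INR m) as Hm.
    assert (N : RtoC (INR (S m)) <> 0%C) by (intros E; apply RtoC_inj in E; rewrite S_INR in E; lra).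
    transitivity (/ (4 * (INR (S m) * INR (S m))) * (4 * (INR (S m) * INR (S m) - 0 * 0) * cos_integral (S m) 0))%C.
    + field. exact N.
    + rewrite H. simpl wallis. rewrite S_INR in *.
      rewrite <- !RtoC_mult. rewrite <- RtoC_inv by nra. rewrite <- RtoC_mult. f_equal. field. lra.
Qed.

Lemma RInt_cos_pow m : is_RInt (fun t => cosq t ^ (2 * m)) 0 1 (wallis m).
Proof.
  assert (E : ex_RInt (fun t => cosq t ^ (2 * m)) 0 1).
  { apply (@ex_RInt_continuous R_CompleteNormedModule). intros t _.
    apply (@ex_derive_continuous R_AbsRing R_NormedModule). unfold cosq. auto_derive. trivial. }
  pose proof (RInt_correct _ _ _ E) as HI.
  assert (H : RInt (fun t : R => Re (RtoC (cosq t ^ (2 * m)) * Cs (t * 0))%C) 0 1 = 2 * wallis m) by exact (f_equal Re (cos_integral_at_0 m)).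
  assert (H2 : RInt (fun t => Re (RtoC (cosq t ^ (2 * m)) * Cs (t * 0))%C) 0 1 = 2 * RInt (fun t => cosq t ^ (2 * m)) 0 1).
  { apply is_RInt_unique. apply (is_RInt_ext (fun t => scal 2 (cosq t ^ (2 * m)))).
    - intros t _. replace (t * 0)%C with (RtoC 0) by ring. rewrite Cs_0. unfold Re; simpl. unfold scal; simpl; unfold mult; simpl. ring.
    - apply (@is_RInt_scal R_NormedModule). exact HI. }
  replace (wallis m) with (RInt (fun t => cosq t ^ (2 * m)) 0 1); [exact HI|].
  rewrite H in H2. lra.
Qed.

(** A crude Jordan inequality: [sin a >= a - a^3/6 >= a/3] for [0 <= a <= 2]. *)
Lemma sinq_ge t : 0 <= t <= 1 -> t <= 3 * sinq t.
Proof.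
  intros Ht. pose proof PI_4. pose proof PI2_1 as HP. unfold PI2 in HP. unfold sinq.
  set (a := PI / 2 * t). assert (Ha : t <= a <= 2) by (unfold a; nra).
  destruct (pre_sin_bound a 0 ltac:(lra) ltac:(lra)) as [H1 _].
  unfold sin_approx, sin_term in H1. simpl in H1.
  assert (a - a ^ 3 / 6 <= sin a) by (eapply Rle_trans; [|exact H1]; right; field).
  assert (a ^ 3 / 6 <= 2 * a / 3) by (assert (a ^ 2 <= 4) by nra; nra). lra.
Qed.

(** [2 cos(pi z t) - 2] is [O(t^2)] and [t^2 <= 9 sin^2 (pi t/2)]. The weight [cos^(2m) sin^2] then
    integrates to [wallis m - wallis (S m) = wallis m / (2m + 2)], which gains the factor [1/m]. *)
Lemma cos_integral_close m z : Cmod (cos_integral m z - (2 * wallis m)%R) <= 36 * (PI * Cmod z) ^ 2 * exp (PI * Cmod z) * (wallis m / (2 * INR m + 2)).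
Proof.
  rewrite <- cos_integral_at_0. unfold cos_integral. rewrite <- CInt_minus by (intros; apply CL_cos_integrand).
  set (X := PI * Cmod z). pose proof PI_RGT_0. pose proof (Cmod_ge_0 z).
  assert (HX : 0 <= X) by (unfold X; apply Rmult_le_pos; lra).
  set (K := 18 * X ^ 2 * exp X). assert (HK : 0 <= K) by (unfold K; pose proof (exp_pos X); pose proof (pow2_ge_0 X); apply Rmult_le_pos; lra).
  assert (HG : is_RInt (fun t => scal K (minus (cosq t ^ (2 * m)) (cosq t ^ (2 * S m)))) 0 1 (scal K (minus (wallis m) (wallis (S m))))).
  { apply (@is_RInt_scal R_NormedModule). apply (@is_RInt_minus R_NormedModule); apply RInt_cos_pow. }
  eapply Rle_trans.
  - apply (CInt_bound_RInt _ (fun t => scal K (minus (cosq t ^ (2 * m)) (cosq t ^ (2 * S m))))).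
    + intros t _. apply CL_minus; apply CL_cos_integrand.
    + eexists; exact HG.
    + intros t Ht. replace (RtoC (cosq t ^ (2 * m)) * Cs (t * z) - RtoC (cosq t ^ (2 * m)) * Cs (t * 0))%C with
        (RtoC (cosq t ^ (2 * m)) * (Cs (t * z) - Cs (t * 0)))%C by ring.
      replace (t * 0)%C with (RtoC 0) by ring. rewrite Cs_0.
      rewrite Cmod_mult, Cmod_R.
      assert (Hc : 0 <= cosq t ^ (2 * m)) by (rewrite pow_mult; apply pow_le; apply pow2_ge_0).
      rewrite Rabs_pos_eq by exact Hc.
      replace (scal K (minus (cosq t ^ (2 * m)) (cosq t ^ (2 * S m)))) with (cosq t ^ (2 * m) * (K * sinq t ^ 2)).
      * apply Rmult_le_compat_l; [exact Hc|].
        set (w := (PI * Ci * (t * z))%C).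
        assert (Hw : Cmod w = t * X) by (unfold w, X; rewrite Cmod_iPI, Cmod_mult, Cmod_R, Rabs_pos_eq by lra; ring).
        replace (Cs (t * z) - 2)%C with ((cexp w - 1 - w) + (cexp (- w) - 1 - - w))%C by (unfold Cs; fold w; ring).
        eapply Rle_trans; [apply Cmod_triangle|].
        pose proof (Cmod_cexp_m1z w) as H1. pose proof (Cmod_cexp_m1z (- w)) as H2. rewrite Cmod_opp in H2. rewrite Hw in H1, H2.
        pose proof (sinq_ge t ltac:(lra)) as Hs.
        assert (Hts : t ^ 2 <= 9 * sinq t ^ 2) by nra.
        assert (He : exp (t * X) <= exp X) by (apply exp_le; nra). pose proof (exp_pos (t * X)). pose proof (exp_pos X).
        assert (Hb : (t * X) ^ 2 * exp (t * X) <= 9 * X ^ 2 * exp X * sinq t ^ 2).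
        { replace (9 * X ^ 2 * exp X * sinq t ^ 2) with ((9 * sinq t ^ 2 * X ^ 2) * exp X) by ring.
          apply Rmult_le_compat; [apply pow2_ge_0 | lra | | exact He].
          rewrite Rpow_mult_distr. apply Rmult_le_compat_r; [apply pow2_ge_0 | exact Hts]. }
        unfold K. lra.
      * unfold scal, minus, plus, opp; simpl; unfold mult; simpl.
        replace (m + S (m + 0))%nat with (S (m + (m + 0))) by lia. simpl.
        pose proof (sin2_cos2 (PI / 2 * t)) as HS. unfold Rsqr in HS. unfold cosq, sinq.
        assert (HS' : sin (PI / 2 * t) * sin (PI / 2 * t) = 1 - cos (PI / 2 * t) * cos (PI / 2 * t)) by lra.
        rewrite Rmult_1_r, HS'. ring.
  - rewrite (is_RInt_unique _ _ _ _ HG). simpl wallis. unfold scal, minus, plus, opp; simpl; unfold mult; simpl.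
    unfold K. pose proof (pos_INR m). right. field. lra.
Qed.

Fixpoint sprod (m : nat) (z : C) : C :=
  match m with O => RtoC 1 | S m => (sprod m z * (1 - z * z / (RtoC (INR (S m)) * RtoC (INR (S m)))))%C end.

(** Each new factor is the quotient of the recursion of [cos_integral] at [z] by the same recursion
    at 0, which is that of [wallis]. *)
Lemma sprod_cos_integral m z : (cos_integral 0 z * wallis m = sprod m z * cos_integral m z)%C.
Proof.
  induction m as [|m IH]; [simpl; ring|].
  pose proof (cos_integral_rec m z) as H. pose proof (pos_INR m) as Hm.
  assert (N : RtoC (INR (S m)) <> 0%C) by (intros E; apply RtoC_inj in E; rewrite S_INR in E; lra).
  change (wallis (S m)) with (wallis m * ((2 * INR m + 1) / (2 * INR m + 2))).
  rewrite RtoC_mult. replace (cos_integral 0 z * (wallis m * ((2 * INR m + 1) / (2 * INR m + 2))%R))%C with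
    (cos_integral 0 z * wallis m * ((2 * INR m + 1) / (2 * INR m + 2))%R)%C by ring.
  rewrite IH.
  change (sprod (S m) z) with (sprod m z * (1 - z * z / (RtoC (INR (S m)) * RtoC (INR (S m)))))%C.
  transitivity (sprod m z * (/ (4 * (INR (S m) * INR (S m))) * (4 * (INR (S m) * INR (S m) - z * z) * cos_integral (S m) z)))%C.
  - rewrite H.
    replace (RtoC ((2 * INR m + 1) / (2 * INR m + 2))) with (/ (4 * (INR (S m) * INR (S m))) * ((2 * INR m + 2)%R * (2 * INR m + 1)%R))%C; [ring|].
    rewrite S_INR, <- !RtoC_mult. rewrite <- RtoC_inv by nra. rewrite <- RtoC_mult. f_equal. field. lra.
  - field. exact N.
Qed.

Lemma filterlim_inv_INR B a : filterlim (fun m => B / (INR m + a)) eventually (locally 0).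
Proof.
  apply (filterlim_comp _ _ _ (fun m => INR m + a) (fun r => B / r) _ (Rbar_locally p_infty)); [|apply filterlim_inv_p_infty].
  intros P [M HM]. destruct (INR_unbounded (M - a)) as [n Hn]. exists n. intros k Hk. apply HM.
  apply le_INR in Hk. lra.
Qed.

(** The normalised integrals [cos_integral m z / wallis m] tend to 2 because the weight concentrates
    at [t = 0]; the limit is [sin(pi z) / (pi z)]. *)
Lemma sine_product (z : C) : z <> 0%C -> CL eventually (fun m => sprod m z) (Sn z / (2 * (PI * Ci * z)))%C.
Proof.
  intros Hz. pose proof PI_RGT_0.
  assert (HPi : (PI * Ci * z)%C <> 0%C) by (apply Cmod_gt_0; rewrite Cmod_iPI; apply Rmult_lt_0_compat; [lra | apply Cmod_gt_0; exact Hz]).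
  assert (H2 : RtoC 2 <> 0%C) by (apply RtoC_neq; lra).
  assert (HL : CL eventually (fun m => cos_integral m z / wallis m)%C (RtoC 2)).
  { set (K := 36 * (PI * Cmod z) ^ 2 * exp (PI * Cmod z)).
    apply (CL_squeeze _ _ (fun m => (K / 2) / (INR m + 1))); [|apply filterlim_inv_INR].
    apply filter_forall. intros m. pose proof (wallis_pos m) as Hw. pose proof (pos_INR m).
    assert (Nw : RtoC (wallis m) <> 0%C) by (apply RtoC_neq; lra).
    replace (cos_integral m z / wallis m - 2)%C with ((cos_integral m z - (2 * wallis m)%R) / wallis m)%C by (rewrite RtoC_mult; field; exact Nw).
    rewrite Cmod_div, Cmod_R, Rabs_pos_eq by (lra || assumption).
    apply (Rmult_le_reg_r (wallis m)); [exact Hw|].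
    replace (Cmod (cos_integral m z - (2 * wallis m)%R) / wallis m * wallis m) with (Cmod (cos_integral m z - (2 * wallis m)%R)) by (field; lra).
    eapply Rle_trans; [apply cos_integral_close|]. fold K. right. field. lra. }
  assert (HL2 : CL eventually (fun m => cos_integral 0 z / (cos_integral m z / wallis m))%C (cos_integral 0 z / 2)%C).
  { apply CL_div; [apply CL_const | exact HL | exact H2]. }
  eapply CL_eq.
  - apply (CL_ext_loc (fun m => cos_integral 0 z / (cos_integral m z / wallis m))%C); [|exact HL2].
    assert (HE : eventually (fun m => Cmod (cos_integral m z / wallis m - 2) < 1)) by (apply (proj1 (CL_eps _ _) HL); lra).
    revert HE. apply filter_imp. intros m Hm.
    assert (Nw : RtoC (wallis m) <> 0%C) by (intros E; apply RtoC_inj in E; pose proof (wallis_pos m); lra).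
    assert (Nc : cos_integral m z <> 0%C).
    { intros E. rewrite E in Hm. replace (RtoC 0 / wallis m - 2)%C with (- RtoC 2)%C in Hm by (field; exact Nw).
      rewrite Cmod_opp, Cmod_R, Rabs_pos_eq in Hm by lra. lra. }
    transitivity ((cos_integral 0 z * wallis m) / cos_integral m z)%C; [field; split; assumption|].
    rewrite sprod_cos_integral. field. exact Nc.
  - rewrite <- cos_integral_0. assert (HP : RtoC PI <> 0%C) by (apply RtoC_neq; lra).
    pose proof Ci_nz. field. repeat split; assumption.
Qed.

(** * Stirling's formula and the factor chi *)


Lemma clog_mult (a b : C) : a <> 0%C -> b <> 0%C -> - PI < carg a + carg b <= PI ->
  clog (a * b) = (clog a + clog b)%C.
Proof.
  intros Ha Hb H. apply clog_unique; [|exact H]. rewrite cexp_plus, !cexp_clog by assumption. reflexivity.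
Qed.

Lemma Re_pos_neq_0 (z : C) : 0 < Re z -> z <> 0%C.
Proof. intros H. apply slit_neq_0. left. exact H. Qed.

Lemma clog_mult_Re_pos (a b : C) : 0 < Re a -> 0 < Re b -> clog (a * b) = (clog a + clog b)%C.
Proof.
  intros Ha Hb. pose proof (carg_Re_pos_bound a Ha). pose proof (carg_Re_pos_bound b Hb).
  apply clog_mult; try (apply Re_pos_neq_0; assumption). lra.
Qed.

Lemma Re_div_R (z : C) (x : R) : x <> 0 -> Re (z / RtoC x) = Re z / x.
Proof. intros H. unfold Re; simpl. field. exact H. Qed.

Lemma Re_inv_pos (w : C) : 0 < Re w -> 0 < Re (/ w).
Proof.
  intros H. unfold Re in *; simpl. apply Rdiv_lt_0_compat; [exact H|]. nra.
Qed.

Lemma Cmod_1_plus_ge (u : C) (t : R) : 0 <= Re u -> 0 <= t -> 1 <= Cmod (1 + t * u) /\ slit (1 + t * u).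
Proof.
  intros Hu Ht. assert (H : 1 <= Re (1 + t * u)).
  { replace (Re (1 + t * u)) with (1 + t * Re u) by (unfold Re; simpl; ring). nra. }
  split; [|left; lra]. eapply Rle_trans; [exact H|]. eapply Rle_trans; [apply Rle_abs | apply re_le_Cmod].
Qed.

Lemma Cmod_div_le (a b : C) : 1 <= Cmod b -> Cmod (a / b) <= Cmod a.
Proof.
  intros H. assert (b <> 0%C) by (apply Cmod_gt_0; lra). rewrite Cmod_div by assumption.
  pose proof (Cmod_ge_0 a). apply (Rmult_le_reg_r (Cmod b)); [lra|].
  replace (Cmod a / Cmod b * Cmod b) with (Cmod a) by (field; lra). nra.
Qed.

Lemma clog_0_arg (u : C) : clog (1 + 0 * u) = 0%C.
Proof.
  replace (1 + 0 * u)%C with (RtoC 1) by ring. rewrite clog_RtoC, ln_1 by lra. reflexivity.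
Qed.

Lemma clog_1_plus_1 (u : C) : 0 <= Re u -> Cmod (clog (1 + u) - u) <= Cmod u ^ 2.
Proof.
  intros Hu.
  assert (M := mean_value_C_const (fun t => clog (1 + t * u) - t * u)%C (fun t => u / (1 + t * u) - u)%C (Cmod u ^ 2) 0 1).
  cbv beta in M. rewrite clog_0_arg in M. replace (1 + 1 * u)%C with (1 + u)%C in M by ring.
  replace (clog (1 + u) - 1 * u - (0 - 0 * u))%C with (clog (1 + u) - u)%C in M by ring.
  rewrite Rminus_0_r, Rmult_1_r in M. apply M; [lra | |].
  - intros t Ht. destruct (Cmod_1_plus_ge u t Hu ltac:(lra)) as [A B].
    apply Cder_minus; [apply Cder_clog; [apply Cder_line | exact B] | apply Cder_tz].
  - intros t Ht. destruct (Cmod_1_plus_ge u t Hu ltac:(lra)) as [A B]. pose proof (slit_neq_0 _ B) as N.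
    replace (u / (1 + t * u) - u)%C with (- (t * (u * u)) / (1 + t * u))%C by (field; exact N).
    eapply Rle_trans; [apply Cmod_div_le; exact A|]. rewrite Cmod_opp, !Cmod_mult, Cmod_R, Rabs_pos_eq by lra.
    pose proof (Cmod_ge_0 u). nra.
Qed.

Lemma clog_1_plus_2 (u : C) : 0 <= Re u -> Cmod (clog (1 + u) - u + u * u / 2) <= Cmod u ^ 3.
Proof.
  intros Hu.
  assert (M := mean_value_C_const (fun t => clog (1 + t * u) - t * u + t * u * (t * u) / 2)%C
    (fun t => u / (1 + t * u) - u + (u * (t * u) + t * u * u) / 2)%C (Cmod u ^ 3) 0 1).
  cbv beta in M. rewrite clog_0_arg in M. replace (1 + 1 * u)%C with (1 + u)%C in M by ring.
  replace (clog (1 + u) - 1 * u + 1 * u * (1 * u) / 2 - (0 - 0 * u + 0 * u * (0 * u) / 2))%C with (clog (1 + u) - u + u * u / 2)%C in M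
    by (field; apply RtoC_neq; lra).
  rewrite Rminus_0_r, Rmult_1_r in M. apply M; [lra | |].
  - intros t Ht. destruct (Cmod_1_plus_ge u t Hu ltac:(lra)) as [A B].
    apply Cder_plus; [apply Cder_minus; [apply Cder_clog; [apply Cder_line | exact B] | apply Cder_tz]|].
    eapply Cder_eq; [apply Cder_mult; [apply Cder_mult; apply Cder_tz | apply Cder_const]|].
    cbv beta. unfold Cdiv. ring.
  - intros t Ht. destruct (Cmod_1_plus_ge u t Hu ltac:(lra)) as [A B]. pose proof (slit_neq_0 _ B) as N.
    replace (u / (1 + t * u) - u + (u * (t * u) + t * u * u) / 2)%C with (t * t * (u * (u * u)) / (1 + t * u))%C
      by (field; repeat split; (exact N || apply RtoC_neq; lra)).
    eapply Rle_trans; [apply Cmod_div_le; exact A|]. rewrite !Cmod_mult, Cmod_R, Rabs_pos_eq by lra.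
    pose proof (Cmod_ge_0 u). assert (0 <= Cmod u * (Cmod u * Cmod u)) by (repeat apply Rmult_le_pos; lra).
    assert (t * t <= 1) by nra. simpl. rewrite Rmult_1_r. nra.
Qed.

(** The logarithm by which [stir_S] misses the functional equation of Gamma; see [stir_S_succ]. *)
Definition stir_h (w : C) : C := ((w + (1 / 2)%R) * clog (1 + / w) - 1)%C.
(** Stirling's approximation [w^(w - 1/2) e^(-w)], without the constant factor. *)
Definition stir_S (w : C) : C := cexp ((w - (1 / 2)%R) * clog w - w).

(** With [u = 1/w], the shift [1/2] makes the terms of order 1 and [u] cancel; what remains is
    [- u^2/4] and the cubic remainder [E] divided by [u], plus [E/2]. *)
Lemma stir_h_bound (w : C) : 0 < Re w -> 1 <= Cmod w -> Cmod (stir_h w) <= 2 / Cmod w ^ 2.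
Proof.
  intros Hw H1. pose proof (Re_pos_neq_0 w Hw) as N. set (u := (/ w)%C).
  assert (Hu : 0 < Re u) by (apply Re_inv_pos; exact Hw).
  assert (Mu : Cmod u = / Cmod w) by (apply Cmod_inv; exact N).
  assert (Mu0 : 0 < Cmod u) by (rewrite Mu; apply Rinv_0_lt_compat; lra).
  assert (Mu1 : Cmod u <= 1) by (rewrite Mu, <- Rinv_1; apply Rinv_le_contravar; lra).
  pose proof (clog_1_plus_2 u ltac:(lra)) as HE. set (E := (clog (1 + u) - u + u * u / 2)%C) in HE.
  assert (Nu : u <> 0%C) by (apply Cmod_gt_0; exact Mu0).
  assert (H2 : RtoC 2 <> 0%C) by (apply RtoC_neq; lra).
  replace (stir_h w) with (- (u * u / 4) + (E / u + E / 2))%C.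
  - replace (2 / Cmod w ^ 2) with (2 * Cmod u ^ 2) by (rewrite Mu; field; lra).
    eapply Rle_trans; [apply Cmod_triangle|]. eapply Rle_trans; [apply Rplus_le_compat_l; apply Cmod_triangle|].
    rewrite Cmod_opp, !Cmod_div, Cmod_mult, !Cmod_R, !Rabs_pos_eq by (lra || assumption || apply RtoC_neq; lra).
    assert (Cmod E / Cmod u <= Cmod u ^ 2).
    { apply (Rmult_le_reg_r (Cmod u)); [exact Mu0|]. replace (Cmod E / Cmod u * Cmod u) with (Cmod E) by (field; lra). simpl in *. lra. }
    assert (Cmod u ^ 3 <= Cmod u ^ 2) by nra. nra.
  - unfold stir_h. fold u. replace w with (/ u)%C by (unfold u; field; exact N).
    replace (clog (1 + u)) with (E + u - u * u / 2)%C by (unfold E; ring).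
    rewrite RtoC_div by lra. field. repeat split; (assumption || apply RtoC_neq; lra).
Qed.

Lemma stir_S_succ (w : C) : 0 < Re w -> stir_S (w + 1) = (stir_S w * w * cexp (stir_h w))%C.
Proof.
  intros Hw. pose proof (Re_pos_neq_0 w Hw) as N.
  transitivity (stir_S w * cexp (clog w) * cexp (stir_h w))%C; [|rewrite (cexp_clog w N); reflexivity].
  unfold stir_S, stir_h. rewrite <- !cexp_plus. f_equal.
  replace (w + 1)%C with (w * (1 + / w))%C by (field; exact N).
  rewrite clog_mult_Re_pos; [| exact Hw |].
  - rewrite RtoC_div by lra. field. repeat split; (exact N || apply RtoC_neq; lra).
  - pose proof (Re_inv_pos w Hw). unfold Re in *; simpl in *. lra.
Qed.

Fixpoint stir_sum (z : C) (n : nat) : C :=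
  match n with O => stir_h z | S m => (stir_sum z m + stir_h (z + RtoC (INR n)))%C end.

Lemma Re_plus_nat (z : C) (k : nat) : 0 < Re z -> 0 < Re (z + RtoC (INR k)).
Proof. intros H. pose proof (pos_INR k). change (0 < Re z + INR k). lra. Qed.

(** [stir_S_succ] telescopes; product and sum both run over [0, ..., n], so the argument on the
    right is [z + n + 1]. *)
Lemma prodz_stir (z : C) n : 0 < Re z ->
  (prodz z n * stir_S z * cexp (stir_sum z n))%C = stir_S (z + RtoC (INR (S n))).
Proof.
  intros Hz. induction n as [|n IH].
  - simpl prodz. simpl stir_sum. simpl INR. rewrite stir_S_succ by exact Hz. ring.
  - rewrite S_INR, RtoC_plus, Cplus_assoc, stir_S_succ.
    + rewrite <- IH. simpl prodz. simpl stir_sum. rewrite cexp_plus. simpl INR. ring.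
    + apply Re_plus_nat; exact Hz.
Qed.

(** For [Re z > 0] the cross term of [|z + k|^2] is nonnegative, so [|z + k|] is comparable with
    [|z| + k] and the error depends on [|z|] alone, not on the argument. *)
Lemma Cmod_plus_nat_ge (z : C) (k : nat) : 0 < Re z -> 1 <= Cmod z ->
  1 <= Cmod (z + INR k) /\ (Cmod z + INR k) ^ 2 / 2 <= Cmod (z + INR k) ^ 2.
Proof.
  intros Hz H1. pose proof (pos_INR k) as Hk.
  assert (E : Cmod z ^ 2 + INR k ^ 2 <= Cmod (z + INR k) ^ 2).
  { rewrite !Cmod2_alt. unfold Re, Im in *; simpl in *. nra. }
  pose proof (pow2_ge_0 (Cmod z - INR k)). pose proof (pow2_ge_0 (INR k)). pose proof (Cmod_ge_0 (z + INR k)).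
  split; [|nra]. assert (1 <= Cmod z ^ 2) by nra. nra.
Qed.

(** With [a = |z| + k >= 1], [4/a^2 <= 8/(a (a + 1))], written as a telescoping difference. *)
Lemma stir_h_shift (z : C) (k : nat) : 0 < Re z -> 1 <= Cmod z ->
  Cmod (stir_h (z + INR k)) <= 8 / (Cmod z + INR k) - 8 / (Cmod z + INR k + 1).
Proof.
  intros Hz H1. pose proof (pos_INR k) as Hk. destruct (Cmod_plus_nat_ge z k Hz H1) as [A B].
  eapply Rle_trans; [apply stir_h_bound; [|exact A]|].
  - apply Re_plus_nat; exact Hz.
  - set (a := Cmod z + INR k) in *. assert (Ha : 1 <= a) by (unfold a; lra).
    replace (8 / a - 8 / (a + 1)) with (2 / (a * (a + 1) / 4)) by (field; lra).
    unfold Rdiv at 1 2. apply Rmult_le_compat_l; [lra|]. apply Rinv_le_contravar; nra.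
Qed.

Lemma stir_sum_diff (z : C) m p : 0 < Re z -> 1 <= Cmod z ->
  Cmod (stir_sum z (m + p) - stir_sum z m) <= 8 / (Cmod z + INR m + 1) - 8 / (Cmod z + INR (m + p) + 1).
Proof.
  intros Hz H1. induction p as [|p IH].
  - rewrite Nat.add_0_r. replace (stir_sum z m - stir_sum z m)%C with (RtoC 0) by ring. rewrite Cmod_0. lra.
  - rewrite Nat.add_succ_r.
    change (stir_sum z (S (m + p))) with (stir_sum z (m + p) + stir_h (z + RtoC (INR (S (m + p)))))%C.
    replace (stir_sum z (m + p) + stir_h (z + RtoC (INR (S (m + p)))) - stir_sum z m)%C with
      ((stir_sum z (m + p) - stir_sum z m) + stir_h (z + RtoC (INR (S (m + p)))))%C by ring.
    eapply Rle_trans; [apply Cmod_triangle|]. pose proof (stir_h_shift z (S (m + p)) Hz H1) as H.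
    rewrite S_INR in *. replace (Cmod z + (INR (m + p) + 1)) with (Cmod z + INR (m + p) + 1) in * by ring. lra.
Qed.

Lemma stir_sum_bound (z : C) n : 0 < Re z -> 1 <= Cmod z -> Cmod (stir_sum z n) <= 8 / Cmod z.
Proof.
  intros Hz H1. pose proof (stir_sum_diff z 0 n Hz H1) as H. simpl Nat.add in H.
  pose proof (stir_h_shift z 0 Hz H1) as H0. simpl INR in *.
  replace (z + 0)%C with z in H0 by ring. rewrite Rplus_0_r in *.
  pose proof (Cmod_triangle (stir_sum z n - stir_sum z 0) (stir_sum z 0)) as HT.
  replace (stir_sum z n - stir_sum z 0 + stir_sum z 0)%C with (stir_sum z n) in HT by ring. simpl stir_sum in *.
  assert (0 <= 8 / (Cmod z + INR n + 1)).
  { pose proof (pos_INR n). apply Rmult_le_pos; [lra | left; apply Rinv_0_lt_compat; lra]. }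
  lra.
Qed.

(** The logarithmic error of Stirling's formula: in the right half-plane Gamma is [stir_S z * cexp
    (stir_lim z) / stir_const], by [rgamma_right]. *)
Definition stir_lim (z : C) : C := clim (stir_sum z).

Lemma CL_stir_sum (z : C) : 0 < Re z -> 1 <= Cmod z -> CL eventually (stir_sum z) (stir_lim z).
Proof.
  intros Hz H1.
  assert (HP : forall eps, 0 < eps -> exists M, forall u v, (M <= u)%nat -> (M <= v)%nat -> Cmod (stir_sum z v - stir_sum z u) < eps).
  { intros eps He. destruct (proj1 (filterlim_R_eps _ _) (filterlim_inv_INR 8 1) eps He) as [M HM].
    exists M.
    assert (HW : forall u v, (M <= u)%nat -> (u <= v)%nat -> Cmod (stir_sum z v - stir_sum z u) < eps).
    { intros u v Hu Huv. replace v with (u + (v - u))%nat by lia.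
      pose proof (stir_sum_diff z u (v - u) Hz H1). specialize (HM u Hu). rewrite Rminus_0_r in HM.
      pose proof (pos_INR u). pose proof (pos_INR (u + (v - u))).
      assert (0 <= 8 / (Cmod z + INR (u + (v - u)) + 1)) by (apply Rmult_le_pos; [lra | left; apply Rinv_0_lt_compat; lra]).
      assert (8 / (Cmod z + INR u + 1) <= 8 / (INR u + 1)).
      { unfold Rdiv. apply Rmult_le_compat_l; [lra|]. apply Rinv_le_contravar; lra. }
      pose proof (Rle_abs (8 / (INR u + 1))). lra. }
    intros u v Hu Hv. destruct (Nat.le_gt_cases u v); [apply HW; assumption|].
    rewrite Cmod_minus_sym. apply HW; lia. }
  destruct (CL_cauchy (F := eventually) (stir_sum z)) as [L H].
  { intros eps He. destruct (HP eps He) as [M HM]. exists (fun r => (M <= r)%nat). split; [exists M; trivial | exact HM]. }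
  unfold stir_lim. rewrite (clim_CL _ _ H). exact H.
Qed.

Lemma stir_lim_bound (z : C) : 0 < Re z -> 1 <= Cmod z -> Cmod (stir_lim z) <= 8 / Cmod z.
Proof.
  intros Hz H1. apply (CL_bound (F := eventually) _ _ _ (CL_stir_sum z Hz H1)).
  apply filter_forall. intros n. apply stir_sum_bound; assumption.
Qed.

Lemma prodz_1 m : prodz 1 m = RtoC (INR (fact (S m))).
Proof.
  induction m as [|m IH]; [simpl; reflexivity|].
  change (prodz 1 (S m)) with (prodz 1 m * (1 + RtoC (INR (S m))))%C. rewrite IH.
  change (fact (S (S m))) with (S (S m) * fact (S m))%nat.
  rewrite mult_INR, RtoC_mult, (S_INR (S m)), RtoC_plus. ring.
Qed.

Definition euler_gauss (z : C) (n : nat) : C :=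
  Cdiv (prodz z n) (Cmult (RtoC (INR (fact n))) (cexp (Cmult z (RtoC (ln (INR n)))))).

(** Known as [1 / sqrt(2 pi)]; only its square is determined, in [stir_const_sq]. *)
Definition stir_const : C := (stir_S 1 * cexp (stir_lim 1))%C.

(** With [n = S m], this is [stir_S (z + n + 1) ~ n^z stir_S (1 + n)]. The argument [1 + n] arises
    because [n!] is [prodz 1 m]. *)
Lemma stir_ratio (z : C) : 0 < Re z ->
  CL eventually (fun m => stir_S (z + RtoC (INR (S (S m)))) / (stir_S (1 + RtoC (INR (S m))) * cexp (z * RtoC (ln (INR (S m))))))%C 1%C.
Proof.
  intros Hz. eapply CL_eq; [|apply cexp_0].
  set (X := fun m => let n := INR (S m) in let v := (z / RtoC (n + 1))%C in
    ((z + (n + 1 / 2)%R) * clog (1 + v) + z * (ln (n + 1) - ln n)%R - z)%C).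
  apply (CL_ext (fun m => cexp (X m))).
  - intros m. set (n := INR (S m)). pose proof (pos_INR m) as Hm. assert (Hn : 1 <= n) by (unfold n; rewrite S_INR; lra).
    rewrite (S_INR (S m)). fold n.
    assert (Nn : RtoC (n + 1) <> 0%C) by (apply RtoC_neq; lra).
    unfold stir_S. rewrite <- cexp_plus, <- cexp_minus. f_equal.
    replace (1 + RtoC n)%C with (RtoC (n + 1)) by (rewrite RtoC_plus; ring).
    rewrite (clog_RtoC (n + 1)) by lra.
    set (v := (z / RtoC (n + 1))%C).
    assert (Hv : 0 < Re v).
    { unfold v. rewrite Re_div_R by lra. apply Rdiv_lt_0_compat; [exact Hz | lra]. }
    replace (z + RtoC (n + 1))%C with (RtoC (n + 1) * (1 + v))%C by (unfold v; field; exact Nn).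
    rewrite clog_scal by (try lra; apply Re_pos_neq_0; unfold Re in *; simpl in *; lra).
    unfold X. fold n. fold v.
    replace (RtoC (n + 1) * (1 + v))%C with (z + RtoC (n + 1))%C by (unfold v; field; exact Nn).
    rewrite RtoC_minus, !RtoC_plus, RtoC_div by lra. field.
  - apply CL_cexp.
    set (B := Cmod z ^ 2 + Cmod (z - (1 / 2)%R) * (Cmod z + Cmod z ^ 2) + Cmod z).
    apply (CL_squeeze _ _ (fun m => B / (INR m + 1))); [|apply filterlim_inv_INR].
    apply filter_forall. intros m. unfold X. rewrite S_INR. set (n := INR m + 1).
    pose proof (pos_INR m) as Hm. assert (Hn : 1 <= n) by (unfold n; lra).
    assert (Nn : RtoC (n + 1) <> 0%C) by (apply RtoC_neq; lra).
    set (v := (z / RtoC (n + 1))%C).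
    assert (Hv : 0 < Re v).
    { unfold v. rewrite Re_div_R by lra. apply Rdiv_lt_0_compat; [exact Hz | lra]. }
    pose proof (clog_1_plus_1 v ltac:(lra)) as HL. set (l := clog (1 + v)) in *.
    (* Since [(n + 1) v = z], the main parts cancel and each of the three remaining terms is
       [O(1/n)]. *)
    replace ((z + (n + 1 / 2)%R) * l + z * (ln (n + 1) - ln n)%R - z - 0)%C with
      (RtoC (n + 1) * (l - v) + (z - (1 / 2)%R) * (v + (l - v)) + z * RtoC (ln (n + 1) - ln n))%C.
    + assert (Mv : Cmod v = Cmod z / (n + 1)) by (unfold v; rewrite Cmod_div, Cmod_R, Rabs_pos_eq by (lra || assumption); reflexivity).
      assert (Hln : 0 <= ln (n + 1) - ln n <= 1 / n).
      { split.
        - assert (ln n <= ln (n + 1)) by (apply ln_le; lra). lra.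
        - replace (n + 1) with (n * (1 + 1 / n)) by (field; lra). rewrite ln_mult by (try lra; pose proof (Rinv_0_lt_compat n); unfold Rdiv; lra).
          pose proof (exp_ineq1_le (ln (1 + 1 / n))) as HE. rewrite exp_ln in HE by (pose proof (Rinv_0_lt_compat n); unfold Rdiv; lra). lra. }
      assert (Hi : 0 < / n) by (apply Rinv_0_lt_compat; lra).
      assert (Hi1 : 0 < / (n + 1) <= / n) by (split; [apply Rinv_0_lt_compat; lra | apply Rinv_le_contravar; lra]).
      pose proof (Cmod_ge_0 z) as Hz0. pose proof (Cmod_ge_0 (z - (1 / 2)%R)) as Hz1.
      assert (Mv1 : Cmod v <= Cmod z * / n) by (rewrite Mv; unfold Rdiv; apply Rmult_le_compat_l; lra).
      assert (Mv2 : Cmod v ^ 2 <= Cmod z ^ 2 * / n).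
      { rewrite Mv. unfold Rdiv. rewrite Rpow_mult_distr. apply Rmult_le_compat_l; [apply pow2_ge_0|].
        assert (/ n <= 1) by (rewrite <- Rinv_1; apply Rinv_le_contravar; lra). nra. }
      assert (Mv3 : (n + 1) * Cmod v ^ 2 <= Cmod z ^ 2 * / n).
      { rewrite Mv. replace ((n + 1) * (Cmod z / (n + 1)) ^ 2) with (Cmod z ^ 2 * / (n + 1)) by (field; lra).
        apply Rmult_le_compat_l; [apply pow2_ge_0 | lra]. }
      eapply Rle_trans; [apply Cmod_triangle|]. eapply Rle_trans; [apply Rplus_le_compat_r; apply Cmod_triangle|].
      rewrite !Cmod_mult, !Cmod_R, !Rabs_pos_eq by lra.
      pose proof (Cmod_triangle v (l - v)) as HT. unfold B, Rdiv.
      assert (T1 : (n + 1) * Cmod (l - v) <= Cmod z ^ 2 * / n) by (eapply Rle_trans; [|exact Mv3]; apply Rmult_le_compat_l; lra).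
      assert (T2 : Cmod (z - (1 / 2)%R) * Cmod (v + (l - v)) <= Cmod (z - (1 / 2)%R) * ((Cmod z + Cmod z ^ 2) * / n)) by (apply Rmult_le_compat_l; lra).
      assert (T3 : Cmod z * (ln (n + 1) - ln n) <= Cmod z * / n) by (apply Rmult_le_compat_l; lra).
      unfold Rdiv in T2. lra.
    + unfold v. rewrite !RtoC_minus, !RtoC_plus, RtoC_div by lra. field. cbv beta. rewrite <- RtoC_plus. exact Nn.
Qed.

(** Lets the Euler-Gauss sequence start at [n = 1], where [ln (INR n)] is a genuine logarithm and
    [n!] is a value of [prodz 1]. *)
Lemma CL_eventually_S (u : nat -> C) l : CL eventually (fun m => u (S m)) l -> CL eventually u l.
Proof.
  intros H. apply CL_eps. intros eps He. destruct (proj1 (CL_eps _ _) H eps He) as [N HN].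
  exists (S N). intros n Hn. destruct n as [|n]; [lia|]. apply HN. lia.
Qed.

Lemma CL_stir_sum_S (z : C) : 0 < Re z -> 1 <= Cmod z -> CL eventually (fun m => stir_sum z (S m)) (stir_lim z).
Proof.
  intros Hz H1. apply (CL_comp (G := eventually) S (stir_sum z)); [|apply CL_stir_sum; assumption].
  intros P [N HN]. exists N. intros n Hn. apply HN. lia.
Qed.

Lemma stir_S_neq_0 w : stir_S w <> 0%C.
Proof. apply cexp_neq_0. Qed.

(** The telescoped product is applied twice, at [z] and at 1; the second application treats the
    factorial and produces [stir_const]. *)
Lemma CL_euler_gauss (z : C) : 0 < Re z -> 1 <= Cmod z ->
  CL eventually (euler_gauss z) (stir_const / (stir_S z * cexp (stir_lim z)))%C.
Proof.
  intros Hz H1. apply CL_eventually_S.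
  assert (HR1 : 0 < Re 1) by (simpl; lra). assert (HC1 : 1 <= Cmod 1) by (rewrite Cmod_1; lra).
  pose proof (stir_ratio z Hz) as HR. pose proof (CL_stir_sum_S z Hz H1) as HZ. pose proof (CL_stir_sum 1 HR1 HC1) as HO.
  assert (HL := CL_mult _ _ _ _ HR (CL_div _ _ _ _ (CL_mult _ _ _ _ (CL_const (F := eventually) (stir_S 1)) (CL_cexp _ _ HO))
     (CL_mult _ _ _ _ (CL_const (F := eventually) (stir_S z)) (CL_cexp _ _ HZ)) (Cmult_neq_0 _ _ (stir_S_neq_0 z) (cexp_neq_0 _)))).
  eapply CL_eq; [|unfold stir_const; apply Cmult_1_l]. revert HL. apply CL_ext.
  intros m. unfold euler_gauss. rewrite <- prodz_1.
  pose proof (prodz_stir z (S m) Hz) as E1. pose proof (prodz_stir 1 m HR1) as E2.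
  rewrite <- E1, <- E2.
  pose proof (stir_S_neq_0 z). pose proof (stir_S_neq_0 1). pose proof (cexp_neq_0 (stir_sum z (S m))). pose proof (cexp_neq_0 (stir_sum 1 m)).
  assert (prodz 1 m <> 0%C).
  { rewrite prodz_1. apply RtoC_neq. apply INR_fact_neq_0. }
  pose proof (cexp_neq_0 (z * ln (INR (S m)))).
  field. repeat split; assumption.
Qed.

Lemma rgamma_right (z : C) : 0 < Re z -> 1 <= Cmod z -> rgamma z = (stir_const / (stir_S z * cexp (stir_lim z)))%C.
Proof. intros Hz H1. apply clim_CL. apply CL_euler_gauss; assumption. Qed.

Lemma stir_const_neq_0 : stir_const <> 0%C.
Proof. unfold stir_const. apply Cmult_neq_0; [apply stir_S_neq_0 | apply cexp_neq_0]. Qed.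

(** Shifting the second product by one index pairs [k + w] with [k - w]; the unpaired ends are [w]
    and [n + 1 - w]. *)
Lemma prodz_reflect (w : C) n :
  (prodz w n * prodz (1 - w) n = w * (RtoC (INR (S n)) - w) * (RtoC (INR (fact n)) * RtoC (INR (fact n))) * sprod n w)%C.
Proof.
  induction n as [|n IH].
  - simpl. ring.
  - change (prodz w (S n)) with (prodz w n * (w + RtoC (INR (S n))))%C.
    change (prodz (1 - w) (S n)) with (prodz (1 - w) n * (1 - w + RtoC (INR (S n))))%C.
    change (sprod (S n) w) with (sprod n w * (1 - w * w / (RtoC (INR (S n)) * RtoC (INR (S n)))))%C.
    transitivity (prodz w n * prodz (1 - w) n * ((w + RtoC (INR (S n))) * (1 - w + RtoC (INR (S n)))))%C; [ring|].
    rewrite IH. change (fact (S n)) with (S n * fact n)%nat. rewrite mult_INR, RtoC_mult.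
    replace (RtoC (INR (S (S n)))) with (RtoC (INR (S n)) + 1)%C by (rewrite (S_INR (S n)), RtoC_plus; reflexivity).
    assert (RtoC (INR (S n)) <> 0%C) by (apply RtoC_neq; apply not_0_INR; lia).
    field. assumption.
Qed.

Lemma CL_div_cancel (a b : nat -> C) p q : CL eventually (fun n => a n * b n)%C p -> CL eventually b q -> q <> 0%C ->
  CL eventually a (p / q)%C.
Proof.
  intros H1 H2 Hq. apply (CL_ext_loc (fun n => a n * b n / b n)%C); [|apply CL_div; assumption].
  assert (Hq0 : 0 < Cmod q) by (apply Cmod_gt_0; exact Hq).
  generalize (proj1 (CL_eps _ _) H2 _ Hq0). apply filter_imp. intros n Hn.
  assert (b n <> 0%C).
  { intros E. rewrite E in Hn. replace (0 - q)%C with (- q)%C in Hn by ring. rewrite Cmod_opp in Hn. lra. }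
  field. assumption.
Qed.

(** The powers [n^w] and [n^(1-w)] multiply to [n], which cancels the unpaired end [n + 1 - w] in
    the limit. *)
Lemma euler_gauss_reflect (w : C) : w <> 0%C -> CL eventually (fun n => euler_gauss w n * euler_gauss (1 - w) n)%C (Sn w / (2 * (PI * Ci)))%C.
Proof.
  intros Hw. pose proof PI_RGT_0.
  assert (HP : RtoC PI <> 0%C) by (apply RtoC_neq; lra). pose proof Ci_nz as HCi.
  assert (HL : CL eventually (fun n => w * sprod n w * ((1 - w) / RtoC (INR n) + 1))%C (w * (Sn w / (2 * (PI * Ci * w))) * (0 + 1))%C).
  { apply CL_mult; [apply CL_mult; [apply CL_const | apply sine_product; exact Hw]|]. apply CL_plus; [|apply CL_const].
    apply CL_eventually_S. apply (CL_squeeze _ _ (fun m => Cmod (1 - w) / (INR m + 1))); [|apply filterlim_inv_INR].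
    apply filter_forall. intros m. pose proof (pos_INR m). rewrite S_INR.
    replace ((1 - w) / RtoC (INR m + 1) - 0)%C with ((1 - w) / RtoC (INR m + 1))%C by ring.
    rewrite Cmod_div, Cmod_R, Rabs_pos_eq by (lra || apply RtoC_neq; lra). lra. }
  eapply CL_eq; [|instantiate (1 := (w * (Sn w / (2 * (PI * Ci * w))) * (0 + 1))%C); field; repeat split; assumption].
  revert HL. apply CL_ext_loc. exists 1%nat. intros n Hn.
  assert (Hn0 : 0 < INR n) by (apply lt_0_INR; lia).
  unfold euler_gauss.
  transitivity (prodz w n * prodz (1 - w) n / (RtoC (INR (fact n)) * RtoC (INR (fact n)) * (cexp (w * ln (INR n)) * cexp ((1 - w) * ln (INR n)))))%C.
  - rewrite prodz_reflect. rewrite <- cexp_plus.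
    replace (w * ln (INR n) + (1 - w) * ln (INR n))%C with (RtoC (ln (INR n))) by ring.
    rewrite cexp_RtoC, exp_ln by exact Hn0. rewrite S_INR, RtoC_plus.
    field. split; apply RtoC_neq; (lra || apply INR_fact_neq_0).
  - field. repeat split; try apply cexp_neq_0. apply RtoC_neq. apply INR_fact_neq_0.
Qed.

(** Convergence at [w], which may lie in the left half-plane, is not known beforehand; it follows
    from that of the product and of the factor at [1 - w], whose limit is nonzero. *)
Lemma rgamma_reflect (w : C) : w <> 0%C -> 0 < Re (1 - w) -> 1 <= Cmod (1 - w) ->
  rgamma w = (Sn w / (2 * (PI * Ci)) / rgamma (1 - w))%C.
Proof.
  intros Hw H1 H2. apply clim_CL. apply (CL_div_cancel (euler_gauss w) (euler_gauss (1 - w))).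
  - apply euler_gauss_reflect. exact Hw.
  - rewrite rgamma_right by assumption. apply CL_euler_gauss; assumption.
  - rewrite rgamma_right by assumption. unfold Cdiv. apply Cmult_neq_0; [apply stir_const_neq_0|].
    apply Cmod_gt_0. rewrite Cmod_inv; [apply Rinv_0_lt_compat; apply Cmod_gt_0|]; apply Cmult_neq_0; try apply stir_S_neq_0; apply cexp_neq_0.
Qed.

Lemma atan_approx x : 0 <= x -> Rabs (atan x - x) <= x ^ 3.
Proof.
  intros Hx.
  assert (H := mean_value_C_const (fun t => RtoC (atan t - t)) (fun t => RtoC (/ (1 + Rsqr t) - 1)) (x ^ 2) 0 x Hx).
  cbv beta in H. rewrite atan_0, <- RtoC_minus, Cmod_R in H. replace (atan x - x - (0 - 0)) with (atan x - x) in H by ring.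
  replace (x ^ 3) with (x ^ 2 * (x - 0)) by ring. apply H.
  - intros t _. apply Cder_RtoC. apply (is_derive_minus (K := R_AbsRing) (V := R_NormedModule)); [apply is_derive_atan | apply @is_derive_id].
  - intros t Ht. rewrite Cmod_R. unfold Rsqr. replace (/ (1 + t * t) - 1) with (- (t * t) * / (1 + t * t)) by (field; nra).
    assert (0 < / (1 + t * t) <= 1) by (split; [apply Rinv_0_lt_compat; nra | rewrite <- Rinv_1; apply Rinv_le_contravar; nra]).
    apply Rabs_le. nra.
Qed.

(* Comparing the reflection formula with the Stirling form on the line Re w = 1/2, as Im w -> +oo, identifies the constant. *)
Lemma stir_const_sq : (stir_const * stir_const = RtoC (/ (2 * PI)))%C.
Proof.
  pose proof PI_RGT_0 as HPI.
  assert (HP : RtoC PI <> 0%C) by (apply RtoC_neq; lra). pose proof Ci_nz as HCi.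
  set (wn := fun m : nat => (1 / 2, INR m + 1) : C). set (wc := fun m : nat => (1 / 2, - (INR m + 1)) : C).
  (* With [y = m + 1], [th] is the exponent that remains in [stir_S w * stir_S (1 - w)] besides
     [- pi y]; it tends to 0 because [atan x] is close to [x]. *)
  set (th := fun m : nat => 2 * (INR m + 1) * atan (/ (2 * (INR m + 1))) - 1).
  set (E := fun m : nat => (RtoC (th m) + (stir_lim (wn m) + stir_lim (wc m)))%C).
  assert (Hwn : forall m, 0 < Re (wn m) /\ 1 <= Cmod (wn m) /\ INR m + 1 <= Cmod (wn m)).
  { intros m. pose proof (pos_INR m). assert (INR m + 1 <= Cmod (wn m)).
    { pose proof (Im_le_Cmod (wn m)). simpl in H0. rewrite Rabs_pos_eq in H0 by lra. exact H0. }
    simpl. repeat split; lra. }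
  assert (Hwc : forall m, 0 < Re (wc m) /\ 1 <= Cmod (wc m) /\ INR m + 1 <= Cmod (wc m)).
  { intros m. pose proof (pos_INR m). assert (INR m + 1 <= Cmod (wc m)).
    { pose proof (Im_le_Cmod (wc m)). simpl in H0. rewrite Rabs_Ropp, Rabs_pos_eq in H0 by lra. exact H0. }
    simpl. repeat split; lra. }
  assert (HE : CL eventually E 0%C).
  { apply (CL_squeeze _ _ (fun m => 17 / (INR m + 1))); [|apply filterlim_inv_INR].
    apply filter_forall. intros m. pose proof (pos_INR m) as Hm.
    destruct (Hwn m) as [A1 [A2 A3]]. destruct (Hwc m) as [B1 [B2 B3]].
    pose proof (stir_lim_bound _ A1 A2). pose proof (stir_lim_bound _ B1 B2).
    set (y := INR m + 1) in *. assert (Hy : 1 <= y) by (unfold y; lra).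
    assert (HI : forall M, y <= M -> 8 / M <= 8 / y) by (intros M HM; unfold Rdiv; apply Rmult_le_compat_l; [lra | apply Rinv_le_contravar; lra]).
    pose proof (HI _ A3). pose proof (HI _ B3).
    assert (Hth : Rabs (th m) <= 1 / y).
    { unfold th. fold y. set (x := / (2 * y)). assert (Hx0 : 0 < x) by (apply Rinv_0_lt_compat; lra).
      pose proof (atan_approx x ltac:(lra)) as HA.
      replace (2 * y * atan x - 1) with (2 * y * (atan x - x)) by (unfold x; field; lra).
      rewrite Rabs_mult, (Rabs_pos_eq (2 * y)) by lra.
      apply Rle_trans with (2 * y * x ^ 3); [apply Rmult_le_compat_l; lra|].
      replace (2 * y * x ^ 3) with (1 / y * (/ (4 * y))) by (unfold x; field; lra).
      assert (/ (4 * y) <= 1) by (rewrite <- Rinv_1; apply Rinv_le_contravar; lra).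
      assert (0 < 1 / y) by (apply Rdiv_lt_0_compat; lra). nra. }
    unfold E. replace (th m + (stir_lim (wn m) + stir_lim (wc m)) - 0)%C with (th m + (stir_lim (wn m) + stir_lim (wc m)))%C by ring.
    eapply Rle_trans; [apply Cmod_triangle|]. eapply Rle_trans; [apply Rplus_le_compat_l; apply Cmod_triangle|].
    rewrite Cmod_R. unfold Rdiv in *. lra. }
  assert (Hexp : CL eventually (fun m => RtoC (exp (- (2 * PI * (INR m + 1))))) 0%C).
  { apply (CL_squeeze _ _ (fun m => 1 / (INR m + 1))); [|apply filterlim_inv_INR].
    apply filter_forall. intros m. pose proof (pos_INR m) as Hm.
    replace (RtoC (exp (- (2 * PI * (INR m + 1)))) - 0)%C with (RtoC (exp (- (2 * PI * (INR m + 1))))) by ring.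
    rewrite Cmod_R, Rabs_pos_eq by (left; apply exp_pos). pose proof PI2_1 as HP1. unfold PI2 in HP1.
    eapply Rle_trans; [apply exp_neg_le; nra|]. unfold Rdiv. rewrite Rmult_1_l. apply Rinv_le_contravar; nra. }
  assert (HL : CL eventually (fun m => cexp (E m) * ((1 + RtoC (exp (- (2 * PI * (INR m + 1))))) * RtoC (/ (2 * PI))))%C
     (cexp 0 * ((1 + 0) * RtoC (/ (2 * PI))))%C).
  { apply CL_mult; [apply CL_cexp; exact HE|]. apply CL_mult; [|apply CL_const]. apply CL_plus; [apply CL_const | exact Hexp]. }
  (* The constant sequence is shown to equal, term by term, a sequence whose limit is
     [1 / (2 pi)]. *)
  apply (CL_unique (F := eventually) (fun _ => stir_const * stir_const)%C); [apply CL_const|].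
  eapply CL_eq; [|instantiate (1 := (cexp 0 * ((1 + 0) * RtoC (/ (2 * PI))))%C); rewrite cexp_0; ring].
  revert HL. apply CL_ext. intros m. pose proof (pos_INR m) as Hm.
  destruct (Hwn m) as [A1 [A2 _]]. destruct (Hwc m) as [B1 [B2 _]].
  assert (E1 : (1 - wn m)%C = wc m) by (apply C_eq; simpl; lra).
  pose proof (rgamma_reflect (wn m) (Re_pos_neq_0 _ A1)) as HR. rewrite E1 in HR. specialize (HR B1 B2).
  rewrite (rgamma_right (wn m)), (rgamma_right (wc m)) in HR by assumption.
  set (y := INR m + 1) in *.
  assert (HS : Sn (wn m) = (Ci * RtoC (exp (- (PI * y)) + exp (PI * y)))%C).
  { assert (Hp : (- (PI * Ci * wn m))%C = ((PI * y)%R, (- (PI / 2))%R)) by (apply C_eq; simpl; unfold y; field).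
    assert (Hq : (PI * Ci * wn m)%C = ((- (PI * y))%R, (PI / 2)%R)) by (apply C_eq; simpl; unfold y; field).
    unfold Sn. rewrite Hp, Hq.
    unfold cexp, Re, Im; simpl fst; simpl snd. rewrite cos_neg, sin_neg, cos_PI2, sin_PI2. apply C_eq; simpl; ring. }
  assert (HSS : (stir_S (wn m) * stir_S (wc m) = RtoC (exp (- (PI * y) + th m)))%C).
  { unfold stir_S. rewrite <- cexp_plus, <- cexp_RtoC. f_equal. unfold clog.
    rewrite (carg_Im_pos (wn m)) by (simpl; lra). rewrite (carg_Im_neg (wc m)) by (simpl; lra).
    replace (Cmod (wc m)) with (Cmod (wn m)).
    2:{ unfold Cmod; simpl. f_equal. ring. }
    replace (Re (wn m) / Im (wn m)) with (/ (2 * y)) by (simpl; unfold y; field; lra).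
    replace (Re (wc m) / Im (wc m)) with (- / (2 * y)) by (simpl; unfold y; field; lra).
    rewrite atan_opp. unfold th. fold y. set (l := ln (Cmod (wn m))). set (a := atan (/ (2 * y))).
    unfold wn, wc. fold y. apply C_eq; simpl; field. }
  pose proof (stir_S_neq_0 (wn m)) as N1. pose proof (stir_S_neq_0 (wc m)) as N2.
  pose proof (cexp_neq_0 (stir_lim (wn m))) as N3. pose proof (cexp_neq_0 (stir_lim (wc m))) as N4. pose proof stir_const_neq_0 as N5.
  transitivity (Sn (wn m) / (2 * (PI * Ci)) * (stir_S (wn m) * stir_S (wc m)) * (cexp (stir_lim (wn m)) * cexp (stir_lim (wc m))))%C.
  - rewrite HS, HSS. unfold E. rewrite !cexp_plus, cexp_RtoC.
    replace (exp (- (2 * PI * y))) with (exp (- (PI * y)) * exp (- (PI * y))) by (rewrite <- exp_plus; f_equal; ring).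
    rewrite exp_plus.
    assert (HE1 : exp (PI * y) = / exp (- (PI * y))) by (rewrite exp_Ropp, Rinv_inv; reflexivity).
    rewrite HE1. pose proof (exp_pos (- (PI * y))) as HE0. set (X := exp (- (PI * y))) in *.
    assert (RtoC X <> 0%C) by (apply RtoC_neq; lra).
    rewrite !RtoC_mult, RtoC_plus, !RtoC_inv, RtoC_mult by lra. field. repeat split; assumption.
  - symmetry. transitivity (stir_const / (stir_S (wn m) * cexp (stir_lim (wn m))) * (stir_const * (stir_S (wn m) * cexp (stir_lim (wn m)))))%C.
    + field. split; assumption.
    + rewrite HR. field. repeat split; assumption.
Qed.

(** In the product the Stirling constant appears squared, so its sign never matters. The bound is
    [17 = 8 + 8 + 1]: two Stirling errors and the error [delta] of replacing [log (z + 1/2)] by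
    [log z]. *)
Lemma gamma_product (z : C) : 0 < Re z -> 1 <= Cmod z -> exists theta,
  Cmod theta <= 17 / Cmod z /\ (/ rgamma z * / rgamma (z + (1 / 2)%R) = 2 * PI * cexp ((2 * z - (1 / 2)%R) * clog z - 2 * z) * cexp theta)%C.
Proof.
  intros Hz H1. pose proof PI_RGT_0 as HPI.
  assert (HP : RtoC PI <> 0%C) by (apply RtoC_neq; lra).
  set (z' := (z + (1 / 2)%R)%C).
  assert (Hz' : 0 < Re z') by (change (0 < Re z + 1 / 2); lra).
  assert (HC : Cmod z <= Cmod z').
  { assert (Cmod z ^ 2 <= Cmod z' ^ 2).
    { rewrite !Cmod2_alt. unfold z', Re, Im in *; simpl in *. nra. }
    pose proof (Cmod_ge_0 z'). nra. }
  assert (H1' : 1 <= Cmod z') by lra.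
  pose proof (Re_pos_neq_0 z Hz) as N.
  set (u := (/ (2 * z))%C).
  assert (Hu : 0 < Re u).
  { apply Re_inv_pos. replace (Re (2 * z)) with (2 * Re z) by (unfold Re; simpl; ring). lra. }
  assert (Mu : Cmod u = / (2 * Cmod z)).
  { unfold u. rewrite Cmod_inv, Cmod_mult, Cmod_R, Rabs_pos_eq by (lra || (apply Cmult_neq_0; [apply RtoC_neq; lra | exact N])). reflexivity. }
  (* Since [z u = 1/2], the first-order part of [z log (1 + 1/(2z))] cancels the extra [1/2] in the
     second Stirling exponent. *)
  set (delta := (z * (clog (1 + u) - u))%C).
  assert (Hd : Cmod delta <= 1 / Cmod z).
  { unfold delta. rewrite Cmod_mult. pose proof (clog_1_plus_1 u ltac:(lra)) as HL. rewrite Mu in HL.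
    apply Rle_trans with (Cmod z * (/ (2 * Cmod z)) ^ 2); [apply Rmult_le_compat_l; lra|].
    replace (Cmod z * (/ (2 * Cmod z)) ^ 2) with (1 / 4 * / Cmod z) by (field; lra).
    assert (0 < / Cmod z) by (apply Rinv_0_lt_compat; lra). lra. }
  exists (delta + (stir_lim z + stir_lim z'))%C. split.
  - eapply Rle_trans; [apply Cmod_triangle|]. eapply Rle_trans; [apply Rplus_le_compat_l; apply Cmod_triangle|].
    pose proof (stir_lim_bound z Hz H1). pose proof (stir_lim_bound z' Hz' H1').
    assert (8 / Cmod z' <= 8 / Cmod z) by (unfold Rdiv; apply Rmult_le_compat_l; [lra | apply Rinv_le_contravar; lra]).
    unfold Rdiv in *. lra.
  - rewrite (rgamma_right z), (rgamma_right z') by assumption.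
    assert (HSS : (stir_S z * stir_S z' = cexp ((2 * z - (1 / 2)%R) * clog z - 2 * z) * cexp delta)%C).
    { unfold stir_S. rewrite <- !cexp_plus. f_equal.
      replace (clog z') with (clog z + clog (1 + u))%C.
      - unfold delta. replace (z * (clog (1 + u) - u))%C with (z * clog (1 + u) - 1 / 2)%C by (unfold u; field; exact N).
        unfold z'. rewrite RtoC_div by lra. field.
      - rewrite <- clog_mult_Re_pos; [| exact Hz | change (0 < 1 + Re u); lra].
        f_equal. unfold u, z'. rewrite RtoC_div by lra. field. exact N. }
    pose proof (stir_S_neq_0 z) as N1. pose proof (stir_S_neq_0 z') as N2.
    pose proof (cexp_neq_0 (stir_lim z)) as N3. pose proof (cexp_neq_0 (stir_lim z')) as N4. pose proof stir_const_neq_0 as N5.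
    transitivity (/ (stir_const * stir_const) * (stir_S z * stir_S z') * (cexp (stir_lim z) * cexp (stir_lim z')))%C.
    + field. repeat split; assumption.
    + rewrite stir_const_sq, HSS, !cexp_plus. rewrite RtoC_inv, RtoC_mult by lra. field. repeat split; try assumption; apply RtoC_neq; lra.
Qed.

(** After reflection of [s/2] the two Gamma values sit at [z = (1 - s)/2] and [z + 1/2]; halving
    [1 - s] doubles 17 to 34. *)
Lemma chi_formula (s : C) : Re s <= -4 -> exists theta,
  Cmod theta <= 34 / Cmod (1 - s) /\ chi s = (cpow PI (s - (/ 2)%R) * (Sn (s / 2) / Ci) * cexp ((/ 2 - s) * clog ((1 - s) / 2) - (1 - s)) * cexp theta)%C.
Proof.
  intros Hs0. pose proof PI_RGT_0 as HPI.
  assert (HP : RtoC PI <> 0%C) by (apply RtoC_neq; lra). pose proof Ci_nz as HCi.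
  set (z := ((1 - s) / 2)%C).
  assert (Hz : 5 / 2 <= Re z) by (unfold z; rewrite Re_div_R by lra; change (5 / 2 <= (1 + - Re s) / 2); lra).
  assert (H1 : 1 <= Cmod z) by (pose proof (re_le_Cmod z); pose proof (Rle_abs (Re z)); lra).
  destruct (gamma_product z ltac:(lra) H1) as [theta [Ht HG]]. exists theta.
  assert (Mz : Cmod z = Cmod (1 - s) / 2) by (unfold z; rewrite Cmod_div, Cmod_R, Rabs_pos_eq by (lra || apply RtoC_neq; lra); reflexivity).
  split.
  - rewrite Mz in Ht. rewrite Mz in H1. replace (34 / Cmod (1 - s)) with (17 / (Cmod (1 - s) / 2)) by (field; lra). exact Ht.
  - unfold chi. change (Cdiv (Cminus 1%C s) (RtoC 2)) with z. unfold cgamma.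
    set (w := (s / 2)%C).
    assert (E1 : (1 - w)%C = (z + (1 / 2)%R)%C) by (unfold w, z; rewrite RtoC_div by lra; field).
    assert (Hw : w <> 0%C).
    { intros E. assert (Re w = Re 0) by (rewrite E; reflexivity). unfold w in H. rewrite Re_div_R in H by lra. simpl in H. unfold Re in *. lra. }
    rewrite (rgamma_reflect w Hw); rewrite E1.
    + transitivity (cpow PI (s - (/ 2)%R) * (Sn w / (2 * (PI * Ci))) * (/ rgamma z * / rgamma (z + (1 / 2)%R)))%C.
      * unfold Cdiv. ring.
      * rewrite HG. replace (2 * z - (1 / 2)%R)%C with (/ 2 - s)%C by (unfold z; rewrite RtoC_div by lra; field).
        replace (2 * z)%C with (1 - s)%C by (unfold z; field).
        field. split; assumption.
    + change (0 < Re z + 1 / 2). lra.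
    + assert (H := re_le_Cmod (z + (1 / 2)%R)). pose proof (Rle_abs (Re (z + (1 / 2)%R))).
      change (Re (z + (1 / 2)%R)) with (Re z + 1 / 2) in *. lra.
Qed.

(** * The asymptotic formula *)


(** For [Re s < 1] the radicand is in the upper half-plane, so its principal root has argument
    between 0 and [pi/2]; the test in [eta] keeps it, and [eta] lies in the open first quadrant. *)
Lemma eta_spec (s : C) : 0 < 1 - Re s ->
  let v := ((s - 1) / (RtoC (2 * PI) * Ci))%C in
  clog (eta s) = (RtoC (/ 2) * clog v)%C /\ (eta s * eta s)%C = v /\ Lam (eta s) = (1 - s)%C /\
  0 < Im v /\ 0 < Re (eta s) /\ 0 < Im (eta s).
Proof.
  intros Hs v. pose proof PI_RGT_0 as HPI.
  assert (HP : RtoC PI <> 0%C) by (apply RtoC_neq; lra). pose proof Ci_nz as HCi.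
  assert (HP2 : RtoC (2 * PI) <> 0%C) by (apply RtoC_neq; lra).
  assert (Hv : 0 < Im v).
  { replace v with ((Im s / (2 * PI))%R, ((1 - Re s) / (2 * PI))%R).
    - simpl. apply Rdiv_lt_0_compat; lra.
    - unfold v. apply C_eq; simpl; unfold Re, Im; field; lra. }
  pose proof (carg_Im_pos_bound v Hv) as Ha.
  assert (Nv : v <> 0%C) by (apply slit_neq_0; right; lra).
  set (l := (RtoC (/ 2) * clog v)%C).
  assert (HIl : Im l = carg v / 2) by (unfold l, Im; simpl; change (snd (clog v)) with (carg v); field).
  assert (Hw : csqrt v = cexp l) by (unfold csqrt; rewrite cpow_cexp by exact Nv; reflexivity).
  assert (Hl : clog (cexp l) = l) by (apply clog_cexp; lra).
  assert (He : eta s = cexp l).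
  { unfold eta. change (Cdiv (Cminus s 1%C) (Cmult (RtoC (2 * PI)) Ci)) with v. rewrite Hw.
    change (carg (cexp l)) with (Im (clog (cexp l))). rewrite Hl, HIl.
    destruct (Rlt_dec (- (PI / 4)) (carg v / 2)); [reflexivity | lra]. }
  assert (Hsq : (eta s * eta s)%C = v).
  { rewrite He, <- cexp_plus. transitivity (cexp (clog v)); [|apply cexp_clog; exact Nv].
    f_equal. unfold l. rewrite RtoC_inv by lra. field. }
  split; [rewrite He; exact Hl|]. split; [exact Hsq|]. split.
  - unfold Lam. rewrite Hsq. unfold v. rewrite RtoC_mult. field. split; assumption.
  - split; [exact Hv|]. rewrite He.
    change (0 < exp (Re l) * cos (Im l) /\ 0 < exp (Re l) * sin (Im l)). rewrite HIl.
    split; apply Rmult_lt_0_compat; try apply exp_pos; [apply cos_gt_0 | apply sin_gt_0]; lra.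
Qed.

Lemma Ci_sq : (Ci * Ci)%C = (- RtoC 1)%C.
Proof. apply C_eq; simpl; ring. Qed.

Lemma cexp_i_half_PI : cexp (PI * Ci / 2) = Ci.
Proof.
  replace (PI * Ci / 2)%C with ((0, (PI / 2)%R) : C) by (apply C_eq; simpl; field).
  unfold cexp, Re, Im; simpl fst; simpl snd. rewrite exp_0, cos_PI2, sin_PI2. apply C_eq; simpl; ring.
Qed.

(** [(1 - s)/2 = pi e^(-pi i/2) eta^2]; since [arg (eta^2)] is in the open interval from 0 to [pi],
    the logarithms add without a multiple of [2 pi i]. *)
Lemma clog_half_Lam (s : C) : 0 < 1 - Re s ->
  clog ((1 - s) / 2) = (RtoC (ln PI) - PI * Ci / 2 + 2 * clog (eta s))%C.
Proof.
  intros Hs. destruct (eta_spec s Hs) as [H1 [H2 [H3 [H4 _]]]]. pose proof PI_RGT_0 as HPI.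
  assert (HP : RtoC PI <> 0%C) by (apply RtoC_neq; lra). pose proof Ci_nz as HCi.
  set (v := ((s - 1) / (RtoC (2 * PI) * Ci))%C) in *.
  assert (Nv : v <> 0%C) by (apply slit_neq_0; right; lra).
  assert (E : (2 * clog (eta s))%C = clog v) by (rewrite H1, RtoC_inv by lra; field).
  rewrite E. pose proof (carg_Im_pos_bound v H4).
  apply clog_unique.
  - rewrite cexp_plus, cexp_minus, cexp_clog, cexp_RtoC, exp_ln by (lra || assumption).
    rewrite cexp_i_half_PI. unfold v. rewrite RtoC_mult.
    transitivity ((s - 1) / (2 * (Ci * Ci)))%C; [rewrite Ci_sq; field|].
    field. split; assumption.
  - replace (Im (RtoC (ln PI) - PI * Ci / 2 + clog v)) with (carg v - PI / 2).
    + lra.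
    + unfold Im; simpl. change (snd (clog v)) with (carg v). field.
Qed.

Lemma omega_cexp : (- omega)%C = (Ci * cexp (- (PI * Ci / 4)))%C.
Proof.
  assert (E : omega = (- (cexp (PI * Ci / 2) * cexp (- (PI * Ci / 4))))%C).
  { rewrite <- cexp_plus. unfold omega.
    replace (- cexp (PI * Ci / 2 + - (PI * Ci / 4)))%C with (cexp (PI * Ci / 2 + - (PI * Ci / 4) - PI * Ci)).
    - f_equal. apply C_eq; simpl; field.
    - rewrite cexp_minus. replace (cexp (PI * Ci)) with (- RtoC 1)%C; [field; intros E; apply (RtoC_neq (-1) 0 ltac:(lra)); rewrite <- E; rewrite RtoC_opp; ring|].
      replace (PI * Ci)%C with (PI * Ci / 2 + PI * Ci / 2)%C by field. rewrite cexp_plus, cexp_i_half_PI, Ci_sq. reflexivity. }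
  rewrite E, cexp_i_half_PI. ring.
Qed.

(** The common form of both sides. Each is [lead s] times [1 + O(1/|eta|)], a multiplicative
    statement that survives at the zeros of [1 - e^(pi i s)]. *)
Definition lead (s : C) : C :=
  ((1 - cexp (PI * Ci * s)) * (- omega) * c8 / RtoC (sqrt 2) * cexp (- s * clog (eta s) + PI * Ci * (eta s + eta s * eta s)))%C.

(** Substituting [clog_half_Lam] cancels the powers of [pi] and the factor [e^(-pi i s/2)] of the
    sine, so only [1 - e^(pi i s)] and powers of [eta] remain. *)
Lemma chi_Riemann (s : C) : Re s <= -4 -> exists theta, Cmod theta <= 34 / Cmod (1 - s) /\
  chi s = ((1 - cexp (PI * Ci * s)) * (- omega) * cexp ((1 - 2 * s) * clog (eta s) - (1 - s)) * cexp theta)%C.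
Proof.
  intros Hs. destruct (chi_formula s Hs) as [theta [Ht HX]]. exists theta. split; [exact Ht|].
  rewrite HX. f_equal. pose proof PI_RGT_0 as HPI.
  assert (HP : RtoC PI <> 0%C) by (apply RtoC_neq; lra). pose proof Ci_nz as HCi.
  rewrite cpow_cexp, clog_RtoC by (lra || assumption). rewrite clog_half_Lam by lra.
  assert (HS : Sn (s / 2) = (- (cexp (- (PI * Ci * s / 2)) * (1 - cexp (PI * Ci * s))))%C).
  { unfold Sn. replace (PI * Ci * (s / 2))%C with (PI * Ci * s / 2)%C by field.
    replace (PI * Ci * s)%C with (PI * Ci * s / 2 + PI * Ci * s / 2)%C at 4 by field.
    rewrite cexp_plus, cexp_opp. field. apply cexp_neq_0. }
  rewrite HS, omega_cexp.
  transitivity ((1 - cexp (PI * Ci * s)) * (- (RtoC 1) / Ci) * (cexp ((s - (/ 2)%R) * ln PI) * cexp (- (PI * Ci * s / 2)) *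
    cexp ((/ 2 - s) * (ln PI - PI * Ci / 2 + 2 * clog (eta s)) - (1 - s))))%C; [field; exact HCi|].
  transitivity ((1 - cexp (PI * Ci * s)) * Ci * (cexp (- (PI * Ci / 4)) * cexp ((1 - 2 * s) * clog (eta s) - (1 - s))))%C; [|ring].
  f_equal.
  - f_equal. rewrite <- Ci_sq. field. exact HCi.
  - rewrite <- !cexp_plus. f_equal. rewrite RtoC_inv by lra. field.
Qed.

(** The powers of [eta] add up to [-s], and [1 - s = - 2 pi i eta^2] turns
    [e^(-(1-s)) e^(-pi i eta^2)] into [e^(pi i eta^2)]. *)
Lemma mainterm_lead (s : C) : Re s <= -4 -> exists theta, Cmod theta <= 34 / Cmod (1 - s) /\
  mainterm s = (lead s * cexp theta)%C.
Proof.
  intros Hs. destruct (chi_Riemann s Hs) as [theta [Ht HX]]. exists theta. split; [exact Ht|].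
  destruct (eta_spec s ltac:(lra)) as [H1 [H2 [H3 [H4 [H5 H6]]]]].
  assert (Neta : eta s <> 0%C) by (apply slit_neq_0; right; lra).
  unfold mainterm, lead. rewrite HX, cpow_cexp by exact Neta.
  replace (cexp (0, - (PI / 8))) with c8 by (unfold c8; f_equal; apply C_eq; simpl; field).
  pose proof Rlt_sqrt2_0. assert (N2 : RtoC (sqrt 2) <> 0%C) by (apply RtoC_neq; lra).
  transitivity ((1 - cexp (PI * Ci * s)) * - omega * c8 / sqrt 2 * (cexp ((1 - 2 * s) * clog (eta s) - (1 - s)) *
    cexp ((s - 1) * clog (eta s)) * cexp (PI * Ci * (eta s - eta s * eta s))) * cexp theta)%C; [field; exact N2|].
  f_equal. f_equal. rewrite <- !cexp_plus. f_equal. rewrite <- H3. unfold Lam. ring.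
Qed.

(** The error of [laplace_limit] is [O(N^-2)] while its main term has modulus [1/(N sqrt 2)], so the
    relative error is [O(1/N)]. *)
Lemma RiemannR_lead c (s : C) kap : 0 < c < 1 -> 0 < kap <= 1 / 2 -> in_sector kap (eta s) -> 1 <= Cmod (eta s) ->
  1 <= PI * kap * Cmod (eta s) -> 5 <= 1 - Re s -> exists delta,
  Cmod delta <= (40 + / kap) * poly_gauss_const kap * PI * 2 / Cmod (eta s) /\
  RiemannR c s = (lead s * (1 + delta))%C.
Proof.
  intros Hc Hk Hsec HN HkN HX.
  destruct (eta_spec s ltac:(lra)) as [H1 [H2 [H3 [H4 [H5 H6]]]]].
  set (e := eta s) in *. set (N := Cmod e) in *.
  assert (Neta : e <> 0%C) by (apply slit_neq_0; right; lra).
  assert (NN : RtoC N <> 0%C) by (apply RtoC_neq; lra).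
  assert (Es : s = (1 - Lam e)%C) by (rewrite H3; ring).
  assert (HRL : Re (Lam e) = 1 - Re s) by (rewrite H3; unfold Re; simpl; ring).
  destruct Hsec as [S1 S2]. fold N in S1, S2.
  assert (He1 : Cmod (e / N) = 1).
  { rewrite Cmod_div, Cmod_R, Rabs_pos_eq by (lra || assumption). fold N. field. lra. }
  destruct (RiemannR_ray s c (e / N)%C kap Hc ltac:(lra) He1 Hk) as [L [HL HR]].
  - rewrite Re_div_R by lra. apply (Rmult_le_reg_r N); [lra|]. replace (Re e / N * N) with (Re e) by (field; lra). exact S1.
  - replace (Im (e / N)) with (Im e / N) by (unfold Im; simpl; field; lra).
    apply (Rmult_le_reg_r N); [lra|]. replace (Im e / N * N) with (Im e) by (field; lra). exact S2.
  - assert (HL' : CL (Rbar_locally p_infty) (fun r : R => ray_prim (Rintegrand (1 - Lam e)) (r * (e / Cmod e)))%C L).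
    { rewrite <- Es. exact HL. }
    assert (HB := laplace_limit kap e L Hk (conj S1 S2) HN HkN ltac:(lra) HL'). fold N in HB.
    pose proof Rlt_sqrt2_0 as Hs2. assert (N2 : RtoC (sqrt 2) <> 0%C) by (apply RtoC_neq; lra).
    assert (N8 : c8 <> 0%C) by apply cexp_neq_0. pose proof omega_neq_0 as NO. pose proof (ray_factor_neq_0 e) as NC.
    set (eps := (L / ray_factor e - c8 / e * (- omega / sqrt 2))%C) in *.
    assert (M8 : Cmod c8 = 1).
    { unfold c8. rewrite Cmod_cexp. replace (Re (- (PI * Ci / 8))) with 0 by (simpl; field). apply exp_0. }
    (* The error divided by the Gaussian main term [c8 / e * (- omega / sqrt 2)]; bounding [sqrt 2]
       by 2 gives the last factor of the constant. *)
    exists (eps * (e * sqrt 2 / (c8 * - omega)))%C. split.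
    + assert (NO' : (- omega)%C <> 0%C) by (apply Cmod_gt_0; rewrite Cmod_opp, Cmod_omega; lra).
      rewrite Cmod_mult, Cmod_div, !Cmod_mult, M8, Cmod_opp, Cmod_omega, Cmod_R, Rabs_pos_eq by (lra || (apply Cmult_neq_0; assumption)).
      fold N.
      set (K := (40 + / kap) * poly_gauss_const kap * PI) in *.
      assert (Hs3 : sqrt 2 <= 2) by (pose proof (sqrt_sqrt 2 ltac:(lra)); nra).
      apply Rle_trans with (K / N ^ 2 * (N * 2)); [|right; field; lra].
      apply Rmult_le_compat; [apply Cmod_ge_0 | | exact HB |].
      * apply Rmult_le_pos; [apply Rmult_le_pos; lra | rewrite Rmult_1_l, Rinv_1; lra].
      * replace (N * sqrt 2 / (1 * 1)) with (N * sqrt 2) by field. apply Rmult_le_compat_l; lra.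
    + rewrite HR. unfold lead. fold e.
      assert (EL : L = (ray_factor e * (c8 / e * (- omega / sqrt 2) + eps))%C) by (unfold eps; field; repeat split; assumption).
      rewrite EL.
      assert (EC : (ray_factor e / e = - cexp (- s * clog e + PI * Ci * (e + e * e)))%C).
      { unfold ray_factor. transitivity (- (cexp (Lam e * clog e - Lam e / 2 + PI * Ci * e) * cexp (- clog e)))%C.
        - rewrite cexp_opp, cexp_clog by exact Neta. field. exact Neta.
        - rewrite <- cexp_plus. f_equal. f_equal.
          replace (- s * clog e)%C with (- (1 - Lam e) * clog e)%C by (rewrite <- Es; reflexivity). unfold Lam. field. }
      transitivity (- (1 - cexp (PI * Ci * s)) * (ray_factor e / e) * (c8 * (- omega / sqrt 2) + e * eps))%C; [field; split; assumption|].
      rewrite EC. field. repeat split; assumption.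
Qed.

Theorem mainTheorem7 :
  forall alpha : R, 0 < alpha < PI / 4 ->
  forall c : R, 0 < c < 1 ->
  exists K M : R, forall s : C, G_alpha alpha s -> M <= Cmod s ->
    Cmod (Cminus (RiemannR c s) (mainterm s)) <= K * Cmod (mainterm s) / Cmod (eta s).
Proof.
  intros alpha Ha c Hc. pose proof PI_RGT_0 as HPI. pose proof PI_4 as HPI4. pose proof PI2_1 as HP1. unfold PI2 in HP1.
  set (T := tan (2 * alpha)). assert (HT : 0 < T) by (apply tan_gt_0; lra).
  (* From [T |Im s| <= 1 - Re s] follows [|1 - s| <= (1 - Re s)(1 + 1/T)], that is
     [Re Lam >= k0 |Lam|]. Halving [k0] passes from the product [Re eta * Im eta] to its factors. *)
  set (k0 := T / (1 + T)). set (kap := k0 / 2).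
  assert (Hk0 : 0 < k0) by (apply Rdiv_lt_0_compat; lra).
  assert (Hk1 : k0 <= 1).
  { apply (Rmult_le_reg_r (1 + T)); [lra|]. replace (k0 * (1 + T)) with T by (unfold k0; field; lra). lra. }
  assert (Hkap : 0 < kap <= 1 / 2) by (unfold kap; lra).
  set (K := (40 + / kap) * poly_gauss_const kap * PI * 2).
  (* In [K], [102 = 34 * 3] bounds [N |theta| e^|theta|] and the outer 3 is the inverse of a lower
     bound for [|e^theta|]. In [M], [5/k0] ensures [Re s <= -4], [8/kap^2] gives [N >= 1/kap], 34
     makes [|theta| <= 1], and the leading 1 pays for passing from [s] to [1 - s]. *)
  exists (3 * (K + 102)), (1 + (5 / k0 + 8 / kap ^ 2 + 34)). intros s HG HM.
  unfold G_alpha in HG. fold T in HG.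
  assert (Hi5 : 0 < 5 / k0) by (apply Rdiv_lt_0_compat; lra).
  assert (Hi8 : 32 <= 8 / kap ^ 2).
  { apply (Rmult_le_reg_r (kap ^ 2)); [nra|]. replace (8 / kap ^ 2 * kap ^ 2) with 8 by (field; lra). nra. }
  set (Y := Cmod (1 - s)).
  assert (HY : 5 / k0 + 8 / kap ^ 2 + 34 <= Y).
  { unfold Y. rewrite Cmod_minus_sym. pose proof (Cmod_sub_ge s 1). rewrite Cmod_1 in H. lra. }
  assert (HX0 : 0 <= 1 - Re s).
  { eapply Rle_trans; [|exact HG]. apply Rmult_le_pos; [apply Rabs_pos | lra]. }
  assert (HXY : k0 * Y <= 1 - Re s).
  { assert (Y <= (1 - Re s) + Rabs (Im s)).
    { unfold Y. eapply Rle_trans; [apply Cmod_le_sum|].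
      replace (Re (1 - s)) with (1 - Re s) by (unfold Re; simpl; ring). replace (Im (1 - s)) with (- Im s) by (unfold Im; simpl; ring).
      rewrite Rabs_Ropp, Rabs_pos_eq by exact HX0. lra. }
    apply (Rmult_le_reg_r (1 + T)); [lra|]. replace (k0 * Y * (1 + T)) with (T * Y) by (unfold k0; field; lra). nra. }
  assert (HX5 : 5 <= 1 - Re s).
  { eapply Rle_trans; [|exact HXY]. replace 5 with (k0 * (5 / k0)) by (field; lra). apply Rmult_le_compat_l; lra. }
  destruct (eta_spec s ltac:(lra)) as [H1 [H2 [H3 [H4 [H5 H6]]]]].
  set (N := Cmod (eta s)) in *. assert (HN0 : 0 <= N) by apply Cmod_ge_0.
  assert (HYN : Y = 2 * PI * N ^ 2) by (unfold Y; rewrite <- H3; apply Cmod_Lam).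
  assert (HN2 : / kap <= N /\ 1 <= N).
  { assert (8 * N ^ 2 >= 8 / kap ^ 2) by nra.
    assert ((/ kap) ^ 2 <= N ^ 2) by (replace ((/ kap) ^ 2) with (8 / kap ^ 2 / 8) by (field; lra); lra).
    assert (0 < / kap) by (apply Rinv_0_lt_compat; lra). split; nra. }
  destruct HN2 as [HNk HN1].
  assert (HRI : k0 * N ^ 2 <= 2 * (Re (eta s) * Im (eta s))).
  { assert (E := Re_Lam (eta s)). rewrite H3 in E. change (Re (1 - s)) with (1 + - Re s) in E.
    apply (Rmult_le_reg_l (2 * PI)); [lra|]. rewrite HYN in HXY. lra. }
  assert (HsecR : Re (eta s) <= N) by (eapply Rle_trans; [apply Rle_abs | apply re_le_Cmod]).
  assert (HsecI : Im (eta s) <= N) by (eapply Rle_trans; [apply Rle_abs | apply Im_le_Cmod]).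
  (* The product of the coordinates is at least [kap N^2] and each is at most [N], so each is at
     least [kap N]. *)
  assert (Hsec : in_sector kap (eta s)).
  { split; fold N; apply (Rmult_le_reg_r N); try lra; unfold kap; nra. }
  assert (HkN : 1 <= PI * kap * N).
  { assert (1 <= kap * N) by (replace 1 with (kap * / kap) by (field; lra); apply Rmult_le_compat_l; lra). nra. }
  destruct (RiemannR_lead c s kap Hc Hkap Hsec HN1 HkN HX5) as [delta [Hd ER]].
  destruct (mainterm_lead s ltac:(lra)) as [theta [Ht EM]].
  rewrite ER, EM. fold N in Hd. fold N. fold K in Hd. fold Y in Ht.
  assert (HiN : 0 < / N) by (apply Rinv_0_lt_compat; lra).
  assert (Ht1 : Cmod theta <= 1).
  { eapply Rle_trans; [exact Ht|]. apply (Rmult_le_reg_r Y); [lra|]. replace (34 / Y * Y) with 34 by (field; lra). lra. }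
  assert (Ht2 : Cmod theta <= 34 / N).
  { eapply Rle_trans; [exact Ht|]. unfold Rdiv. apply Rmult_le_compat_l; [lra|]. apply Rinv_le_contravar; [lra|]. rewrite HYN. nra. }
  replace (lead s * (1 + delta) - lead s * cexp theta)%C with (lead s * (delta - (cexp theta - 1)))%C by ring.
  rewrite !Cmod_mult. set (A := Cmod (lead s)). assert (HA : 0 <= A) by apply Cmod_ge_0.
  assert (B1 : Cmod (delta - (cexp theta - 1)) <= (K + 102) / N).
  { eapply Rle_trans; [apply Cmod_triangle_minus|]. pose proof (Cmod_cexp_m1' theta) as HC.
    assert (exp (Cmod theta) <= 3) by (eapply Rle_trans; [apply exp_le; exact Ht1 | exact exp_le_3]).
    pose proof (exp_pos (Cmod theta)). pose proof (Cmod_ge_0 theta).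
    assert (Cmod theta * exp (Cmod theta) <= 34 / N * 3) by (apply Rmult_le_compat; lra).
    unfold Rdiv in *. lra. }
  assert (B2 : 1 <= 3 * Cmod (cexp theta)).
  { rewrite Cmod_cexp. pose proof (re_le_Cmod theta). pose proof (Rle_abs (- Re theta)). rewrite Rabs_Ropp in H0.
    assert (exp (- Re theta) <= 3) by (eapply Rle_trans; [apply exp_le with (b := 1); lra | exact exp_le_3]).
    rewrite exp_Ropp in H7. pose proof (exp_pos (Re theta)).
    apply (Rmult_le_reg_r (/ exp (Re theta))); [apply Rinv_0_lt_compat; lra|].
    replace (3 * exp (Re theta) * / exp (Re theta)) with 3 by (field; lra). lra. }
  assert (HK : 0 <= (K + 102) / N) by (eapply Rle_trans; [apply Cmod_ge_0 | exact B1]).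
  apply Rle_trans with (A * ((K + 102) / N)); [apply Rmult_le_compat_l; assumption|].
  replace (3 * (K + 102) * (A * Cmod (cexp theta)) / N) with (A * ((K + 102) / N) * (3 * Cmod (cexp theta))) by (field; lra).
  assert (0 <= A * ((K + 102) / N)) by (apply Rmult_le_pos; assumption). nra.
Qed.
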